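(* Let $\Gamma=PSL(2;13)$. The joint spectral measure (over $\mathbb{T}^2$) for all embeddings of $\Gamma$ into the fundamental representations of $G_2$ is $$\mathrm{d}\varepsilon = \frac{1}{448\pi^4} J^2 \, \mathrm{d}_7 \times \mathrm{d}_7 + \frac{1}{1152\pi^4} J^2 \, \mathrm{d}_6 \times \mathrm{d}_6 + \frac{1}{4} \, \mathrm{d}_3 \times \mathrm{d}_3 + \frac{1}{9} \, \mathrm{d}_2 \times \mathrm{d}_2 - \frac{22}{819} \, \mathrm{d}_1 \times \mathrm{d}_1 - \frac{1}{12} \, \mathrm{d}^{(1)} + \frac{1}{156} \sum_{g \in D_{12}} (\delta_{g(\zeta,\zeta^4)} + \delta_{g(\zeta^2,\zeta^7)})$$ for $\zeta$ a primitive 13-th root of unity.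
   Context: $G_2$ is the compact simply connected simple Lie group of dimension 14, with fundamental representations $\rho_1$, $\rho_2$ of dimensions 7 and 14. Its maximal torus is identified with $\mathbb{T}^2$ so that, for $(\omega_1,\omega_2)=(e^{2\pi i\theta_1},e^{2\pi i\theta_2})\in\mathbb{T}^2$, $$\chi_{\rho_1} = 1 + \omega_1 + \omega_1^{-1} + \omega_2 + \omega_2^{-1} + \omega_1\omega_2^{-1} + \omega_1^{-1}\omega_2,$$ $$\chi_{\rho_2} = \chi_{\rho_1} + 1 + \omega_1\omega_2 + \omega_1^{-1}\omega_2^{-1} + \omega_1^2\omega_2^{-1} + \omega_1^{-2}\omega_2 + \omega_1\omega_2^{-2} + \omega_1^{-1}\omega_2^2 .$$ The Weyl group $D_{12}$ of $G_2$ (dihedral of order 12) is the subgroup of $GL(2,\mathbb{Z})$ generated by $T_2=\begin{pmatrix}0&-1\\-1&0\end{pmatrix}$ and $T_6=\begin{pmatrix}0&1\\-1&1\end{pmatrix}$, acting on $\mathbb{T}^2$ by $T(\omega_1,\omega_2)=(\omega_1^{a_{11}}\omega_2^{a_{12}},\omega_1^{a_{21}}\omega_2^{a_{22}})$ for $T=(a_{il})$. An embedding of a finite group $\Gamma$ in $G_2$ is an injective homomorphism $\iota:\Gamma\to G_2$; put $\varrho_j=\rho_j\circ\iota$, $j=1,2$. Let $\Delta_j$ be the adjacency matrix of the McKay graph of $\varrho_j$ (the matrix of tensoring with $\varrho_j$ on the irreducible representations of $\Gamma$), and $e_{\ast}$ the basis vector of the trivial representation. The joint spectral measure over $\mathbb{T}^2$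 of the embedding is the unique $D_{12}$-invariant probability measure $\varepsilon$ on $\mathbb{T}^2$ such that for all integers $m,n\geq 0$ $$\int_{\mathbb{T}^2}\chi_{\rho_1}^m\chi_{\rho_2}^n\,\mathrm{d}\varepsilon=\langle\Delta_1^m\Delta_2^n e_\ast,e_\ast\rangle=\sum_C\frac{|C|}{|\Gamma|}\chi_{\varrho_1}(C)^m\chi_{\varrho_2}(C)^n,$$ the sum being over the conjugacy classes $C$ of $\Gamma$. Notation for measures on $\mathbb{T}^2$: $\mathrm{d}_k$ is the uniform probability measure on the $k$-th roots of unity; $\mathrm{d}^{(n)}$ is the uniform probability measure on $\{(e^{2\pi i q_1/3n},e^{2\pi i q_2/3n}) : q_1,q_2\in\{0,1,\ldots,3n-1\},\ q_1+q_2\equiv 0 \bmod 3\}$; $\delta_x$ is the Dirac measure at $x$. A function multiplying a measure is a density, and functions on $\mathbb{T}^2$ are written in the coordinates $\theta_1,\theta_2$. The function $J$ is $$J = 8\pi^2\big(\cos 2\pi(2\theta_1+\theta_2)+\cos 2\pi(\theta_1-3\theta_2)+\cos 2\pi(3\theta_1-2\theta_2)-\cos 2\pi(\theta_1+2\theta_2)-\cos 2\pi(3\theta_1-\theta_2)-\cos 2\pi(2\theta_1-3\theta_2)\big).$$ $PSL(2;13)$ is the projective special linear group of degree 2 over the field with 13 elements, of order 1092. *)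

(* Defs.v *)
From HB Require Import structures.
From mathcomp Require Import all_boot all_order all_algebra all_fingroup.
From mathcomp Require Import all_solvable all_field all_character.
From mathcomp Require Import complex ring.
From mathcomp Require Import all_classical all_reals all_analysis.

Set Implicit Arguments.
Unset Strict Implicit.
Unset Printing Implicit Defensive.
Import Order.TTheory GRing.Theory Num.Theory.
Import numFieldNormedType.Exports.

Local Open Scope classical_set_scope.
Local Open Scope complex_scope.
Local Open Scope ring_scope.

Section Circle.
Variable R : realType.

Record circle := Circle { cval : R[i] ; cvalP : `|cval| == 1 }.

HB.instance Definition _ := [isSub for cval].
HB.instance Definition _ := [Choice of circle by <:].

Lemma circle1_subproof : `|1 : R[i]| == 1.
Proof. by rewrite normr1. Qed.

HB.instance Definition _ := isPointed.Build circle (Circle circle1_subproof).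

Definition circle_coord (z : circle) : measurableTypeR R * measurableTypeR R :=
  (complex.Re (cval z), complex.Im (cval z)).

(* The Borel sigma-algebra, as the trace on the circle of that of R * R. *)
HB.instance Definition _ :=
  Measurable.copy circle (g_sigma_algebra_preimageType circle_coord).

Lemma circle_mul_subproof (z w : circle) : `|cval z * cval w| == 1.
Proof. by rewrite normrM (eqP (cvalP z)) (eqP (cvalP w)) mulr1. Qed.

Definition circle_mul (z w : circle) : circle :=
  Circle (circle_mul_subproof z w).

Lemma circle_exp_subproof (z : circle) (a : int) : `|cval z ^ a| == 1.
Proof.
case: z => z /= /eqP hz.
case: a => n; first by rewrite -exprnP normrX hz expr1n.
by rewrite NegzE -exprnN normfV normrX hz expr1n invr1.
Qed.

Definition circle_exp (z : circle) (a : int) : circle :=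
  Circle (circle_exp_subproof z a).

Lemma cis_subproof (t : R) : `|cos (2 * pi * t) +i* sin (2 * pi * t)| == 1.
Proof. by rewrite normc_def /= cos2Dsin2 sqrtr1. Qed.

(* e ^ (2 i pi t) *)
Definition cis (t : R) : circle := Circle (cis_subproof t).

(* The coordinate theta in [0, 1[ of a point of the circle. *)
Definition theta (z : circle) : R := xget 0 [set t : R | 0 <= t < 1 /\ cis t = z].

End Circle.

Notation torus R := (circle R * circle R)%type.

Section Weyl.

Definition T2 : 'M[int]_2 :=
  \matrix_(i, j) nth 0 (nth [::] [:: [:: 0; -1]; [:: -1; 0]] i) j.

Definition T6 : 'M[int]_2 :=
  \matrix_(i, j) nth 0 (nth [::] [:: [:: 0; 1]; [:: -1; 1]] i) j.

Inductive weyl : 'M[int]_2 -> Prop :=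
| weyl_T2 : weyl T2
| weyl_T6 : weyl T6
| weyl1 : weyl 1
| weylM (g h : 'M[int]_2) : weyl g -> weyl h -> weyl (g * h)
| weylV (g : 'M[int]_2) : weyl g -> weyl g^-1.

Definition D12 : set 'M[int]_2 := [set g | weyl g].

Definition torus_act (R : realType) (g : 'M[int]_2) (w : torus R) : torus R :=
  (circle_mul (circle_exp w.1 (g 0 0)) (circle_exp w.2 (g 0 1)),
   circle_mul (circle_exp w.1 (g 1 0)) (circle_exp w.2 (g 1 1))).

End Weyl.

Section TorusFunctions.
Variable R : realType.
Implicit Type w : torus R.

Definition chi_rho1 w : R[i] :=
  let w1 := cval w.1 in let w2 := cval w.2 in
  1 + w1 + w1^-1 + w2 + w2^-1 + w1 * w2^-1 + w1^-1 * w2.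

Definition chi_rho2 w : R[i] :=
  let w1 := cval w.1 in let w2 := cval w.2 in
  chi_rho1 w + 1 + w1 * w2 + w1^-1 * w2^-1 + w1 ^+ 2 * w2^-1
    + w1 ^- 2 * w2 + w1 * w2 ^- 2 + w1^-1 * w2 ^+ 2.

Definition J_angle (t1 t2 : R) : R :=
  8 * pi ^+ 2 *
    (cos (2 * pi * (2 * t1 + t2)) + cos (2 * pi * (t1 - 3 * t2))
     + cos (2 * pi * (3 * t1 - 2 * t2)) - cos (2 * pi * (t1 + 2 * t2))
     - cos (2 * pi * (3 * t1 - t2)) - cos (2 * pi * (2 * t1 - 3 * t2))).

Definition J w : R := J_angle (theta w.1) (theta w.2).

End TorusFunctions.

Section Measures.
Context {d : measure_display} {T : measurableType d} {R : realType}.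

Definition unif_weight (s : seq T) : {nonneg R} := ((size s)%:R^-1)%:nng.

(* The uniform probability measure on the points listed in s, which are
   meant to be pairwise distinct. *)
Definition unif (s : seq T) : set T -> \bar R :=
  mscale (unif_weight s) (msum (fun i => \d_(nth point s i)) (size s)).

HB.instance Definition _ (s : seq T) := Measure.on (unif s).

Lemma unif_fin_num (s : seq T) : fin_num_fun (unif s).
Proof.
move=> A mA; rewrite /unif /mscale /msum fin_numM//.
by apply/sum_fin_numP => i _ _; exact: fin_num_measure.
Qed.

HB.instance Definition _ (s : seq T) :=
  Measure_isFinite.Build _ T R (unif s) (unif_fin_num s).

Definition complex_integral (mu : {measure set T -> \bar R}) (f : T -> R[i]) :
    R[i] :=
  (\int[mu]_t complex.Re (f t)) +i* (\int[mu]_t complex.Im (f t)).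

End Measures.

Section RootMeasures.
Variable R : realType.

Definition d_root (k : nat) : {finite_measure set (circle R) -> \bar R} :=
  unif [seq cis (j%:R / k%:R : R) | j <- iota 0 k].

Definition d_diag (n : nat) : {finite_measure set (torus R) -> \bar R} :=
  unif [seq (cis (q.1%:R / (3 * n)%N%:R : R), cis (q.2%:R / (3 * n)%N%:R : R))
       | q <- [seq (q1, q2) | q1 <- iota 0 (3 * n)%N, q2 <- iota 0 (3 * n)%N]
       & (3 %| q.1 + q.2)%N].

End RootMeasures.

Section G2.
Variable R : realType.
Implicit Types (x y z : 'rV[R]_7) (A X : 'M[R]_7).

Definition wedge3 (i j k : nat) x y z : R :=
  let c (u : 'rV[R]_7) n := u 0 (inord n) in
  c x i * (c y j * c z k - c y k * c z j)
  - c x j * (c y i * c z k - c y k * c z i)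
  + c x k * (c y i * c z j - c y j * c z i).

(* The triple product (x, y, z) |-> <x y, z> of the imaginary octonions, that is
   e123 + e145 + e167 + e246 - e257 - e347 - e356 in indices starting at 1. *)
Definition oct3 x y z : R :=
  wedge3 0 1 2 x y z + wedge3 0 3 4 x y z + wedge3 0 5 6 x y z
  + wedge3 1 3 5 x y z - wedge3 1 4 6 x y z
  - wedge3 2 3 6 x y z - wedge3 2 4 5 x y z.

(* The automorphism group of the octonions acting, on the right, on the row
   vectors of imaginary octonions: the product of two imaginary octonions is
   determined by the scalar product and by oct3. *)
Definition G2 : set 'M[R]_7 :=
  [set A | A *m A^T = 1%:M /\
           forall x y z, oct3 (x *m A) (y *m A) (z *m A) = oct3 x y z].

(* The Lie algebra of G2, obtained by linearising the equations of G2 at 1. *)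
Definition g2 : set 'M[R]_7 :=
  [set X | X + X^T = 0 /\
    forall x y z, oct3 (x *m X) y z + oct3 x (y *m X) z + oct3 x y (z *m X) = 0].

Definition skew_eqn X : 'M[R]_7 := X + X^T.

Definition deriv_eqn (t : 'I_7 * 'I_7 * 'I_7) X : 'M[R]_1 :=
  let e i : 'rV[R]_7 := delta_mx 0 i in
  let: (i, j, k) := t in
  (oct3 (e i *m X) (e j) (e k) + oct3 (e i) (e j *m X) (e k)
   + oct3 (e i) (e j) (e k *m X))%:M.

(* Its row space is g2, with matrices flattened by mxvec; see g2_mxP. *)
Definition g2_mx : 'M[R]_(7 * 7) :=
  (kermx (lin_mx skew_eqn)
   :&: \bigcap_(t : 'I_7 * 'I_7 * 'I_7) kermx (lin_mx (deriv_eqn t)))%MS.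

Lemma oct3D1 a x x' y z : oct3 (a *: x + x') y z = a * oct3 x y z + oct3 x' y z.
Proof. by rewrite /oct3 /wedge3 !mxE; ring. Qed.

Lemma oct3D2 a x y y' z : oct3 x (a *: y + y') z = a * oct3 x y z + oct3 x y' z.
Proof. by rewrite /oct3 /wedge3 !mxE; ring. Qed.

Lemma oct3D3 a x y z z' : oct3 x y (a *: z + z') = a * oct3 x y z + oct3 x y z'.
Proof. by rewrite /oct3 /wedge3 !mxE; ring. Qed.

Lemma skew_eqn_linear : linear skew_eqn.
Proof. by move=> a X Y; rewrite /skew_eqn linearP /= scalerDr addrACA. Qed.

Lemma deriv_eqn_linear t : linear (deriv_eqn t).
Proof.
case: t => -[i j] k a X Y; rewrite /deriv_eqn !mulmxDr -!scalemxAr.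
rewrite oct3D1 oct3D2 oct3D3; apply/matrixP => u v.
by rewrite !mxE !ord1 eqxx !mulr1n; ring.
Qed.

HB.instance Definition _ :=
  GRing.isLinear.Build R 'M[R]_7 'M[R]_7 _ skew_eqn skew_eqn_linear.
HB.instance Definition _ t :=
  GRing.isLinear.Build R 'M[R]_7 'M[R]_1 _ (deriv_eqn t) (deriv_eqn_linear t).

Lemma linear_row_eq0 (f : 'rV[R]_7 -> R) :
  (forall a x y, f (a *: x + y) = a * f x + f y) ->
  (forall i, f (delta_mx 0 i) = 0) -> forall x, f x = 0.
Proof.
move=> flin fe x; have f0 : f 0 = 0.
  by have := flin (-1) 0 0; rewrite scaler0 addr0 mulN1r addNr.
rewrite (row_sum_delta x); elim/big_rec : _ => // i u _ fu.
by rewrite flin fe fu mulr0 addr0.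
Qed.

Lemma g2_mxP X : (mxvec X <= g2_mx)%MS <-> g2 X.
Proof.
rewrite sub_capmx; split.
  move=> /andP[/sub_kermxP]; rewrite mul_vec_lin => /(canRL mxvecK).
  rewrite linear0 => skX /sub_bigcapmxP derX; split=> // x y z.
  have {}derX i j k : oct3 (delta_mx 0 i *m X) (delta_mx 0 j) (delta_mx 0 k)
      + oct3 (delta_mx 0 i) (delta_mx 0 j *m X) (delta_mx 0 k)
      + oct3 (delta_mx 0 i) (delta_mx 0 j) (delta_mx 0 k *m X) = 0.
    have /sub_kermxP := derX (i, j, k) isT.
    rewrite mul_vec_lin => /(canRL mxvecK); rewrite linear0.
    by move=> /matrixP/(_ 0 0); rewrite !mxE eqxx mulr1n.
  pose f x y z := oct3 (x *m X) y z + oct3 x (y *m X) z + oct3 x y (z *m X).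
  rewrite -/(f x y z).
  move: x; apply: linear_row_eq0 => [a x x'|i].
    by rewrite /f !mulmxDl -!scalemxAl !oct3D1; ring.
  move: y; apply: linear_row_eq0 => [a y y'|j].
    by rewrite /f !mulmxDl -!scalemxAl !oct3D2; ring.
  move: z; apply: linear_row_eq0 => [a z z'|k]; last exact: derX.
  by rewrite /f !mulmxDl -!scalemxAl !oct3D3; ring.
move=> [skX derX]; apply/andP; split.
  by apply/sub_kermxP; rewrite mul_vec_lin /= /skew_eqn skX linear0.
apply/sub_bigcapmxP => -[[i j] k] _; apply/sub_kermxP.
by rewrite mul_vec_lin /= /deriv_eqn derX raddf0 linear0.
Qed.

Definition Ad A X : 'M[R]_7 := invmx A *m X *m A.

Lemma Ad_linear A : linear (Ad A).
Proof. by move=> a X Y; rewrite /Ad mulmxDr mulmxDl -scalemxAr -scalemxAl. Qed.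

HB.instance Definition _ A :=
  GRing.isLinear.Build R 'M[R]_7 'M[R]_7 _ (Ad A) (Ad_linear A).

Definition rho1 A : 'M[R[i]]_7 := map_mx (real_complex R) A.

(* The complexified adjoint representation; \rank g2_mx is 14. *)
Definition rho2 A : 'M[R[i]]_(\rank g2_mx) :=
  map_mx (real_complex R)
    (in_submod g2_mx (@val_submod _ _ g2_mx _ 1%:M *m lin_mx (Ad A))).

Lemma g2_Ad A X : G2 A -> g2 X -> g2 (Ad A X).
Proof.
move=> [AAT GA] [skX derX]; have [uA _] := mulmx1_unit AAT.
have AV : invmx A = A^T by rewrite -[invmx A]mulmx1 -AAT mulKmx.
split.
  rewrite /Ad AV !trmx_mul trmxK [A^T *m (_ *m A)]mulmxA -mulmxDl -mulmxDr.
  by rewrite skX mulmx0 mul0mx.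
have AdE u : u *m Ad A X = u *m invmx A *m X *m A by rewrite /Ad !mulmxA.
move=> x y z; rewrite !AdE.
have := derX (x *m invmx A) (y *m invmx A) (z *m invmx A).
rewrite -(GA (x *m _ *m X)) -(GA _ (y *m _ *m X)) -(GA _ _ (z *m _ *m X)).
by rewrite !mulmxKV.
Qed.

End G2.

Record G2_embedding (R : realType) (gT : finGroupType) (G : {group gT}) :=
  G2Embedding {
    emb :> gT -> 'M[R]_7;
    emb_G2 : forall x, x \in G -> G2 (emb x);
    embM : forall x y, x \in G -> y \in G -> emb (x * y)%g = emb x *m emb y;
    emb_inj : {in G &, injective emb}
  }.

Section Restriction.
Variables (R : realType) (gT : finGroupType) (G : {group gT}).
Variable iota : G2_embedding R G.

Lemma emb1 : iota 1%g = 1%:M.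
Proof.
have [] := emb_G2 iota (group1 G); set A := iota _ => AAT _.
have : A *m A = A by rewrite -(embM iota) ?group1// mulg1.
by move=> /(congr1 (mulmx^~ A^T)); rewrite -mulmxA AAT mulmx1.
Qed.

Lemma emb_unit x : x \in G -> iota x \in unitmx.
Proof. by move=> /(emb_G2 iota)[/mulmx1_unit[]]. Qed.

Lemma rho1_mx_repr : mx_repr G (fun g => rho1 (iota g)).
Proof.
split=> [|x y Gx Gy]; rewrite /rho1 /=; first by rewrite emb1 map_mx1.
by rewrite embM// map_mxM.
Qed.

Lemma rho2_mx_repr : mx_repr G (fun g => rho2 (iota g)).
Proof.
pose L A : 'M[R]_(7 * 7) := lin_mx (Ad A).
have LE A X : mxvec X *m L A = mxvec (Ad A X) by rewrite mul_vec_lin.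
have L_repr : mx_repr G (fun g => L (iota g)).
  split=> [|x y Gx Gy]; apply/row_matrixP => i; rewrite !rowE; set v := delta_mx _ _.
    by rewrite -[v]vec_mxK /= LE /Ad emb1 invmx1 mulmx1 mul1mx mulmx1.
  rewrite -[v]vec_mxK /= mulmxA !LE; congr mxvec.
  have [ux uy] := (emb_unit Gx, emb_unit Gy).
  have invxy : invmx (iota (x * y)%g) = invmx (iota y) *m invmx (iota x).
    apply: (can_inj (mulmxK (emb_unit (groupM Gx Gy)))).
    rewrite mulVmx ?emb_unit ?groupM// embM// mulmxA -(mulmxA _ (invmx _)).
    by rewrite mulVmx// mulmx1 mulVmx.
  by rewrite /Ad invxy embM// !mulmxA.
pose LG := MxRepresentation L_repr.
have modL : mxmodule LG (g2_mx R).
  apply/mxmoduleP => x Gx; apply/row_subP => i; rewrite row_mul.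
  rewrite -[row i _]vec_mxK LE; apply/g2_mxP/g2_Ad; first exact: emb_G2 Gx.
  by apply/g2_mxP; rewrite vec_mxK row_sub.
have [h1 hM] := submod_mx_repr modL.
split=> [|x y Gx Gy]; rewrite /rho2 /=.
  by rewrite (h1 : in_submod _ _ = _) map_mx1.
by rewrite -map_mxM -[in RHS](hM x y Gx Gy).
Qed.

Definition rho2_repr := MxRepresentation rho2_mx_repr.

Definition rho1_repr := MxRepresentation rho1_mx_repr.

End Restriction.

Section McKay.
Variables (F : closedFieldType) (gT : finGroupType) (G : {group gT}).

Definition irreps : irrType F G := DecSocleType (regular_repr F G).

(* The multiplicity of the irreducible representation i in rG (compare
   standard_irr_coef in mathcomp.character, which is specific to algC). *)
Definition irr_mult n (rG : mx_representation F G n) (i : irreps) : nat :=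
  let sG := DecSocleType rG in
  oapp (fun W : sG => socle_mult W) 0%N
    [pick W : sG | irr_comp irreps (socle_repr W) == i].

Definition mckay_mx n (rG : mx_representation F G n) : 'M[F]_#|irreps| :=
  \matrix_(i, j)
    (irr_mult (prod_repr (irr_repr (enum_val i)) rG) (enum_val j))%:R.

Definition trivial_index : 'I_#|irreps| := enum_rank [1 irreps]%irr.

End McKay.

Section JointSpectralMeasure.
Variables (R : realType) (gT : finGroupType) (G : {group gT}).
Variable iota : G2_embedding R G.

Definition D12_invariant (eps : probability (torus R) R) : Prop :=
  forall g A, D12 g -> measurable A -> eps (torus_act g @^-1` A) = eps A.

Definition joint_moment (eps : probability (torus R) R) (m n : nat) : R[i] :=
  complex_integral eps (fun w => chi_rho1 w ^+ m * chi_rho2 w ^+ n).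

Definition mckay_moment (m n : nat) : R[i] :=
  let e := trivial_index R[i] G in
  (mckay_mx (rho1_repr iota) ^+ m *m mckay_mx (rho2_repr iota) ^+ n) e e.

Definition class_moment (m n : nat) : R[i] :=
  \sum_(C in classes G)
    #|C|%:R / #|G|%:R * (\tr (rho1_repr iota (repr C)) ^+ m
                         * \tr (rho2_repr iota (repr C)) ^+ n).

Definition joint_spectral_spec (eps : probability (torus R) R) : Prop :=
  D12_invariant eps /\
  forall m n, joint_moment eps m n = mckay_moment m n /\
              mckay_moment m n = class_moment m n.

Definition joint_spectral_measure (eps : probability (torus R) R) : Prop :=
  joint_spectral_spec eps /\
  forall eps', joint_spectral_spec eps' ->
    forall A, measurable A -> eps' A = eps A.

End JointSpectralMeasure.

Section PSL.
Variable F : finFieldType.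

Definition SL2 : {set {'GL_2[F]}} := [set g | \det (GLval g) == 1]%SET.

Lemma SL2_group_set : group_set SL2.
Proof.
apply/group_setP; split=> [|g h]; first by rewrite inE det1.
by rewrite !inE => /eqP dg /eqP dh; rewrite /= det_mulmx dg dh mulr1.
Qed.

Canonical SL2_group := Group SL2_group_set.

Definition PSL2 : {group coset_of 'Z(SL2)} := (SL2 / 'Z(SL2))%G.

End PSL.

(* Main.v *)
Require Import Defs.
From HB Require Import structures.
From mathcomp Require Import all_boot all_order all_algebra all_fingroup.
From mathcomp Require Import all_solvable all_field all_character.
From mathcomp Require Import complex ring lra zify.
From mathcomp Require Import all_classical all_reals all_analysis.
From mathcomp Require Import measurable_realfun.

Set Implicit Arguments.
Unset Strict Implicit.
Unset Printing Implicit Defensive.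
Import Order.TTheory GRing.Theory Num.Theory.
Import numFieldNormedType.Exports.

Local Open Scope ring_scope.

Lemma mxtrace_idem (F : fieldType) n (P : 'M[F]_n) :
  P *m P = P -> \tr P = (\rank P)%:R.
Proof.
move=> PP; have CB := mulmx_base P.
have [C' C'C] : exists C', C' *m col_base P = 1%:M.
  by apply/row_fullP; exact: col_base_full.
have [B' BB'] : exists B', row_base P *m B' = 1%:M.
  by apply/row_freeP; exact: row_base_free.
move: (col_base P) (row_base P) CB C'C BB' => C B CB C'C BB'.
suff BC : B *m C = 1%:M by rewrite -{1}CB mxtrace_mulC BC mxtrace1.
have : C' *m (C *m B *m (C *m B)) *m B' = C' *m (C *m B) *m B' by rewrite CB PP.
by rewrite !mulmxA C'C !mul1mx -!mulmxA BB' mulmx1.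
Qed.

Lemma scalerVMn (F : fieldType) (V : lmodType F) (v : V) n :
  n%:R != 0 :> F -> n%:R^-1 *: (v *+ n) = v.
Proof. by move=> n0; rewrite -scaler_nat scalerA mulVf// scale1r. Qed.

Section Average.
Variables (F : fieldType) (gT : finGroupType) (G : {group gT}) (n : nat).
Variable rG : mx_representation F G n.
Implicit Types H K : {group gT}.

Definition avg (H : {set gT}) : 'M[F]_n :=
  #|H|%:R^-1 *: \sum_(x in H) rG x.

Lemma avgMr H x : H \subset G -> x \in H -> avg H *m rG x = avg H.
Proof.
move=> HG Hx; rewrite /avg -scalemxAl mulmx_suml; congr (_ *: _).
rewrite [RHS](reindex_inj (mulIg x)) /=.
rewrite [RHS](eq_bigl (mem H)) => [|y]; last by rewrite /= groupMr.
by apply: eq_bigr => y Hy; rewrite repr_mxM ?(fintype.subsetP HG).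
Qed.

Lemma avgMl H x : H \subset G -> x \in H -> rG x *m avg H = avg H.
Proof.
move=> HG Hx; rewrite /avg -scalemxAr mulmx_sumr; congr (_ *: _).
rewrite [RHS](reindex_inj (mulgI x)) /=.
rewrite [RHS](eq_bigl (mem H)) => [|y]; last by rewrite /= groupMl.
by apply: eq_bigr => y Hy; rewrite repr_mxM ?(fintype.subsetP HG).
Qed.

Lemma avgM H K : #|K|%:R != 0 :> F -> H \subset G -> K \subset H ->
  avg H *m avg K = avg H.
Proof.
move=> K0 HG KH; rewrite {2}/avg -scalemxAr mulmx_sumr.
rewrite (eq_bigr (fun=> avg H)) => [|x Kx]; last by rewrite avgMr// (fintype.subsetP KH).
by rewrite sumr_const scalerVMn.
Qed.

Lemma avg_norm H x : H \subset G -> x \in G -> x \in 'N(H)%g ->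
  avg H *m rG x = rG x *m avg H.
Proof.
move=> HG Gx Nx; rewrite /avg -scalemxAl -scalemxAr; congr (_ *: _).
rewrite mulmx_suml mulmx_sumr [RHS](reindex_inj (conjg_inj x)) /=.
rewrite [RHS](eq_bigl (mem H)) => [|y]; last by rewrite /= memJ_norm.
apply: eq_bigr => y Hy; have Gy := fintype.subsetP HG _ Hy.
by rewrite -!repr_mxM ?groupJ// -conjgC.
Qed.

Lemma mxtrace_avg H : \tr (avg H) = #|H|%:R^-1 * \sum_(x in H) \tr (rG x).
Proof. by rewrite /avg mxtraceZ raddf_sum. Qed.

Lemma mxtrace_avg_rank H : #|H|%:R != 0 :> F -> H \subset G ->
  \tr (avg H) = (\rank (avg H))%:R.
Proof. by move=> H0 HG; apply: mxtrace_idem; exact: avgM. Qed.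

End Average.

Section McKayMoment.
Variables (F : closedFieldType) (gT : finGroupType) (G : {group gT}).
Hypothesis F'G : ([pchar F]^'.-group G)%g.
Local Notation iG := (irreps F G).

Lemma mxtrace_irr_mult n (rG : mx_representation F G n) x : x \in G ->
  \tr (rG x) = \sum_(i : iG) (irr_mult rG i)%:R * \tr (irr_repr i x).
Proof.
move=> Gx; pose sG := DecSocleType rG.
have S1 : (Socle sG :=: 1%:M)%MS.
  by rewrite (reducible_Socle1 sG (mx_Maschke_pchar rG F'G)).
rewrite -(mxtrace_submod1 (Socle_module sG) S1)// mxtrace_Socle//.
pose h (W : sG) : iG := irr_comp iG (socle_repr W).
have hW (W : sG) : mx_rsim (socle_repr W) (irr_repr (h W)).
  exact: rsim_irr_comp_pchar (socle_irr W).
have h_inj : injective h.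
  move=> V W hVW; apply/eqP/socle_rsimP; apply: mx_rsim_trans (hW V) _.
  by rewrite hVW; apply: mx_rsim_sym.
rewrite (eq_bigr (fun W => (socle_mult W)%:R * \tr (irr_repr (h W) x))); last first.
  by move=> W _; rewrite (mxtrace_rsim (hW W))// mulr_natl.
rewrite (partition_big h xpredT) //=; apply: eq_bigr => i _.
rewrite /irr_mult; case: pickP => [W /eqP hWi|noW] /=.
  rewrite (big_pred1 W) => [|V]; first by rewrite [h W]hWi.
  by rewrite /= -hWi (inj_eq h_inj).
rewrite big_pred0 ?mul0r// => W; exact: noW.
Qed.

Lemma sum_irr_repr (i : iG) :
  \sum_(x in G) irr_repr i x = if i == [1 iG]%irr then #|G|%:R%:M else 0.
Proof.
case: eqVneq => [->|ne1].
  by rewrite (eq_bigr (fun=> 1%:M)) ?sumr_const ?raddfMn// => x Gx; rewrite irr1_repr.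
pose aG := regular_repr F G.
pose A := \sum_(x in G) aG x.
have Aop : gring_op (irr_repr i) A = \sum_(x in G) irr_repr i x.
  by rewrite /A linear_sum; apply: eq_bigr => x Gx; exact: gring_opG.
rewrite -Aop; apply: (irr_repr'_op0_pchar F'G (j := [1 iG]%irr)); first by rewrite eq_sym.
have AR : (A \in enveloping_algebra_mx aG)%MS.
  by apply/envelop_mxP; exists (fun=> 1); apply: eq_bigr => x _; rewrite scale1r.
rewrite -(gring_rowK AR) genmxE mem_gring_mx.
rewrite irr1_rfix; apply/rfix_mxP => x Gx.
rewrite -gring_row_mul; congr gring_row.
rewrite /A mulmx_suml [RHS](reindex_inj (mulIg x)) /=.
rewrite [RHS](eq_bigl (mem G)) => [|y]; last by rewrite /= groupMr.
by apply: eq_bigr => y Gy; rewrite repr_mxM.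
Qed.

Lemma mckay_mx_eigen n (rG : mx_representation F G n) x : x \in G ->
  mckay_mx rG *m (\col_j \tr (irr_repr (enum_val j : iG) x))
  = \tr (rG x) *: \col_j \tr (irr_repr (enum_val j : iG) x).
Proof.
move=> Gx; apply/colP => k; rewrite !mxE mulrC.
rewrite -[LHS]/(_) -mxtrace_prod.
have := mxtrace_irr_mult (prod_repr (irr_repr (enum_val k : iG)) rG) Gx.
rewrite /= => ->; rewrite (reindex _ (onW_bij _ (enum_val_bij iG))) /=.
by apply: eq_bigr => j _; rewrite !mxE.
Qed.

Lemma mckay_mx_moment n1 n2 (rG1 : mx_representation F G n1)
    (rG2 : mx_representation F G n2) (m n : nat) :
  let e := trivial_index F G in
  (mckay_mx rG1 ^+ m *m mckay_mx rG2 ^+ n) e e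
  = #|G|%:R^-1 * \sum_(x in G) \tr (rG1 x) ^+ m * \tr (rG2 x) ^+ n.
Proof.
move=> e; set M := _ *m _.
pose v x : 'cV[F]_#|iG| := \col_j \tr (irr_repr (enum_val j : iG) x).
have eigX k (A : 'M[F]_#|iG|) (c : F) (w : 'cV_#|iG|) :
    A *m w = c *: w -> A ^+ k *m w = c ^+ k *: w.
  move=> Aw; elim: k => [|k IHk]; first by rewrite !expr0 scale1r mul1mx.
  by rewrite exprSr -mulmxA Aw -scalemxAr IHk scalerA -exprS.
have Mv x : x \in G -> M *m v x = (\tr (rG1 x) ^+ m * \tr (rG2 x) ^+ n) *: v x.
  move=> Gx; rewrite -mulmxA (eigX _ _ _ _ (mckay_mx_eigen rG2 Gx)) -scalemxAr.
  by rewrite (eigX _ _ _ _ (mckay_mx_eigen rG1 Gx)) scalerA mulrC.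
have ve x : x \in G -> v x e 0 = 1.
  by move=> Gx; rewrite mxE enum_rankK irr1_repr// mxtrace1 degree_irr1.
have sumv : \sum_(x in G) v x = #|G|%:R *: delta_mx e 0.
  apply/colP => j; rewrite summxE.
  under eq_bigr do rewrite mxE.
  rewrite -raddf_sum /= sum_irr_repr !mxE eqxx andbT -(inj_eq enum_val_inj) enum_rankK.
  case: eqVneq => [->|_]; last by rewrite raddf0 mulr0.
  by rewrite mxtrace_scalar degree_irr1 mulr1.
have G0 : #|G|%:R != 0 :> F by rewrite -pcharf'_nat.
apply: (mulfI G0); rewrite mulrA mulfV// mul1r.
transitivity ((M *m (\sum_(x in G) v x)) e 0).
  by rewrite sumv -scalemxAr [RHS]mxE -colE [in RHS]mxE.
rewrite mulmx_sumr summxE; apply: eq_bigr => x Gx.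
by rewrite Mv// mxE ve// mulr1.
Qed.

End McKayMoment.

Lemma class_sum (V : nmodType) (gT : finGroupType) (G : {group gT}) (f : gT -> V) :
  (forall x y, x \in G -> y \in G -> f (x ^ y)%g = f x) ->
  \sum_(C in classes G) f (repr C) *+ #|C| = \sum_(x in G) f x.
Proof.
move=> fJ; rewrite (partition_big (class^~ G) (mem (classes G))) /=; last first.
  by move=> x Gx; exact: mem_classes.
apply: eq_bigr => _ /imsetP[x Gx ->].
rewrite -sumr_const; have [y Gy ->] := repr_class G x; rewrite fJ//.
rewrite (eq_bigl (fun z => (z \in G) && (z ^: G == x ^: G)%g)); last first.
  move=> z; apply/idP/andP => [zx|[Gz /eqP <-]]; last exact: class_refl.
  split; last by apply/eqP/class_eqP.
  by have /imsetP[g Gg ->] := zx; rewrite groupJ.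
apply: eq_bigr => z /andP[Gz /eqP zx].
have /imsetP[g Gg ->] : z \in (x ^: G)%g by rewrite -zx class_refl.
by rewrite fJ.
Qed.

Section Matrices22.
Variable F : comRingType.

Definition mx22 (a b c d : F) : 'M[F]_2 :=
  \matrix_(i, j) if i == 0 then if j == 0 then a else b
                 else if j == 0 then c else d.

Lemma mx22_eq (A B : 'M[F]_2) : A 0 0 = B 0 0 -> A 0 1 = B 0 1 ->
  A 1 0 = B 1 0 -> A 1 1 = B 1 1 -> A = B.
Proof.
have ord2 (i : 'I_2) : (i = 0) \/ (i = 1).
  by case: i => [[|[|//]] ?]; [left|right]; apply: val_inj.
move=> e00 e01 e10 e11; apply/matrixP => i j.
by case: (ord2 i) => ->; case: (ord2 j) => ->.
Qed.

Lemma mx22E (A : 'M[F]_2) : A = mx22 (A 0 0) (A 0 1) (A 1 0) (A 1 1).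
Proof. by apply: mx22_eq; rewrite mxE. Qed.

Lemma mx22M a b c d a' b' c' d' : mx22 a b c d *m mx22 a' b' c' d' =
  mx22 (a * a' + b * c') (a * b' + b * d') (c * a' + d * c') (c * b' + d * d').
Proof. by apply: mx22_eq; rewrite !mxE !big_ord_recl big_ord0 !mxE /= addr0. Qed.

Lemma mx22_1 : mx22 1 0 0 1 = 1%:M.
Proof. by apply: mx22_eq; rewrite !mxE. Qed.

Lemma det_mx22 a b c d : \det (mx22 a b c d) = a * d - b * c.
Proof.
rewrite (expand_det_row _ 0) !big_ord_recl big_ord0 addr0 /cofactor.
rewrite !det_mx11 !mxE /= expr0 expr1; ring.
Qed.

End Matrices22.

Local Notation quad := (nat * nat * nat * nat)%type.

Section SL2_13.
Local Notation F := 'F_13.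
Local Notation GL := {'GL_2['F_13]}.

Lemma F13_mod m : (m %% 13)%:R = m%:R :> F.
Proof. by rewrite Fp_nat_mod. Qed.

Lemma F13_eq m n : (m == n %[mod 13])%N -> m%:R = n%:R :> F.
Proof. by move=> /eqP e; rewrite -F13_mod e F13_mod. Qed.

Lemma F13_inj m n : m%:R = n%:R :> F -> (m == n %[mod 13])%N.
Proof. by move=> /(congr1 val); rewrite /= !val_Fp_nat// => ->. Qed.

Lemma F13_nat (a : F) : exists2 n, (n < 13)%N & a = n%:R.
Proof. by exists (val a); [exact: (ltn_ord a) | rewrite natr_Zp]. Qed.

(* minus is +12 *)
Definition det4 (q : quad) : nat :=
  let: (a, b, c, d) := q in ((a * d + 12 * b * c) %% 13)%N.
Definition mul4 (p q : quad) : quad :=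
  let: (a, b, c, d) := p in let: (a', b', c', d') := q in
  ((a * a' + b * c') %% 13, (a * b' + b * d') %% 13,
   (c * a' + d * c') %% 13, (c * b' + d * d') %% 13)%N.
Definition mx4 (q : quad) : 'M[F]_2 :=
  let: (a, b, c, d) := q in mx22 a%:R b%:R c%:R d%:R.
Definition elt (q : quad) : GL := insubd (1%g : GL) (mx4 q).

Lemma F13_12 : 12%:R = -1 :> F.
Proof. by apply/eqP; rewrite -subr_eq0 opprK. Qed.

Lemma det_mx4 q : \det (mx4 q) = (det4 q)%:R.
Proof.
case: q => [[[a b] c] d] /=.
rewrite det_mx22 F13_mod natrD !natrM F13_12; ring.
Qed.

Lemma elt_val q : det4 q = 1%N -> GLval (elt q) = mx4 q.
Proof.
move=> dq; rewrite /elt; apply: (@insubdK _ _ GL).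
by rewrite -topredE /= unitmxE det_mx4 dq unitr1.
Qed.

Lemma mem_SL2 (g : GL) : (g \in SL2 F) = (\det (GLval g) == 1).
Proof. by rewrite inE. Qed.

Lemma elt_SL2 q : det4 q = 1%N -> elt q \in SL2 F.
Proof. by move=> dq; rewrite mem_SL2 elt_val// det_mx4 dq. Qed.

Lemma mx4M p q : mx4 (mul4 p q) = mx4 p *m mx4 q.
Proof.
move: p q => [[[a b] c] d] [[[a' b'] c'] d'] /=.
by rewrite !F13_mod !natrD !natrM -mx22M.
Qed.

Lemma GLval_inj : injective (@GLval 2 F).
Proof. exact: val_inj. Qed.

Lemma det4M p q : det4 p = 1%N -> det4 q = 1%N -> det4 (mul4 p q) = 1%N.
Proof.
move=> dp dq; have : (det4 (mul4 p q))%:R = 1%:R :> F.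
  by rewrite -det_mx4 mx4M det_mulmx !det_mx4 dp dq mulr1.
move=> /F13_inj; case: (mul4 p q) => [[[a b] c] d] /=.
by rewrite modn_mod => /eqP.
Qed.

Lemma eltM p q : det4 p = 1%N -> det4 q = 1%N ->
  elt (mul4 p q) = (elt p * elt q)%g.
Proof.
move=> dp dq; apply: GLval_inj.
by rewrite GL_ME !elt_val// ?det4M// mx4M.
Qed.

Lemma elt_mx4 p q : det4 p = 1%N -> det4 q = 1%N -> elt p = elt q -> mx4 p = mx4 q.
Proof. by move=> dp dq /(congr1 (@GLval 2 F)); rewrite !elt_val. Qed.

Lemma elt1 : elt (1, 0, 0, 1)%N = 1%g.
Proof. by apply: GLval_inj; rewrite elt_val//= mx22_1. Qed.

Definition pairs13 : seq (nat * nat) := [seq (a, b) | a <- iota 0 13, b <- iota 0 13].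
Definition quads : seq quad :=
  [seq q <- [seq (p.1.1, p.1.2, p.2.1, p.2.2) |
               p <- [seq (x, y) | x <- pairs13, y <- pairs13]]
     | det4 q == 1%N].

Lemma mem_quads (a b c d : nat) : ((a, b, c, d) \in quads) =
  [&& (a < 13)%N, (b < 13)%N, (c < 13)%N, (d < 13)%N & det4 (a, b, c, d) == 1%N].
Proof.
rewrite mem_filter andbC.
have mem2 (x y : nat) : ((x, y) \in pairs13)
    = (x < 13)%N && (y < 13)%N.
  apply/allpairsP/andP => [[p [pa pb [-> ->]]]|[x13 y13]].
    by move: pa pb; rewrite !mem_iota.
  by exists (x, y); rewrite !mem_iota.
rewrite !andbA; congr (_ && _); rewrite -!andbA.
apply/mapP/and4P => [[p pp [-> -> -> ->]]|[a13 b13 c13 d13]].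
  case/allpairsP: pp => -[[u v] [w s]] [uv ws ->].
  by move: uv ws; rewrite !mem2 => /andP[-> ->] /andP[-> ->].
exists ((a, b), (c, d)); last by []; apply/allpairsP.
by exists ((a, b), (c, d)); rewrite !mem2 a13 b13 c13 d13.
Qed.

Lemma quads_uniq : uniq quads.
Proof.
apply: filter_uniq; rewrite map_inj_uniq; last first.
  by move=> [[? ?] [? ?]] [[? ?] [? ?]] /= [-> -> -> ->].
have up : uniq pairs13.
  by apply: allpairs_uniq; rewrite ?iota_uniq// => -[? ?] [? ?] _ _ [-> ->].
by apply: allpairs_uniq => // -[? ?] [? ?] _ _ [-> ->].
Qed.

Lemma sum_SL2_quads (V : nmodType) (f : GL -> V) :
  \sum_(g in SL2 F) f g = \sum_(q <- quads) f (elt q).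
Proof.
have detq q : q \in quads -> det4 q = 1%N.
  by case: q => [[[a b] c] d]; rewrite mem_quads => /and5P[_ _ _ _ /eqP].
have inj : {in quads &, injective elt}.
  move=> p q pq qq /(congr1 (@GLval 2 F)); rewrite !elt_val ?detq//.
  move: p q pq qq => [[[a b] c] d] [[[a' b'] c'] d'].
  rewrite !mem_quads => /and5P[a1 b1 c1 d1 _] /and5P[a2 b2 c2 d2 _] /= e.
  have {}e i j := congr1 (fun A : 'M['F_13]_2 => A i j) e.
  move: (e 0 0) (e 0 1) (e 1 0) (e 1 1); rewrite !mxE /=.
  move=> /F13_inj + /F13_inj + /F13_inj + /F13_inj.
  by rewrite !modn_small// => /eqP -> /eqP -> /eqP -> /eqP ->.
rewrite -(big_map elt xpredT) big_uniq; last first.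
  by rewrite map_inj_in_uniq ?quads_uniq.
apply: eq_bigl => g; apply/idP/mapP => [|[q qq ->]]; last exact/elt_SL2/detq.
rewrite mem_SL2 => /eqP dg.
have [[a a13 ea] [b b13 eb]] := (F13_nat (GLval g 0 0), F13_nat (GLval g 0 1)).
have [[c c13 ec] [d d13 ed]] := (F13_nat (GLval g 1 0), F13_nat (GLval g 1 1)).
have gE : GLval g = mx4 (a, b, c, d) by rewrite [LHS]mx22E ea eb ec ed.
have d1 : det4 (a, b, c, d) = 1%N.
  move: dg; rewrite gE det_mx4 => /(@F13_inj _ 1).
  by rewrite /= modn_mod => /eqP.
exists (a, b, c, d); first by rewrite mem_quads a13 b13 c13 d13 d1.
by apply: GLval_inj; rewrite elt_val.
Qed.

(* lists of (representative, inverse of its upper right entry) *)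
Definition canon : seq (quad * nat) :=
  [:: ((1, 0, 0, 1), 0); ((0, 1, 12, 0), 1); ((0, 1, 12, 1), 1);
      ((0, 1, 12, 4), 1); ((0, 1, 12, 3), 1); ((0, 1, 12, 5), 1);
      ((0, 1, 12, 6), 1); ((0, 1, 12, 2), 1); ((0, 2, 6, 2), 7)]%N.

Definition canon_quad (k : nat) : quad := (nth ((1, 0, 0, 1), 0) canon k).1%N.
Definition canon_elt k : GL := elt (canon_quad k).

Definition minus1 : quad := (12, 0, 0, 12)%N.

Definition conj_test (D q P : quad) : bool :=
  if det4 P == 1%N then mul4 P q == mul4 D P else false.

Definition adapted (q : quad) (ri : nat) (v : nat * nat) : quad :=
  let: (a, b, c, d) := q in let: (x, y) := v in
  (x, y, (x * a + y * c) * ri %% 13, (x * b + y * d) * ri %% 13)%N.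

Fixpoint lazy_has (T : Type) (a : pred T) (s : seq T) : bool :=
  if s is x :: s' then if a x then true else lazy_has a s' else false.

Arguments lazy_has : simpl never.

Lemma lazy_hasP (T : eqType) (a : pred T) (s : seq T) :
  reflect (exists2 x, x \in s & a x) (lazy_has a s).
Proof.
have -> : lazy_has a s = has a s.
  by elim: s => //= x s <-; rewrite /lazy_has /=; case: (a x).
exact: hasP.
Qed.

Definition conj_to (Dr : quad * nat) (q : quad) : bool :=
  let: (a, b, c, d) := q in let: (_, _, _, d', ri) := Dr in
  if ri == 0%N then q == (1, 0, 0, 1)%N else
  if ((a + d) %% 13 == d')%N
  then lazy_has (fun v => conj_test Dr.1 q (adapted q ri v)) pairs13 else false.

Definition conj_upto_sign (q : quad) (Dr : quad * nat) : bool :=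
  if conj_to Dr q then true else conj_to Dr (mul4 q minus1).

Definition class_idx (q : quad) : nat := find (conj_upto_sign q) canon.

Definition class_sizes := [:: 2; 182; 364; 364; 312; 312; 312; 168; 168]%N.

Lemma class_idx_counts : let l := [seq class_idx q | q <- quads] in
  all (fun k => k < 9)%N l &&
  ([seq count_mem k l | k <- iota 0 9]%N
    == class_sizes).
Proof. by vm_cast_no_check (erefl true). Qed.

Lemma canon_det k : det4 (nth ((1, 0, 0, 1), 0) canon k).1%N = 1%N.
Proof.
have [k9|k9] := ltnP k 9; last by rewrite nth_default.
by move: k k9; do 9?[case=> //].
Qed.

Lemma canon_elt_SL2 k : canon_elt k \in SL2 F.
Proof. exact/elt_SL2/canon_det. Qed.

Section ClassFunction.
Variables (V : nmodType) (f : GL -> V).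
Hypothesis fJ : forall g h, g \in SL2 F -> h \in SL2 F -> f (g ^ h)%g = f g.
Hypothesis fN : forall g, g \in SL2 F -> f (g * elt minus1)%g = f g.

Lemma conj_testP D q P : det4 D = 1%N -> det4 q = 1%N -> conj_test D q P ->
  f (elt q) = f (elt D).
Proof.
move=> dD dq; rewrite /conj_test; case: eqP => // dP /eqP e.
have {}e : (elt P * elt q = elt D * elt P)%g by rewrite -!eltM// e.
have -> : elt q = (elt D ^ elt P)%g by rewrite conjgE -e mulKg.
by rewrite fJ ?elt_SL2.
Qed.

Local Opaque pairs13 lazy_has conj_test adapted modn.

Lemma conj_toP Dr q : det4 Dr.1 = 1%N -> det4 q = 1%N -> conj_to Dr q ->
  (Dr.2 == 0%N -> Dr.1 = (1, 0, 0, 1)%N) -> f (elt q) = f (elt Dr.1).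
Proof.
move: Dr q => [[[[a' b'] c'] d'] ri] [[[a b] c] d] dD dq; rewrite /conj_to.
case: (ri == 0%N) => [/eqP -> De|]; first by rewrite [fst _]De.
have ifP2 (b1 b2 : bool) : (if b1 then b2 else false) -> b2 by case: b1.
move=> /ifP2 has_v _; have [v _ qD] := elimT (lazy_hasP _ _) has_v.
exact: conj_testP qD.
Qed.

Lemma class_idxP q : det4 q = 1%N -> (class_idx q < 9)%N ->
  f (elt q) = f (canon_elt (class_idx q)).
Proof.
move=> dq; rewrite -[9%N]/(size canon) -has_find => /(nth_find ((1, 0, 0, 1), 0)%N).
rewrite /canon_elt /class_idx; set k := find _ _.
have canon2 : let Dr := nth ((1, 0, 0, 1), 0)%N canon k in
    Dr.2 == 0%N -> Dr.1 = (1, 0, 0, 1)%N.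
  have [k9|k9] := ltnP k 9; last by rewrite nth_default.
  by move: (k) k9; do 9?[case=> //].
have dD := canon_det k.
rewrite /conj_upto_sign; case: ifP => [qD _|_ qD]; first exact: conj_toP qD canon2.
have dm : det4 minus1 = 1%N by [].
by rewrite -fN ?elt_SL2// -eltM//; apply: conj_toP qD canon2; rewrite ?det4M.
Qed.

Lemma sum_SL2 : \sum_(g in SL2 F) f g =
  \sum_(k < 9) f (canon_elt k) *+ nth 0%N class_sizes k.
Proof.
have sum_count (l : seq nat) (h : nat -> V) : all (fun k => k < 9)%N l ->
    \sum_(k <- l) h k = \sum_(k <- iota 0 9) h k *+ count_mem k l.
  elim: l => [_|x l IHl /andP[x9 /IHl e]].
    by rewrite big_nil big1// => k _; rewrite mulr0n.
  rewrite big_cons e -[LHS]/(h x + _).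
  rewrite [RHS](eq_bigr (fun k => h k *+ (x == k) + h k *+ count_mem k l)); last first.
    by move=> k _; exact: mulrnDr.
  rewrite big_split; congr (_ + _).
  rewrite (bigD1_seq x) ?mem_iota ?iota_uniq//.
  rewrite eqxx mulr1n big1 => [|k /= kx]; first exact/esym/addr0.
  by rewrite eq_sym (negPf kx) mulr0n.
have [l9 /eqP lc] := andP class_idx_counts.
have detq q : q \in quads -> det4 q = 1%N.
  by case: q => [[[a b] c] d]; rewrite mem_quads => /and5P[_ _ _ _ /eqP].
rewrite sum_SL2_quads (eq_big_seq (fun q => f (canon_elt (class_idx q)))); last first.
  move=> q qq; apply: class_idxP; first exact: detq.
  by apply: (allP l9); apply: map_f.
rewrite -(big_map class_idx xpredT (fun k => f (canon_elt k))) sum_count; last exact: l9.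
move: lc; rewrite -(big_mkord xpredT (fun k => f (canon_elt k) *+ nth 0%N class_sizes k)).
move: class_sizes => cs; set l := [seq class_idx q | q <- quads].
clearbody l => <-; apply: eq_big_seq => k; rewrite mem_iota => /andP[_ k9].
by rewrite (nth_map 0%N) ?size_iota ?nth_iota.
Qed.

End ClassFunction.

End SL2_13.

Lemma rank1_sandwich (F : fieldType) n (P M : 'M[F]_n) : \rank P = 1%N ->
  P *m M *m P = \tr (P *m M) *: P.
Proof.
move: (mulmx_base P) (col_base P) (row_base P) => + C B.
move: (col_base P) (row_base P) => + + + r1; rewrite r1 => {}C {}B <-.
have -> : C *m B *m M *m (C *m B) = C *m (B *m M *m C) *m B by rewrite !mulmxA.
have -> : \tr (C *m B *m M) = \tr (B *m M *m C) by rewrite -mulmxA mxtrace_mulC.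
by rewrite [B *m M *m C]mx11_scalar mxtrace_scalar mul_mx_scalar -scalemxAl.
Qed.

Lemma sum_root_unity (F : fieldType) n (z : F) : z ^+ n = 1 -> z != 1 ->
  \sum_(j < n) z ^+ j = 0.
Proof.
move=> zn z1; have z10 : z - 1 != 0 by rewrite subr_eq0.
by apply: (mulfI z10); rewrite -subrX1 zn subrr mulr0.
Qed.

Section CyclicMultiplicities.
Variables (F : numFieldType) (gT : finGroupType) (G : {group gT}) (d : nat).
Variable rG : mx_representation F G d.
Variables (n : nat) (eps : F) (x : gT).
Hypotheses (prim : n.-primitive_root eps) (Gx : x \in G).
Hypothesis xn : rG (x ^+ n)%g = 1%:M.
Local Notation chi k := (\tr (rG (x ^+ k)%g)).

Let n_gt0 : (0 < n)%N := prim_order_gt0 prim.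

Let n0 : n%:R != 0 :> F. Proof. by rewrite pnatr_eq0 -lt0n. Qed.

Let eps0 k : eps ^+ k != 0.
Proof. by apply: expf_neq0; rewrite (prim_root_eq0 prim) -lt0n. Qed.

Definition eigen_proj (j : nat) : 'M[F]_d :=
  n%:R^-1 *: \sum_(k < n) eps ^- (j * k) *: rG (x ^+ k)%g.

Lemma repr_expM a b : rG (x ^+ a)%g *m rG (x ^+ b)%g = rG (x ^+ (a + b))%g.
Proof. by rewrite -repr_mxM ?groupX// expgD. Qed.

Lemma repr_exp_mod a : rG (x ^+ (a %% n))%g = rG (x ^+ a)%g.
Proof.
rewrite [in RHS](divn_eq a n) -repr_expM.
suff -> q : rG (x ^+ (q * n))%g = 1%:M by rewrite mul1mx.
elim: q => [|q IHq]; first by rewrite repr_mx1.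
by rewrite mulSn -repr_expM IHq xn mul1mx.
Qed.

Lemma eigen_projMr j k : eigen_proj j *m rG (x ^+ k)%g = eps ^+ (j * k) *: eigen_proj j.
Proof.
have step : eigen_proj j *m rG (x ^+ 1)%g = eps ^+ j *: eigen_proj j.
  rewrite /eigen_proj -scalemxAl scalerA mulrC -scalerA; congr (_ *: _).
  rewrite mulmx_suml scaler_sumr; case: n n_gt0 prim xn => // m _ pr xm.
  rewrite big_ord_recr [RHS]big_ord_recl /= [LHS]addrC; congr (_ + _).
    rewrite -scalemxAl repr_expM addn1 xm muln0 expr0 invr1 expg0 repr_mx1 scale1r.
    congr (_ *: _); apply: (mulfI (eps0 (j * m))).
    by rewrite mulfV // -exprD addnC -mulnS mulnC exprM (prim_expr_order pr) expr1n.
  apply: eq_bigr => i _; rewrite /= /bump add1n -scalemxAl repr_expM addn1 scalerA.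
  by congr (_ *: _); rewrite mulnS exprD invfM mulVKf.
elim: k => [|k IHk]; first by rewrite muln0 expr0 scale1r repr_mx1 mulmx1.
rewrite -addn1 -repr_expM mulmxA IHk -scalemxAl step scalerA.
by rewrite mulnDr muln1 exprD.
Qed.

Lemma eigen_proj_idem j : eigen_proj j *m eigen_proj j = eigen_proj j.
Proof.
rewrite {2}/eigen_proj -scalemxAr mulmx_sumr.
rewrite (eq_bigr (fun=> eigen_proj j)) => [|k _].
  by rewrite sumr_const card_ord scalerVMn.
by rewrite -scalemxAr eigen_projMr scalerA mulVf// scale1r.
Qed.

Definition emult j := \rank (eigen_proj j).

Lemma emultE j : n%:R * (emult j)%:R = \sum_(k < n) eps ^- (j * k) * chi k.
Proof.
rewrite -mxtrace_idem ?eigen_proj_idem// mxtraceZ mulVKf// raddf_sum /=.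
by apply: eq_bigr => k _; rewrite mxtraceZ.
Qed.

Lemma emult_mod j : emult (j %% n) = emult j.
Proof.
rewrite /emult /eigen_proj; congr (\rank (_ *: _)); apply: eq_bigr => k _.
by congr (_^-1 *: _); rewrite !exprM (prim_expr_mod prim).
Qed.

Lemma chi_emult k : chi k = \sum_(j < n) (emult j)%:R * eps ^+ (j * k).
Proof.
apply: (mulfI n0); rewrite [RHS]mulr_sumr.
under [RHS]eq_bigr do rewrite mulrA emultE mulr_suml.
rewrite [RHS]exchange_big /= -repr_exp_mod.
have kn : (k %% n < n)%N by rewrite ltn_mod.
have term (j l : 'I_n) : eps ^- (j * l) * chi l * eps ^+ (j * k)
    = chi l * (eps ^+ k / eps ^+ l) ^+ j.
  by rewrite expr_div_n -!exprM ![(_ * j)%N]mulnC; ring.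
rewrite [RHS](bigD1 (Ordinal kn)) //= [X in _ = _ + X]big1 ?addr0 => [|l lk].
  under [RHS]eq_bigr => j _.
    rewrite (term j (Ordinal kn)) /= (prim_expr_mod prim) divff// expr1n mulr1.
    over.
  by rewrite sumr_const card_ord mulr_natl.
under eq_bigr do rewrite term.
rewrite -mulr_sumr sum_root_unity ?mulr0//.
  by rewrite expr_div_n !(exprAC _ _ n) (prim_expr_order prim) !expr1n divr1.
rewrite -(inj_eq (mulIf (eps0 l))) mul1r mulfVK// (eq_prim_root_expr prim).
by rewrite -(modn_mod k) eq_sym (modn_small (ltn_ord l)) modn_small.
Qed.

Lemma sum_emult : (\sum_(j < n) emult j)%N = d.
Proof.
apply/eqP; rewrite -(eqr_nat F) natr_sum.
have := chi_emult 0; rewrite expg0 repr_mx1 mxtrace1 => ->; apply/eqP.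
by apply: eq_bigr => j _; rewrite muln0 mulr1.
Qed.

Lemma emult_mul r r' j : (r' * r = 1 %[mod n])%N ->
  (forall k, chi (r * k)%N = chi k) -> emult (r * j) = emult j.
Proof.
move=> r'r chi_r; apply/eqP; rewrite -(eqr_nat F); apply/eqP/(mulfI n0).
rewrite !emultE.
pose h (k : 'I_n) : 'I_n := Ordinal (ltn_pmod (r * k) n_gt0).
have h_inj : injective h.
  apply: (can_inj (g := fun k : 'I_n => Ordinal (ltn_pmod (r' * k) n_gt0))) => k.
  apply: val_inj; rewrite /= modnMmr mulnA -modnMml r'r modnMml mul1n.
  exact: modn_small.
rewrite [RHS](reindex_inj h_inj) /=; apply: eq_bigr => k _.
rewrite repr_exp_mod chi_r; congr (_^-1 * _).
rewrite [(j * _)%N]mulnC [RHS]exprM (prim_expr_mod prim) -exprM.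
by rewrite mulnAC.
Qed.

Lemma emult_parseval r : eps ^+ r.+1 = 1 -> (r * r = 1 %[mod n])%N ->
  (forall k, chi (r * k)%N = chi k) ->
  \sum_(k < n) chi k ^+ 2 = n%:R * \sum_(j < n) (emult j)%:R ^+ 2.
Proof.
move=> er rr chi_r; rewrite mulr_sumr.
transitivity (\sum_(k < n) \sum_(j < n) (emult j)%:R * (eps ^+ (j * k) * chi k)).
  apply: eq_bigr => k _; rewrite expr2 {1}chi_emult mulr_suml.
  by apply: eq_bigr => j _; rewrite mulrA.
rewrite exchange_big /=; apply: eq_bigr => j _; rewrite -mulr_sumr expr2 mulrCA.
congr (_ * _); rewrite -(emult_mul j rr chi_r) emultE; apply: eq_bigr => k _.
congr (_ * _); apply: (mulfI (eps0 (r * j * k))); rewrite mulfV// -exprD.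
by rewrite -mulnA -mulSnr exprM er expr1n.
Qed.

(* The case of the first power of eps: the projector on the fixed vectors. *)
Lemma emult0_full : emult 0 = d -> rG x = 1%:M.
Proof.
move=> full; have := eigen_projMr 0 1; rewrite expg1 scale1r.
have /row_fullP[B BP] : row_full (eigen_proj 0) by apply/eqP; exact: full.
by move=> /(congr1 (mulmx B)); rewrite mulmxA BP mul1mx.
Qed.

Lemma eigen_proj0_comm y r r' : y \in G -> (x ^ y = x ^+ r)%g ->
  (r' * r = 1 %[mod n])%N ->
  eigen_proj 0 *m rG y = rG y *m eigen_proj 0.
Proof.
move=> Gy xy r'r; rewrite /eigen_proj -scalemxAl -scalemxAr; congr (_ *: _).
pose h (k : 'I_n) : 'I_n := Ordinal (ltn_pmod (r * k) n_gt0).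
have h_inj : injective h.
  apply: (can_inj (g := fun k : 'I_n => Ordinal (ltn_pmod (r' * k) n_gt0))) => k.
  apply: val_inj; rewrite /= modnMmr mulnA -modnMml r'r modnMml mul1n.
  exact: modn_small.
rewrite mulmx_suml mulmx_sumr [RHS](reindex_inj h_inj) /=.
apply: eq_bigr => k _; rewrite !mul0n !expr0 invr1 !scale1r repr_exp_mod.
by rewrite -!repr_mxM ?groupX// expgM -xy -conjXg -conjgC.
Qed.

End CyclicMultiplicities.

Lemma mxtrace_reprJ (F : fieldType) (gT : finGroupType) (G : {group gT}) n
    (rG : mx_representation F G n) g h : g \in G -> h \in G ->
  \tr (rG (g ^ h)%g) = \tr (rG g).
Proof.
by move=> Gg Gh; rewrite !repr_mxM ?groupM ?groupV// mxtrace_mulC repr_mxK.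
Qed.


Definition pow4 (q : quad) (k : nat) : quad := iter k (mul4 q) (1, 0, 0, 1)%N.

Lemma det4_pow q k : det4 q = 1%N -> det4 (pow4 q k) = 1%N.
Proof. by move=> dq; elim: k => //= k IHk; rewrite det4M. Qed.

Lemma mult13_values (m : nat -> nat) :
  (forall j, m (j %% 13)%N = m j) -> (forall j, m (10 * j %% 13)%N = m j) ->
  (\sum_(j < 13) m j = 7)%N -> m 0 <> 7%N -> m 0 = 1%N /\
  ((forall j, m j = (j %% 13 \in [:: 0; 1; 3; 4; 9; 10; 12])%N :> nat) \/
   (forall j, m j = (j %% 13 \in [:: 0; 2; 5; 6; 7; 8; 11])%N)).
Proof.
move=> m13 m10 s7 m07.
have e10 : m 10 = m 1 by rewrite -(m10 1).
have e9 : m 9 = m 1 by rewrite -e10 -(m10 10).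
have e12 : m 12 = m 1 by rewrite -e9 -(m10 9).
have e3 : m 3 = m 1 by rewrite -e12 -(m10 12).
have e4 : m 4 = m 1 by rewrite -e3 -(m10 3).
have e7 : m 7 = m 2 by rewrite -(m10 2).
have e5 : m 5 = m 2 by rewrite -e7 -(m10 7).
have e11 : m 11 = m 2 by rewrite -e5 -(m10 5).
have e6 : m 6 = m 2 by rewrite -e11 -(m10 11).
have e8 : m 8 = m 2 by rewrite -e6 -(m10 6).
have {}s7 : (m 0 + 6 * m 1 + 6 * m 2 = 7)%N.
  move: s7; rewrite -(big_mkord xpredT m) unlock /= e3 e4 e5 e6 e7 e8 e9 e10 e11 e12.
  by clear; move: (m 0) (m 1) (m 2) => a b c; lia.
have [m0 m12] : m 0 = 1%N /\ ((m 1 = 1 /\ m 2 = 0) \/ (m 1 = 0 /\ m 2 = 1))%N.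
  by move: s7 m07; clear; move: (m 0) (m 1) (m 2) => a b c; lia.
split=> //; have lt13 (j : nat) : (j %% 13 < 13)%N by rewrite ltn_mod.
case: m12 => -[m1 m2]; [left|right] => j; rewrite -m13; move: (lt13 j);
  move: (j %% 13)%N => i; do 13?[case: i => [|i] //];
  by rewrite /= ?m0 ?e3 ?e4 ?e5 ?e6 ?e7 ?e8 ?e9 ?e10 ?e11 ?e12 ?m1 ?m2.
Qed.

Lemma mult7_values (m : nat -> nat) k :
  (forall j, m (j %% 7)%N = m j) -> (forall j, m (6 * j %% 7)%N = m j) ->
  (\sum_(j < 7) m j = 7)%N -> (\sum_(j < 7) m j ^ 2 = 2 * k + 5)%N -> (k <= 2)%N ->
  forall j, m j = 1%N.
Proof.
move=> m7 m6 s1 s2 k2 j.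
have e6 : m 6 = m 1 by rewrite -(m6 1).
have e5 : m 5 = m 2 by rewrite -(m6 2).
have e4 : m 4 = m 3 by rewrite -(m6 3).
have {}s1 : (m 0 + 2 * m 1 + 2 * m 2 + 2 * m 3 = 7)%N.
  move: s1; rewrite -(big_mkord xpredT m) unlock /= e6 e5 e4.
  by clear; move: (m 0) (m 1) (m 2) (m 3) => a b c d; lia.
have {}s2 : (m 0 ^ 2 + 2 * m 1 ^ 2 + 2 * m 2 ^ 2 + 2 * m 3 ^ 2 = 2 * k + 5)%N.
  move: s2; rewrite -(big_mkord xpredT (fun j => m j ^ 2)%N) unlock /= e6 e5 e4.
  by clear; move: (m 0 ^ 2)%N (m 1 ^ 2)%N (m 2 ^ 2)%N (m 3 ^ 2)%N => a b c d; lia.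
have [m0 m1 m2 m3] : [/\ m 0 = 1, m 1 = 1, m 2 = 1 & m 3 = 1]%N.
  move: s1 s2 k2; clear; move: (m 0) (m 1) (m 2) (m 3) => a b c d s1.
  have b3 : (b <= 3)%N by lia.
  have c3 : (c <= 3)%N by lia.
  have d3 : (d <= 3)%N by lia.
  have -> : a = (7 - 2 * b - 2 * c - 2 * d)%N by lia.
  have bcd : (b + c + d <= 3)%N by lia.
  case: b b3 bcd {s1} => [|[|[|[|b]]]] // _; case: c c3 => [|[|[|[|c]]]] // _;
    case: d d3 => [|[|[|[|d]]]] // _ _; rewrite -!mulnn => ? ?; split; lia.
rewrite -m7; have : (j %% 7 < 7)%N by rewrite ltn_mod.
by move: (j %% 7)%N => i; do 7?[case: i => [|i] //]; rewrite ?e6 ?e5 ?e4.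
Qed.

Local Opaque class_idx canon.

Lemma mxtrace_rank1M (F : fieldType) n (P A B : 'M[F]_n) : P *m P = P ->
  \rank P = 1%N -> P *m A = A *m P ->
  \tr (P *m (A *m B)) = \tr (P *m A) * \tr (P *m B).
Proof.
move=> PP P1 PA; have -> : P *m (A *m B) = P *m A *m P *m B.
  by rewrite -{1}PP -!mulmxA (mulmxA P A) PA !mulmxA.
by rewrite rank1_sandwich// -scalemxAl mxtraceZ.
Qed.

Lemma avg_eigen_proj (F : numFieldType) (gT : finGroupType) (G : {group gT}) d
    (rG : mx_representation F G d) n (eps : F) x : (0 < n)%N -> x \in G ->
  avg rG G *m eigen_proj rG n eps x 0 = avg rG G.
Proof.
move=> n0 Gx; rewrite /eigen_proj -scalemxAr mulmx_sumr.
rewrite (eq_bigr (fun=> avg rG G)) => [|k _].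
  by rewrite sumr_const card_ord scalerVMn// pnatr_eq0 -lt0n.
by rewrite mul0n expr0 invr1 scale1r avgMr ?groupX.
Qed.

Lemma class_sizes_sum (F : comRingType) (h : nat -> F) :
  \sum_(k < 9) h k *+ nth 0%N class_sizes k =
  2%:R * h 0 + 182%:R * h 1 + 364%:R * h 2 + 364%:R * h 3
  + 312%:R * (h 4 + h 5 + h 6) + 168%:R * (h 7 + h 8).
Proof.
rewrite -(big_mkord xpredT (fun k => h k *+ nth 0%N class_sizes k)).
rewrite unlock /class_sizes /=; ring.
Qed.

Definition uq : quad := (1, 1, 0, 1)%N.
Definition yq : quad := (2, 0, 0, 7)%N.
Definition zq : quad := (0, 1, 12, 3)%N.

Section CharactersPSL2_13.
Variables (F : numFieldType) (gT : finGroupType) (G : {group gT}) (el : quad -> gT).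
Variable rG : mx_representation F G 7.
Variables (eps13 eps7 eps6 : F).
Hypotheses (prim13 : 13.-primitive_root eps13) (prim7 : 7.-primitive_root eps7).
Hypothesis prim6 : 6.-primitive_root eps6.

Hypothesis el1 : el (1, 0, 0, 1)%N = 1%g.
Hypothesis elG : forall q, det4 q = 1%N -> el q \in G.
Hypothesis elM : forall p q, det4 p = 1%N -> det4 q = 1%N ->
  el (mul4 p q) = (el p * el q)%g.
Local Notation cel k := (el (canon_quad k)).
Hypothesis el_class : forall f : gT -> F,
  (forall g h, g \in G -> h \in G -> f (g ^ h)%g = f g) ->
  (forall g, g \in G -> f (g * el minus1)%g = f g) ->
  (forall q, det4 q = 1%N -> (class_idx q < 9)%N ->
     f (el q) = f (cel (class_idx q))) /\
  \sum_(g in G) f g = \sum_(k < 9) f (cel k) *+ nth 0%N class_sizes k.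

Local Notation u := (el uq).
Local Notation y := (el yq).
Local Notation z := (el zq).
Local Notation w := (el minus1).

Hypothesis rGN : rG w = 1%:M.
Hypothesis rGu : rG u <> 1%:M.

Local Notation chi g := (\tr (rG g)).

Let du : det4 uq = 1%N. Proof. by []. Qed.
Let dy : det4 yq = 1%N. Proof. by []. Qed.
Let dz : det4 zq = 1%N. Proof. by []. Qed.
Let Gu : u \in G. Proof. exact: elG. Qed.
Let Gy : y \in G. Proof. exact: elG. Qed.
Let Gz : z \in G. Proof. exact: elG. Qed.
Let GN : w \in G. Proof. exact: elG. Qed.

Let elX q k : det4 q = 1%N -> el (pow4 q k) = (el q ^+ k)%g.
Proof.
move=> dq; elim: k => [|k IHk]; first by rewrite expg0 -el1.
by rewrite expgS -IHk -elM// det4_pow.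
Qed.

Lemma chiJ g h : g \in G -> h \in G -> chi (g ^ h)%g = chi g.
Proof.
exact: mxtrace_reprJ.
Qed.

Lemma repr_minus g : g \in G -> rG (g * w)%g = rG g.
Proof. by move=> Gg; rewrite (repr_mxM rG Gg GN) rGN mulmx1. Qed.

Lemma chi_class q k : det4 q = 1%N -> class_idx q = k -> (k < 9)%N ->
  chi (el q) = chi (cel k).
Proof.
have HN g : g \in G -> chi (g * w)%g = chi g by move=> /repr_minus ->.
by move=> dq <- qk; exact: (proj1 (el_class chiJ HN)) q dq qk.
Qed.

Lemma repr_u13 : rG (u ^+ 13)%g = 1%:M.
Proof.
have e : pow4 uq 13 = (1, 0, 0, 1)%N by vm_compute.
by rewrite -(elX 13 du) e el1 repr_mx1.
Qed.

Lemma repr_y6 : rG (y ^+ 6)%g = 1%:M.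
Proof.
have e : pow4 yq 6 = minus1 by vm_compute.
by rewrite -(elX 6 dy) e rGN.
Qed.

Lemma repr_z7 : rG (z ^+ 7)%g = 1%:M.
Proof.
have e : pow4 zq 7 = minus1 by vm_compute.
by rewrite -(elX 7 dz) e rGN.
Qed.

Lemma u_conj_y : (u ^ y = u ^+ 10)%g.
Proof.
have e : mul4 uq yq = mul4 yq (pow4 uq 10) by vm_compute.
have yu : (u * y = y * u ^+ 10)%g.
  by rewrite -(elX 10 du) -(elM du dy) e (elM dy (det4_pow 10 du)).
by rewrite conjgE yu mulKg.
Qed.

Lemma chi_u10 k : chi (u ^+ (10 * k))%g = chi (u ^+ k)%g.
Proof. by have := chiJ (groupX k Gu) Gy; rewrite conjXg u_conj_y -expgM. Qed.

Local Notation mu := (emult rG 13 eps13 u).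

Lemma mu10 j : mu (10 * j %% 13) = mu j.
Proof.
rewrite (emult_mod rG u prim13).
exact: (emult_mul prim13 Gu repr_u13 j (r := 10) (r' := 4) erefl chi_u10).
Qed.

Lemma mu_values : mu 0 = 1%N /\
  ((forall j, mu j = (j %% 13 \in [:: 0; 1; 3; 4; 9; 10; 12])%N) \/
   (forall j, mu j = (j %% 13 \in [:: 0; 2; 5; 6; 7; 8; 11])%N)).
Proof.
apply: mult13_values (sum_emult prim13 Gu repr_u13) _ => [j|j|].
- exact: (emult_mod rG u prim13).
- exact: mu10.
- by move=> /(emult0_full prim13 Gu repr_u13)/rGu.
Qed.

Let P := eigen_proj rG 13 eps13 u 0.
Let lam := \tr (P *m rG y).

Lemma chi_uy k j : (k < 13)%N -> (0 < j < 6)%N ->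
  chi (u ^+ k * y ^+ j)%g = chi (cel (nth 0 [:: 0; 3; 2; 1; 2; 3] j)%N).
Proof.
have tbl : all (fun k => all (fun j => class_idx (mul4 (pow4 uq k) (pow4 yq j))
    == nth 0 [:: 0; 3; 2; 1; 2; 3] j)%N (iota 1 5)) (iota 0 13) by vm_compute.
move=> k13 /andP[j0 j6].
have /allP/(_ j) := allP tbl k (etrans (mem_iota 0 13 k) k13).
rewrite mem_iota j0 /= => /(_ j6)/eqP idx.
have -> : (u ^+ k * y ^+ j)%g = el (mul4 (pow4 uq k) (pow4 yq j)).
  by rewrite (elM (det4_pow k du) (det4_pow j dy)) (elX k du) (elX j dy).
apply: chi_class idx _; first exact: (det4M (det4_pow k du) (det4_pow j dy)).
by move: j6; clear; do 6?[case: j => [|j] //].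
Qed.

Lemma chi_y j : (0 < j < 6)%N ->
  chi (y ^+ j)%g = chi (cel (nth 0 [:: 0; 3; 2; 1; 2; 3] j)%N).
Proof. by move=> j6; have := chi_uy (k := 0) isT j6; rewrite expg0 mul1g. Qed.

Let n13 : 13%:R != 0 :> F. Proof. by rewrite pnatr_eq0. Qed.

Let P_idem : P *m P = P := eigen_proj_idem prim13 Gu repr_u13 0.

Let P_rank : \rank P = 1%N := proj1 mu_values.

Let Py : P *m rG y = rG y *m P :=
  eigen_proj0_comm prim13 Gu repr_u13 (r := 10) (r' := 4) Gy u_conj_y erefl.

Let trP_y j : \tr (P *m rG (y ^+ j)%g) = lam ^+ j.
Proof.
elim: j => [|j IHj].
  by rewrite expg0 repr_mx1 mulmx1 (mxtrace_idem P_idem) P_rank expr0.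
rewrite expgS (repr_mxM rG Gy (groupX j Gy)).
by rewrite (mxtrace_rank1M _ P_idem P_rank Py) IHj exprS.
Qed.

Let chi_y_lam j : (0 < j < 6)%N -> chi (y ^+ j)%g = lam ^+ j.
Proof.
move=> j6; rewrite -trP_y; apply: (mulfI n13).
rewrite /P /eigen_proj -scalemxAl mxtraceZ mulVKf// mulmx_suml raddf_sum /=.
rewrite (eq_bigr (fun=> chi (y ^+ j)%g)) => [|k _].
  by rewrite sumr_const card_ord mulr_natl.
rewrite mul0n expr0 invr1 scale1r -(repr_mxM rG (groupX k Gu) (groupX j Gy)).
by rewrite (chi_uy (ltn_ord k) j6) (chi_y j6).
Qed.

Lemma chi_split_torus : lam ^+ 2 = 1 /\
  [/\ chi (cel 1) = lam ^+ 3, chi (cel 2) = lam ^+ 2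
    & chi (cel 3) = lam].
Proof.
have c3 : chi (cel 3) = lam.
  exact: etrans (esym (chi_y (j := 1) isT)) (chi_y_lam (j := 1) isT).
have l5 : lam ^+ 5 = lam.
  exact: etrans (esym (chi_y_lam (j := 5) isT)) (etrans (chi_y (j := 5) isT) c3).
have l6 : lam ^+ 6 = 1.
  by rewrite -trP_y repr_y6 mulmx1 (mxtrace_idem P_idem) P_rank.
split; first by rewrite -l6 [RHS]exprS l5.
split; last exact: c3.
  exact: etrans (esym (chi_y (j := 3) isT)) (chi_y_lam (j := 3) isT).
exact: etrans (esym (chi_y (j := 2) isT)) (chi_y_lam (j := 2) isT).
Qed.

Definition qr13 : seq nat := [:: 1; 3; 4; 9; 10; 12]%N.

Lemma chi_u k : (0 < k < 13)%N ->
  chi (u ^+ k)%g = if k \in qr13 then chi (cel 7) else chi (cel 8).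
Proof.
have tbl : all (fun k => class_idx (pow4 uq k) == if k \in qr13 then 7 else 8)%N
  (iota 1 12) by vm_compute.
move=> k13; have /eqP idx := allP tbl k (etrans (mem_iota 1 12 k) k13).
have -> : (if k \in qr13 then chi (cel 7) else chi (cel 8))
    = chi (cel (if k \in qr13 then 7 else 8)%N) by case: (k \in qr13).
rewrite -(elX k du).
by apply: chi_class (det4_pow k du) idx _; case: (k \in qr13).
Qed.

Lemma chi_z k : (0 < k < 7)%N ->
  chi (z ^+ k)%g = chi (cel (nth 0 [:: 0; 4; 6; 5; 5; 6; 4] k)%N).
Proof.
have tbl : all (fun k => class_idx (pow4 zq k) == nth 0 [:: 0; 4; 6; 5; 5; 6; 4] k)%N
  (iota 1 6) by vm_compute.
move=> k7; have /eqP idx := allP tbl k (etrans (mem_iota 1 6 k) k7).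
rewrite -(elX k dz); apply: chi_class (det4_pow k dz) idx _.
by move: k7; clear; do 7?[case: k => [|k] //].
Qed.

Lemma chi_u12 k : chi (u ^+ (12 * k))%g = chi (u ^+ k)%g.
Proof.
rewrite -[RHS]chi_u10 -[RHS]chi_u10 -[RHS]chi_u10.
rewrite -(repr_exp_mod Gu repr_u13) -[in RHS](repr_exp_mod Gu repr_u13).
by rewrite !mulnA -[in RHS]modnMml.
Qed.

Lemma chi_z6 k : chi (z ^+ (6 * k))%g = chi (z ^+ k)%g.
Proof.
rewrite -(repr_exp_mod Gz repr_z7) -[in RHS](repr_exp_mod Gz repr_z7).
rewrite -modnMmr; have : (k %% 7 < 7)%N by rewrite ltn_mod.
move: (k %% 7)%N => i; case: i => [|i i7]; first by rewrite muln0.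
have [i6 j6] : (0 < i.+1 < 7)%N /\ (0 < 6 * i.+1 %% 7 < 7)%N.
  by move: i7; clear; do 6?[case: i => [|i] //].
rewrite (chi_z i6) (chi_z j6); congr (\tr (rG (cel _))).
by move: i7; clear; do 6?[case: i => [|i] //].
Qed.

Lemma chi1 : chi 1%g = 7%:R.
Proof. by rewrite repr_mx1 mxtrace1. Qed.

Lemma chi_u_sumsq : \sum_(k < 13) chi (u ^+ k)%g ^+ 2 = 91%:R.
Proof.
have [_ muj] := mu_values.
rewrite (emult_parseval prim13 Gu repr_u13 (r := 12) (prim_expr_order prim13) erefl chi_u12).
rewrite (eq_bigr (fun j : 'I_13 => (mu j)%:R)) => [|j _]; last first.
  by case: muj => ->; case: (_ \in _); rewrite ?expr1n ?expr0n.
by rewrite -natr_sum (sum_emult prim13 Gu repr_u13) -natrM.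
Qed.

Lemma chi_unipotent_sums : chi (cel 7) + chi (cel 8) = 1 /\
  chi (cel 7) ^+ 2 + chi (cel 8) ^+ 2 = 7%:R.
Proof.
have sumu (f : F -> F) : \sum_(k < 13) f (chi (u ^+ k)%g)
    = f 7%:R + 6%:R * (f (chi (cel 7)) + f (chi (cel 8))).
  rewrite big_ord_recl expg0 chi1; congr (_ + _).
  rewrite (eq_bigr (fun k : 'I_12 => f (if k.+1 \in qr13 then chi (cel 7)
      else chi (cel 8)))) => [|k _]; last by rewrite chi_u// ltnS ltn_ord.
  move: (chi (cel 7)) (chi (cel 8)) => a b.
  rewrite -(big_mkord xpredT (fun k : nat => f (if k.+1 \in qr13 then a else b))).
  rewrite unlock /=; ring.
have em := emultE prim13 Gu repr_u13 0.
have s1 := sumu id; rewrite /= in s1.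
have s2 := sumu (fun x => x ^+ 2).
have [mu0 _] := mu_values.
have e1 : \sum_(k < 13) chi (u ^+ k)%g = 13%:R.
  transitivity (13%:R * (mu 0)%:R : F); last by rewrite mu0 mulr1.
  rewrite em; apply: eq_bigr => k _.
  by rewrite mul0n expr0 invr1 mul1r.
move: s1 s2; rewrite e1 chi_u_sumsq; move: (chi (cel 7)) (chi (cel 8)) => a b h1 h2.
have n6 : 6%:R != 0 :> F by rewrite pnatr_eq0.
split; apply: (mulfI n6).
  by rewrite -[LHS](addKr 7%:R) -h1; ring.
by rewrite -[LHS](addKr (7%:R ^+ 2)) -h2; ring.
Qed.

Lemma chi_norm_aux d (VV : mx_representation F G d) :
  (forall g, \tr (VV g) = chi g ^+ 2) -> (forall g, rG g = 1%:M -> VV g = 1%:M) ->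
  exists2 n, (n <= 2)%N & \sum_(g in G) chi g ^+ 2 = (#|G| * n)%:R.
Proof.
move=> chi_VV VVN.
have G0 : #|G|%:R != 0 :> F by rewrite pnatr_eq0 -lt0n cardG_gt0.
pose eU := eigen_proj VV 13 eps13 u 0; pose eY := eigen_proj VV 6 eps6 y 0.
have VVu13 : VV (u ^+ 13)%g = 1%:M := VVN _ repr_u13.
have VVy6 : VV (y ^+ 6)%g = 1%:M := VVN _ repr_y6.
have commY A : A *m VV y = VV y *m A -> A *m eY = eY *m A.
  move=> Ay; rewrite /eY /eigen_proj -scalemxAr -scalemxAl mulmx_sumr mulmx_suml.
  congr (_ *: _); apply: eq_bigr => j _; rewrite mul0n expr0 invr1 scale1r.
  elim: (nat_of_ord j) => [|k IHk]; first by rewrite expg0 repr_mx1 mulmx1 mul1mx.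
  by rewrite expgS (repr_mxM VV Gy (groupX k Gy)) mulmxA Ay -!mulmxA IHk.
have UY : eU *m eY = eY *m eU.
  apply: commY.
  exact: (eigen_proj0_comm prim13 Gu VVu13 (r := 10) (r' := 4) Gy u_conj_y erefl).
have idQ : (eU *m eY) *m (eU *m eY) = eU *m eY.
  rewrite {1}UY -!mulmxA (mulmxA eU eU) (eigen_proj_idem prim13 Gu VVu13).
  by rewrite mulmxA -UY -mulmxA (eigen_proj_idem prim6 Gy VVy6).
have trQ : \tr (eU *m eY) = 2%:R.
  rewrite /eU /eY /eigen_proj -scalemxAl -scalemxAr !mxtraceZ.
  rewrite mulmx_suml raddf_sum /=.
  have term (k : 'I_13) : \tr (eps13 ^- (0 * k) *: VV (u ^+ k)%g
      *m \sum_(j < 6) eps6 ^- (0 * j) *: VV (y ^+ j)%g) = chi (u ^+ k)%g ^+ 2 + 5%:R.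
    rewrite mul0n expr0 invr1 scale1r mulmx_sumr raddf_sum /=.
    rewrite (eq_bigr (fun j : 'I_6 => chi (u ^+ k * y ^+ j)%g ^+ 2)); last first.
      move=> j _; rewrite scale1r -chi_VV.
      by rewrite (repr_mxM VV (groupX k Gu) (groupX j Gy)).
    rewrite big_ord_recl expg0 mulg1; congr (_ + _).
    rewrite (eq_bigr (fun=> 1)) => [|j _]; first by rewrite sumr_const card_ord.
    have j6 : (0 < lift ord0 j < 6)%N by rewrite /= /bump add1n ltnS ltn_ord.
    have [l2 _] := chi_split_torus.
    rewrite (chi_uy (ltn_ord k) j6) -(chi_y j6) chi_y_lam//.
    by rewrite exprAC l2 expr1n.
  rewrite (eq_bigr _ (fun k _ => term k)) big_split /= chi_u_sumsq sumr_const card_ord.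
  by field; rewrite ?pnatr_eq0.
have rkQ : \rank (eU *m eY) = 2%N.
  by apply/eqP; rewrite -(eqr_nat F) -(mxtrace_idem idQ) trQ.
exists (\rank (avg VV G)).
  have -> : avg VV G = avg VV G *m (eU *m eY).
    by rewrite mulmxA /eU avg_eigen_proj// /eY avg_eigen_proj.
  by rewrite -rkQ mxrankM_maxr.
rewrite natrM -(mxtrace_avg_rank VV G0 (subxx G)) mxtrace_avg mulVKf//.
by apply: eq_bigr => g _; rewrite chi_VV.
Qed.

Lemma chi_norm : exists2 n, (n <= 2)%N & \sum_(g in G) chi g ^+ 2 = (#|G| * n)%:R.
Proof.
apply: (@chi_norm_aux _ (prod_repr rG rG)) => g; first exact: mxtrace_prod.
move=> g1; have -> : prod_repr rG rG g = tprod (rG g) (rG g) by [].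
by rewrite g1 tprod1.
Qed.

Lemma chi_sum : exists n, \sum_(g in G) chi g = (#|G| * n)%:R.
Proof.
have G0 : #|G|%:R != 0 :> F by rewrite pnatr_eq0 -lt0n cardG_gt0.
exists (\rank (avg rG G)).
by rewrite natrM -(mxtrace_avg_rank rG G0 (subxx G)) mxtrace_avg mulVKf.
Qed.

Lemma sum_class (f : F -> F) : \sum_(g in G) f (chi g) =
  2%:R * f 7%:R + 182%:R * f (chi (cel 1)) + 364%:R * f (chi (cel 2))
  + 364%:R * f (chi (cel 3)) + 312%:R * (f (chi (cel 4)) + f (chi (cel 5)) + f (chi (cel 6)))
  + 168%:R * (f (chi (cel 7)) + f (chi (cel 8))).
Proof.
have fJ g h : g \in G -> h \in G -> f (chi (g ^ h)%g) = f (chi g).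
  by move=> Gg Gh; rewrite (chiJ Gg Gh).
have fN g : g \in G -> f (chi (g * w)%g) = f (chi g) by move=> /repr_minus ->.
rewrite (proj2 (@el_class (fun g => f (chi g)) fJ fN)).
have -> : f 7%:R = f (chi (cel 0)) by rewrite -chi1 -el1.
exact: (class_sizes_sum (fun k => f (chi (cel k)))).
Qed.

Lemma card_G : #|G|%:R = 2184%:R :> F.
Proof.
rewrite -sumr_const.
rewrite (proj2 (@el_class (fun=> 1) (fun _ _ _ _ => erefl) (fun _ _ => erefl))).
rewrite (class_sizes_sum (fun=> 1)); ring.
Qed.

Let n_neq0 n : (0 < n)%N -> n%:R != 0 :> F.
Proof. by move=> n0; rewrite pnatr_eq0 -lt0n. Qed.

Lemma chi_order7 k : (0 < k < 7)%N -> chi (z ^+ k)%g = 0.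
Proof.
move=> k7; pose nu := emult rG 7 eps7 z.
have [l2 [c1 c2 c3]] := chi_split_torus.
have [_ sq78] := chi_unipotent_sums.
have sumz : \sum_(k < 7) chi (z ^+ k)%g ^+ 2 =
    49%:R + 2%:R * (chi (cel 4) ^+ 2 + chi (cel 5) ^+ 2 + chi (cel 6) ^+ 2).
  rewrite big_ord_recl expg0 chi1.
  rewrite (eq_bigr (fun k : 'I_6 => chi (cel (nth 0 [:: 4; 6; 5; 5; 6; 4] k)%N) ^+ 2)).
    rewrite !big_ord_recl big_ord0 /= .
    move: (chi (cel 4)) (chi (cel 5)) (chi (cel 6)) => a b c; ring.
  by move=> i _; rewrite chi_z// ltnS ltn_ord.
have [n n2 norm] := chi_norm.
have nu_all j : nu j = 1%N.
  apply: (@mult7_values _ n) => //.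
  - exact: (emult_mod rG z prim7).
  - move=> i; rewrite /nu (emult_mod rG z prim7).
    exact: (emult_mul prim7 Gz repr_z7 i (r := 6) (r' := 6) erefl chi_z6).
  - exact: (sum_emult prim7 Gz repr_z7).
  apply/eqP; rewrite -(eqr_nat F); apply/eqP/(mulfI (@n_neq0 7 isT)).
  have parse := emult_parseval prim7 Gz repr_z7 (r := 6) (prim_expr_order prim7) erefl chi_z6.
  rewrite natr_sum; under eq_bigr do rewrite natrX.
  rewrite -parse sumz.
  move: norm; rewrite (sum_class (fun x => x ^+ 2)) c1 c2 c3 natrM card_G.
  move: sq78; move: (chi (cel 4)) (chi (cel 5)) (chi (cel 6)) (chi (cel 7)) (chi (cel 8)).
  move=> a b c d e sq78 norm.
  apply: (mulfI (@n_neq0 156 isT)).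
  have -> : 156%:R * (49%:R + 2%:R * (a ^+ 2 + b ^+ 2 + c ^+ 2))
    = 2184%:R * n%:R + 5460%:R :> F.
    rewrite -norm.
    have -> : (lam ^+ 3) ^+ 2 = 1 by rewrite exprAC l2 expr1n.
    by rewrite sq78 l2; ring.
  by ring.
rewrite (chi_emult prim7 Gz repr_z7).
under eq_bigr do rewrite -/(nu _) nu_all mul1r mulnC exprM.
apply: sum_root_unity; first by rewrite exprAC (prim_expr_order prim7) expr1n.
by rewrite -(prim_order_dvd prim7) /dvdn modn_small; case/andP: k7; case: (k).
Qed.

Definition qr_trace : F := 1 + eps13 + eps13 ^+ 12 + eps13 ^+ 4 + eps13 ^+ 9
  + eps13 ^+ 10 + eps13 ^+ 3.
Definition nqr_trace : F := 1 + eps13 ^+ 2 + eps13 ^+ 11 + eps13 ^+ 7 + eps13 ^+ 6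
  + eps13 ^+ 8 + eps13 ^+ 5.

Lemma chi_unipotent :
  (chi (cel 7) = qr_trace /\ chi (cel 8) = nqr_trace) \/
  (chi (cel 7) = nqr_trace /\ chi (cel 8) = qr_trace).
Proof.
have c7 : chi (cel 7) = chi (u ^+ 1)%g by rewrite chi_u.
have c8 : chi (cel 8) = chi (u ^+ 2)%g by rewrite chi_u.
have red k : eps13 ^+ k = eps13 ^+ (k %% 13) by rewrite (prim_expr_mod prim13).
pose tbl (s : pred nat) k := [seq (s j, j * k %% 13)%N | j <- iota 0 13].
have sum (s : pred nat) k : (forall j, mu j = s (j %% 13)%N) ->
    chi (u ^+ k)%g = \sum_(p <- tbl s k) (p.1)%:R * eps13 ^+ p.2.
  move=> sE; rewrite (chi_emult prim13 Gu repr_u13) big_map -[iota 0 13]/(index_iota 0 13).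
  rewrite big_mkord; by apply: eq_bigr => j _; rewrite sE modn_small ?ltn_ord// -red.
have [_ [|] /sum muE] := mu_values; [left|right]; rewrite c7 c8 !muE;
  rewrite /qr_trace /nqr_trace;
  do 2!match goal with |- context [tbl ?s ?k] =>
    let v := eval vm_compute in (tbl s k) in change (tbl s k) with v end;
  rewrite !big_cons !big_nil /= !expr0; split; ring.
Qed.

Lemma chi_table :
  [/\ chi (cel 1) = -1, chi (cel 2) = 1 & chi (cel 3) = -1] /\
  [/\ chi (cel 4) = 0, chi (cel 5) = 0 & chi (cel 6) = 0].
Proof.
have z4 : chi (cel 4) = 0 by rewrite -(chi_z (k := 1) isT) chi_order7.
have z5 : chi (cel 5) = 0 by rewrite -(chi_z (k := 3) isT) chi_order7.
have z6 : chi (cel 6) = 0 by rewrite -(chi_z (k := 2) isT) chi_order7.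
have [l2 [c1 c2 c3]] := chi_split_torus.
split; last by split.
have [s78 _] := chi_unipotent_sums.
have lamN1 : lam = -1.
  have /eqP : (lam - 1) * (lam + 1) = 0.
    have -> : (lam - 1) * (lam + 1) = lam ^+ 2 - 1 by ring.
    by rewrite l2 subrr.
  rewrite mulf_eq0 subr_eq0 addr_eq0 => /orP[/eqP l1|/eqP //].
  have [n] := chi_sum; have := sum_class id; rewrite /= => ->.
  rewrite natrM card_G s78 z4 z5 z6 c1 c2 c3 l1 => e.
  have : 1092%:R = (2184 * n)%:R :> F by rewrite natrM -e; ring.
  move=> /eqP; rewrite eqr_nat => /eqP.
  by clear; case: n => [|n]; lia.
by rewrite c1 c2 c3 lamN1; split; ring.
Qed.

Definition square_class := [:: 0; 0; 2; 2; 6; 4; 5; 8; 7]%N.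

Lemma chi_square k : (k < 9)%N ->
  chi (cel k * cel k)%g = chi (cel (nth 0 square_class k)%N).
Proof.
have tbl : all (fun k => let c := canon_quad k in
  [&& det4 c == 1, class_idx (mul4 c c) == nth 0 square_class k
    & nth 0 square_class k < 9])%N (iota 0 9) by vm_compute.
move=> k9; have /and3P[/eqP dk /eqP idx sk] := allP tbl k (etrans (mem_iota 0 9 k) k9).
by rewrite -(elM dk dk); apply: chi_class (det4M dk dk) idx sk.
Qed.

Lemma sum_chi_square (f : F -> F -> F) :
  \sum_(g in G) f (chi g) (chi (g * g)%g) =
  2%:R * f 7%:R 7%:R + 182%:R * f (-1) 7%:R + 364%:R * f 1 1 + 364%:R * f (-1) 1
  + 936%:R * f 0 0 + 168%:R * (f qr_trace nqr_trace + f nqr_trace qr_trace).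
Proof.
have fJ g h : g \in G -> h \in G ->
    f (chi (g ^ h)%g) (chi (g ^ h * g ^ h)%g) = f (chi g) (chi (g * g)%g).
  by move=> Gg Gh; rewrite -conjMg !chiJ ?groupM.
have fN g : g \in G ->
    f (chi (g * w)%g) (chi (g * w * (g * w))%g) = f (chi g) (chi (g * g)%g).
  move=> Gg; have Ggw := groupM Gg GN.
  by rewrite (repr_minus Gg) (repr_mxM rG Ggw Ggw) (repr_minus Gg) -(repr_mxM rG Gg Gg).
rewrite (proj2 (@el_class (fun g => f (chi g) (chi (g * g)%g)) fJ fN)).
have [[c1 c2 c3] [c4 c5 c6]] := chi_table.
have c0 : chi (cel 0) = 7%:R by rewrite -chi1 -el1.
transitivity (\sum_(k < 9) f (chi (cel k)) (chi (cel (nth 0 square_class k)%N))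
    *+ nth 0%N class_sizes k).
  by apply: eq_bigr => k _; rewrite chi_square.
rewrite (class_sizes_sum (fun k => f (chi (cel k)) (chi (cel (nth 0 square_class k)%N)))).
rewrite /square_class ![nth _ _ _]/= c0 c1 c2 c3 c4 c5 c6.
by case: chi_unipotent => -[-> ->]; ring.
Qed.

End CharactersPSL2_13.

Lemma mxtrace_in_submod (F : fieldType) n (U P M : 'M[F]_n) :
  (P <= U)%MS -> U *m P = U -> (U *m M <= U)%MS ->
  \tr (in_submod U (@val_submod _ _ U _ 1%:M *m M)) = \tr (M *m P).
Proof.
move=> PU UP UM; set V := @val_submod _ _ U _ 1%:M.
have VU : (V <= U)%MS by exact: val_submodP.
have PE : P = in_submod U P *m V by rewrite -val_submodE in_submodK.
have VC : V *m in_submod U P = 1%:M.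
  have VP : V *m P = V by have /submxP[D ->] := VU; rewrite -mulmxA UP.
  apply: (can_inj (val_submodK (U := U))).
  by rewrite val_submodE -mulmxA -PE VP.
have VM : (V *m M <= U)%MS by apply: submx_trans UM; exact: submxMr.
have KV : in_submod U (V *m M) *m V = V *m M by rewrite -val_submodE in_submodK.
rewrite -[in_submod _ _]mulmx1 -VC mulmxA KV -mulmxA mxtrace_mulC -mulmxA.
by rewrite -PE.
Qed.

Lemma mxtrace_lin_mx (R : comNzRingType) m n (f : {linear 'M[R]_(m, n) -> 'M[R]_(m, n)}) :
  \tr (lin_mx f) = \sum_i \sum_j f (delta_mx i j) i j.
Proof.
rewrite pair_big /= /mxtrace (reindex _ (curry_mxvec_bij m n)) /=.
apply: eq_bigr => -[i j] _ /=.
by rewrite mxE /= vec_mx_delta mxvecE.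
Qed.

Section Octonions.
Variable R : realType.
Local Notation e i := (delta_mx 0 i : 'rV[R]_7).

Definition wedgeZ (i j k a b c : nat) : int :=
  let d (x n : nat) : int := (x == n)%:Z in
  d a i * (d b j * d c k - d b k * d c j)
  - d a j * (d b i * d c k - d b k * d c i)
  + d a k * (d b i * d c j - d b j * d c i).

Definition phiZ (a b c : nat) : int :=
  wedgeZ 0 1 2 a b c + wedgeZ 0 3 4 a b c + wedgeZ 0 5 6 a b c
  + wedgeZ 1 3 5 a b c - wedgeZ 1 4 6 a b c
  - wedgeZ 2 3 6 a b c - wedgeZ 2 4 5 a b c.

Definition phi (a b c : 'I_7) : R := (phiZ a b c)%:~R.

Lemma oct3_delta a b c : oct3 (e a) (e b) (e c) = phi a b c.
Proof.
have wE i j k : (i < 7)%N -> (j < 7)%N -> (k < 7)%N ->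
    wedge3 i j k (e a) (e b) (e c) = (wedgeZ i j k a b c)%:~R.
  move=> i7 j7 k7.
  have cE (x : 'I_7) n : (n < 7)%N -> e x 0 (inord n) = (x == n :> nat)%:Z%:~R.
    by move=> n7; rewrite mxE eqxx -val_eqE /= inordK// eq_sym; case: (_ == _).
  by rewrite /wedge3 !cE// /wedgeZ !(rmorphD, rmorphN, rmorphM).
by rewrite /oct3 !wE// /phi /phiZ !(rmorphD, rmorphN).
Qed.

Lemma sum_delta (f : 'rV[R]_7 -> R) :
  (forall a x y, f (a *: x + y) = a * f x + f y) ->
  forall x, f x = \sum_a x 0 a * f (e a).
Proof.
move=> flin x; have f0 : f 0 = 0.
  by have := flin (-1) 0 0; rewrite scaler0 addr0 mulN1r addNr.
rewrite {1}(row_sum_delta x); elim/big_rec2 : _ => // i u v _ <-.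
exact: flin.
Qed.

Lemma oct3_sum1 x y z : oct3 x y z = \sum_a x 0 a * oct3 (e a) y z.
Proof. by apply: (sum_delta (f := fun x => oct3 x y z)) => *; exact: oct3D1. Qed.

Lemma oct3_sum2 x y z : oct3 x y z = \sum_a y 0 a * oct3 x (e a) z.
Proof. by apply: (sum_delta (f := fun y => oct3 x y z)) => *; exact: oct3D2. Qed.

Lemma oct3_sum3 x y z : oct3 x y z = \sum_a z 0 a * oct3 x y (e a).
Proof. by apply: (sum_delta (f := fun z => oct3 x y z)) => *; exact: oct3D3. Qed.

(* Coefficient of X p q in the derivation equation of X at (e i, e j, e k). *)
Definition derZ (i j k p q : nat) : int :=
  (i == p)%:Z * phiZ q j k + (j == p)%:Z * phiZ i q k + (k == p)%:Z * phiZ i j q.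

Definition derphiZ (i j k l : nat) : int :=
  foldr (fun q s => phiZ q j k * phiZ l i q + phiZ i q k * phiZ l j q
                    + phiZ i j q * phiZ l k q + s) 0 (iota 0 7).

Lemma der_phi_checks : let I := iota 0 7 in
  all (fun i => all (fun j => all (fun k =>
    let a := [seq derphiZ i j k l | l <- I] in
    all (fun p => all (fun q => 3 * (derZ i j k p q - derZ i j k q p) ==
      foldr (fun l s => nth 0 a l * phiZ l p q + s) 0 I) I) I) I) I) I.
Proof. by vm_cast_no_check (erefl true). Qed.

Lemma phi_norm_checks : let I := iota 0 7 in
  all (fun k => all (fun l =>
    foldr (fun p s => foldr (fun q s => phiZ k p q * phiZ l p q + s) 0 I + s) 0 I
     == 6 * (k == l)%:Z) I) I
  && all (fun k => all (fun p => all (fun q => phiZ k p q == - phiZ k q p) I) I) I.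
Proof. by vm_cast_no_check (erefl true). Qed.

Lemma foldr_iota7 (h : nat -> int) :
  (foldr (fun q s => h q + s) 0 (iota 0 7))%:~R = \sum_(q < 7) (h q)%:~R :> R.
Proof.
by rewrite -(big_mkord xpredT (fun q => (h q)%:~R)) unlock /= !rmorphD rmorph0.
Qed.

Lemma all_iota7 (P : pred nat) (i : 'I_7) : all P (iota 0 7) -> P i.
Proof. by move=> /allP; apply; rewrite mem_iota ltn_ord. Qed.

Lemma der_phi (i j k p q : 'I_7) :
  3%:R * ((derZ i j k p q)%:~R - (derZ i j k q p)%:~R) =
  \sum_(l < 7) (derphiZ i j k l)%:~R * phi l p q :> R.
Proof.
have := all_iota7 q (all_iota7 p (all_iota7 k (all_iota7 j (all_iota7 i der_phi_checks)))).
move=> /eqP /(congr1 (fun z : int => z%:~R : R)).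
rewrite foldr_iota7 rmorphM rmorphB => ->; apply: eq_bigr => l _.
by rewrite (nth_map 0%N) ?size_iota ?ltn_ord// nth_iota ?ltn_ord// rmorphM.
Qed.

Lemma phi_norm (k l : 'I_7) :
  \sum_(p < 7) \sum_(q < 7) phi k p q * phi l p q = 6%:R * (k == l)%:R.
Proof.
have [chk _] := andP phi_norm_checks.
have /eqP /(congr1 (fun z : int => z%:~R : R)) := all_iota7 l (all_iota7 k chk).
rewrite (foldr_iota7 (fun p => foldr (fun q s => phiZ k p q * phiZ l p q + s) 0 (iota 0 7))).
rewrite rmorphM -[k == l]val_eqE => <-; apply: eq_bigr => p _.
by rewrite foldr_iota7; apply: eq_bigr => q _; rewrite rmorphM.
Qed.

Lemma phi_skew (k p q : 'I_7) : phi k p q = - phi k q p.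
Proof.
have [_ chk] := andP phi_norm_checks.
have /eqP e := all_iota7 q (all_iota7 p (all_iota7 k chk)).
by rewrite /phi e rmorphN.
Qed.

Definition phi_mx (k : 'I_7) : 'M[R]_7 := \matrix_(p, q) phi k p q.

Definition phi_coord (k : 'I_7) (X : 'M[R]_7) : R := \sum_(p < 7) \sum_(q < 7) phi k p q * X p q.

Definition der (i j k : 'I_7) (X : 'M[R]_7) : R :=
  oct3 (e i *m X) (e j) (e k) + oct3 (e i) (e j *m X) (e k) + oct3 (e i) (e j) (e k *m X).

Lemma derE i j k X : der i j k X = \sum_(p < 7) \sum_(q < 7) (derZ i j k p q)%:~R * X p q.
Proof.
have one (h : 'I_7 -> R) (r : 'I_7) :
    \sum_(p < 7) \sum_(q < 7) ((r == p)%:R * h q) * X p q = \sum_(q < 7) X r q * h q.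
  rewrite (bigD1 r) //= [X in _ + X]big1 ?addr0 => [|p rp].
    by apply: eq_bigr => q _; rewrite eqxx mul1r mulrC.
  by rewrite big1// => q _; rewrite eq_sym (negPf rp) !mul0r.
rewrite /der oct3_sum1 (oct3_sum2 (e i)) (oct3_sum3 (e i)).
under eq_bigr do rewrite -rowE mxE oct3_delta.
under [X in _ + X + _]eq_bigr do rewrite -rowE mxE oct3_delta.
under [X in _ + _ + X]eq_bigr do rewrite -rowE mxE oct3_delta.
rewrite -(one (fun q => phi q j k)) -(one (fun q => phi i q k)) -(one (fun q => phi i j q)).
rewrite -!big_split /=; apply: eq_bigr => p _; rewrite -!big_split /=.
by apply: eq_bigr => q _; rewrite /derZ !rmorphD !rmorphM -!mulrDl /phi.
Qed.

Lemma der_skew i j k X : X^T = - X ->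
  6%:R * der i j k X = \sum_(l < 7) (derphiZ i j k l)%:~R * phi_coord l X.
Proof.
move=> Xsk; have XE p q : X q p = - X p q.
  by have /matrixP/(_ p q) := Xsk; rewrite !mxE.
transitivity (\sum_(p < 7) \sum_(q < 7) 3%:R * ((derZ i j k p q)%:~R - (derZ i j k q p)%:~R) * X p q).
  have der' : der i j k X = - \sum_(p < 7) \sum_(q < 7) (derZ i j k q p)%:~R * X p q.
    rewrite derE exchange_big /= -sumrN; apply: eq_bigr => p _.
    by rewrite -sumrN; apply: eq_bigr => q _; rewrite XE mulrN.
  have -> : 6%:R * der i j k X = 3%:R * der i j k X + 3%:R * der i j k X by ring.
  rewrite {1}derE der' mulrN -mulrBr -sumrB mulr_sumr; apply: eq_bigr => p _.
  by rewrite -sumrB mulr_sumr; apply: eq_bigr => q _; ring.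
transitivity (\sum_(p < 7) \sum_(q < 7) \sum_(l < 7) (derphiZ i j k l)%:~R * (phi l p q * X p q)).
  apply: eq_bigr => p _; apply: eq_bigr => q _; rewrite der_phi mulr_suml.
  by apply: eq_bigr => l _; rewrite mulrA.
under eq_bigr do rewrite exchange_big /=.
rewrite exchange_big /=; apply: eq_bigr => l _; rewrite mulr_sumr.
by apply: eq_bigr => p _; rewrite mulr_sumr.
Qed.

Lemma g2_phi_coord X : g2 X <-> X^T = - X /\ forall l, phi_coord l X = 0.
Proof.
split=> [[skX derX]|[skX coordX]].
  have Xsk : X^T = - X by apply/eqP; rewrite -addr_eq0 addrC skX.
  split=> // l.
  pose t : seq (nat * nat * nat) := [:: (1, 5, 4); (0, 3, 6); (0, 3, 5);
    (0, 5, 2); (0, 2, 6); (0, 1, 4); (0, 1, 3)]%N.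
  have chk : all (fun l => all (fun m =>
      let: (i, j, k) := nth (0, 0, 0)%N t l in
      [&& (i < 7)%N, (j < 7)%N, (k < 7)%N &
      derphiZ i j k m == 3 * (l == m)%:Z]) (iota 0 7)) (iota 0 7) by vm_compute.
  have {chk} := all_iota7 l chk.
  case: (nth _ _ _) => -[i j] k chk.
  have /and4P[i7 j7 k7 _] := all_iota7 l chk.
  have := @der_skew (Ordinal i7) (Ordinal j7) (Ordinal k7) X Xsk.
  rewrite /der derX mulr0 (bigD1 l) //= big1 => [|m ml].
    have /and4P[_ _ _ /eqP ->] := all_iota7 l chk.
    by rewrite eqxx mulr1 addr0 => /esym/eqP; rewrite mulf_eq0 intr_eq0 => /eqP.
  have /and4P[_ _ _ /eqP ->] := all_iota7 m chk.
  by rewrite (inj_eq val_inj) eq_sym (negPf ml) mulr0 mul0r.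
have der0 i j k : der i j k X = 0.
  apply/eqP; rewrite -(mulrI_eq0 _ (mulfI (_ : 6%:R != 0))) ?pnatr_eq0// der_skew//.
  by rewrite big1// => l _; rewrite coordX mulr0.
split=> [|x y z]; first by rewrite skX addrN.
pose f x y z := oct3 (x *m X) y z + oct3 x (y *m X) z + oct3 x y (z *m X).
rewrite -/(f x y z).
move: x; apply: linear_row_eq0 => [a x x'|i].
  by rewrite /f !mulmxDl -!scalemxAl !oct3D1; ring.
move: y; apply: linear_row_eq0 => [a y y'|j].
  by rewrite /f !mulmxDl -!scalemxAl !oct3D2; ring.
move: z; apply: linear_row_eq0 => [a z z'|k]; last exact: der0.
by rewrite /f !mulmxDl -!scalemxAl !oct3D3; ring.
Qed.

Lemma phi_coordD k a X Y : phi_coord k (a *: X + Y) = a * phi_coord k X + phi_coord k Y.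
Proof.
rewrite /phi_coord mulr_sumr -big_split; apply: eq_bigr => p _ /=.
rewrite mulr_sumr -big_split; apply: eq_bigr => q _ /=.
by rewrite !mxE; ring.
Qed.

Lemma phi_coord0 k : phi_coord k 0 = 0.
Proof. by rewrite /phi_coord big1// => p _; rewrite big1// => q _; rewrite mxE mulr0. Qed.

Lemma phi_coordB k X Y : phi_coord k (X - Y) = phi_coord k X - phi_coord k Y.
Proof. by have := phi_coordD k (-1) Y X; rewrite scaleN1r addrC => ->; ring. Qed.

Lemma phi_coordZ k a X : phi_coord k (a *: X) = a * phi_coord k X.
Proof. by have := phi_coordD k a X 0; rewrite !addr0 phi_coord0 addr0. Qed.

Lemma phi_coord_sum k (I : finType) (c : I -> R) (M : I -> 'M[R]_7) :
  phi_coord k (\sum_i c i *: M i) = \sum_i c i * phi_coord k (M i).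
Proof.
elim/big_rec2 : _ => [|i u v _ <-]; first exact: phi_coord0.
exact: phi_coordD.
Qed.

Lemma phi_coord_tr k X : phi_coord k X^T = - phi_coord k X.
Proof.
rewrite /phi_coord exchange_big -sumrN; apply: eq_bigr => p _ /=.
by rewrite -sumrN; apply: eq_bigr => q _ /=; rewrite mxE phi_skew mulNr.
Qed.

Lemma phi_coord_phi k l : phi_coord k (phi_mx l) = 6%:R * (k == l)%:R.
Proof.
rewrite -phi_norm; apply: eq_bigr => p _; apply: eq_bigr => q _.
by rewrite mxE.
Qed.

Definition g2_proj (X : 'M[R]_7) : 'M[R]_7 :=
  2%:R^-1 *: (X - X^T) - 6%:R^-1 *: \sum_k phi_coord k X *: phi_mx k.

Lemma g2_projE X i j : g2_proj X i j =
  2%:R^-1 * (X i j - X j i) - 6%:R^-1 * \sum_k phi_coord k X * phi k i j.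
Proof.
rewrite !mxE summxE; congr (_ - _ * _); apply: eq_bigr => k _.
by rewrite !mxE.
Qed.

Lemma g2_proj_linear : linear g2_proj.
Proof.
move=> a X Y; rewrite /g2_proj.
under eq_bigr do rewrite phi_coordD scalerDl -scalerA.
rewrite big_split /= -scaler_sumr linearP /=.
apply/matrixP => p q; rewrite !mxE.
by move: (X p q) (X q p) (Y p q) (Y q p) (_ p q) (_ p q) => *; ring.
Qed.

HB.instance Definition _ :=
  GRing.isLinear.Build R 'M[R]_7 'M[R]_7 _ g2_proj g2_proj_linear.

Lemma phi_coord_proj k X : phi_coord k (g2_proj X) = 0.
Proof.
have n6 : 6%:R != 0 :> R by rewrite pnatr_eq0.
rewrite /g2_proj phi_coordB !phi_coordZ phi_coordB phi_coord_tr.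
rewrite phi_coord_sum (bigD1 k) //= big1 => [|l lk]; last first.
  by rewrite phi_coord_phi eq_sym (negPf lk) !mulr0.
by rewrite phi_coord_phi eqxx mulr1 addr0; field.
Qed.

Lemma g2_proj_g2 X : g2 (g2_proj X).
Proof.
apply/g2_phi_coord; split=> [|l]; last exact: phi_coord_proj.
apply/matrixP => p q; rewrite !mxE !summxE.
rewrite (eq_bigr (fun k => - (phi_coord k X *: phi_mx k) p q)) ?sumrN.
  by move: (\sum_k _) => s; rewrite ?mxE; ring.
by move=> k _; rewrite !mxE phi_skew mulrN.
Qed.

Lemma g2_proj_id X : g2 X -> g2_proj X = X.
Proof.
move=> /g2_phi_coord[skX coordX]; rewrite /g2_proj big1 => [|k _].
  by rewrite skX scaler0 subr0; apply/matrixP => p q; rewrite !mxE; field.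
by rewrite coordX scale0r.
Qed.

Lemma g2_mx_proj : (lin_mx g2_proj <= g2_mx R)%MS /\
  g2_mx R *m lin_mx g2_proj = g2_mx R.
Proof.
split.
  apply/row_subP => i; rewrite rowE -[delta_mx _ _]vec_mxK mul_vec_lin.
  by apply/g2_mxP; exact: g2_proj_g2.
apply/row_matrixP => i; rewrite row_mul -[row i (g2_mx R)]vec_mxK mul_vec_lin /=.
rewrite g2_proj_id//; apply/g2_mxP; rewrite vec_mxK; exact: row_sub.
Qed.

Lemma g2_mx_Ad A : G2 A -> (g2_mx R *m lin_mx (Ad A) <= g2_mx R)%MS.
Proof.
move=> GA; apply/row_subP => i; rewrite row_mul -[row i (g2_mx R)]vec_mxK mul_vec_lin.
by apply/g2_mxP/(g2_Ad GA)/g2_mxP; rewrite vec_mxK row_sub.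
Qed.

Lemma mxtrace_Ad_proj A : G2 A ->
  \tr (lin_mx (Ad A) *m lin_mx g2_proj) = (\tr A ^+ 2 - \tr (A *m A)) / 2%:R - \tr A.
Proof.
move=> [AAT GA]; have [uA _] := mulmx1_unit AAT.
have AV : invmx A = A^T by rewrite -[invmx A]mulmx1 -AAT mulKmx.
have -> : \tr (lin_mx (Ad A) *m lin_mx g2_proj)
    = \sum_(i < 7) \sum_(j < 7) g2_proj (Ad A (delta_mx i j)) i j.
  rewrite pair_big /= /mxtrace (reindex _ (curry_mxvec_bij 7 7)) /=.
  apply: eq_bigr => -[i j] _ /=.
  set k := mxvec_index i j; set M := _ *m _.
  have -> : M k k = row k M 0 k by rewrite [RHS]mxE.
  by rewrite rowE -mxvec_delta /M mulmxA !mul_vec_lin mxvecE.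
have AdE i j p q : Ad A (delta_mx i j) p q = A i p * A j q.
  rewrite /Ad AV -(mul_delta_mx (0 : 'I_1)) mulmxA -colE -mulmxA -rowE mxE big_ord1.
  by rewrite !mxE.
have trA : \sum_(i < 7) \sum_(j < 7) A i i * A j j = \tr A ^+ 2.
  by rewrite expr2 mulr_suml; apply: eq_bigr => i _; rewrite mulr_sumr.
have trAA : \sum_(i < 7) \sum_(j < 7) A i j * A j i = \tr (A *m A).
  by apply: eq_bigr => i _; rewrite mxE.
have trphi : \sum_(i < 7) \sum_(j < 7)
    \sum_k phi_coord k (Ad A (delta_mx i j)) * phi k i j = 6%:R * \tr A.
  under eq_bigr do rewrite exchange_big /=.
  rewrite exchange_big /= /mxtrace mulr_sumr; apply: eq_bigr => k _.
  have coordE i j : phi_coord k (Ad A (delta_mx i j)) = \sum_c A c k * phi c i j.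
    transitivity (oct3 (e k) (e i *m A) (e j *m A)).
      rewrite /phi_coord (oct3_sum2 (e k)); apply: eq_bigr => p _.
      rewrite (oct3_sum3 (e k)) mulr_sumr; apply: eq_bigr => q _.
      by rewrite AdE oct3_delta -!rowE !mxE; ring.
    have -> : e k = e k *m A^T *m A by rewrite -mulmxA -AV mulVmx// mulmx1.
    rewrite GA oct3_sum1; apply: eq_bigr => c _.
    by rewrite oct3_delta -rowE !mxE.
  transitivity (\sum_c A c k * \sum_(i < 7) \sum_(j < 7) phi c i j * phi k i j).
    under eq_bigr do under eq_bigr do rewrite coordE mulr_suml.
    under eq_bigr do rewrite exchange_big /=.
    rewrite exchange_big /=; apply: eq_bigr => c _; rewrite mulr_sumr.
    apply: eq_bigr => i _; rewrite mulr_sumr; apply: eq_bigr => j _.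
    by rewrite mulrA.
  rewrite (bigD1 k) //= [X in _ + X]big1 => [|c ck].
    by rewrite phi_norm eqxx mulr1 addr0 mulrC.
  by rewrite phi_norm (negPf ck) !mulr0.
transitivity (2%:R^-1 * (\tr A ^+ 2 - \tr (A *m A)) - 6%:R^-1 * (6%:R * \tr A)); last by field.
rewrite -trphi -trA -trAA -sumrB !mulr_sumr -sumrB; apply: eq_bigr => i _.
rewrite -sumrB !mulr_sumr -sumrB; apply: eq_bigr => j _.
by rewrite g2_projE !AdE.
Qed.

Lemma mxtrace_rho2 (A : 'M[R]_7) : G2 A -> \tr (rho2 A) =
  (\tr (rho1 A) ^+ 2 - \tr (rho1 (A *m A))) / 2%:R - \tr (rho1 A).
Proof.
move=> GA; have [PU UP] := g2_mx_proj.
rewrite /rho2 /rho1 !trace_map_mx (mxtrace_in_submod PU UP (g2_mx_Ad GA)).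
rewrite (mxtrace_Ad_proj GA).
by rewrite rmorphB fmorph_div rmorphB rmorphXn /= rmorph_nat.
Qed.

End Octonions.

Local Open Scope complex_scope.

Section Cis.
Variable R : realType.
Implicit Types (s t : R) (z : circle R).

Lemma circle_inj : injective (@cval R).
Proof. exact: val_inj. Qed.

Lemma cval_neq0 z : cval z != 0.
Proof. by rewrite -normr_gt0 (eqP (cvalP z)) ltr01. Qed.

Lemma cvalV z : (cval z)^-1 = (cval z)^*.
Proof. by rewrite invc_norm (eqP (cvalP z)) expr1n invr1 mul1r. Qed.

Lemma cisD s t : cval (cis (s + t)) = cval (cis s) * cval (cis t).
Proof. by rewrite /= mulrDr cosD sinD; simpc; congr (_ +i* _); ring. Qed.

Lemma cis0 : cval (cis (0 : R)) = 1.
Proof. by rewrite /= mulr0 cos0 sin0. Qed.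

Lemma cis1 : cval (cis (1 : R)) = 1.
Proof. by rewrite /= mulr1 mulr_natl cos2pi sin2pi. Qed.

Lemma cisN t : cval (cis (- t)) = (cval (cis t))^-1.
Proof.
by apply: (mulIf (cval_neq0 (cis t))); rewrite -cisD addNr cis0 mulVf ?cval_neq0.
Qed.

Lemma cisMn n t : cval (cis (n%:R * t)) = cval (cis t) ^+ n.
Proof.
elim: n => [|n IHn]; first by rewrite mul0r cis0.
by rewrite -natr1 mulrDl mul1r cisD IHn exprSr.
Qed.

Lemma cisB s t : cval (cis (s - t)) = cval (cis s) / cval (cis t).
Proof. by rewrite cisD cisN. Qed.

Lemma cis_nat n : cval (cis (n%:R : R)) = 1.
Proof. by rewrite -[n%:R]mulr1 cisMn cis1 expr1n. Qed.

Lemma cis_eq1 t : 0 <= t < 1 -> cval (cis t) = 1 -> t = 0.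
Proof.
move=> /andP[t0 t1] [c1 s0]; have pi0 := pi_gt0 R.
have half (u : R) : 0 <= u <= 1 / 2 -> cos (2 * pi * u) = 1 -> u = 0.
  move=> /andP[u0 u1] cu.
  have : 2 * pi * u = 0.
    have ui : 2 * pi * u \in `[0, pi].
      rewrite in_itv /=; have p0 : 0 <= pi * u by apply: mulr_ge0 => //; exact: pi_ge0.
      have p1 : 0 <= pi * (1 - 2 * u) by apply: mulr_ge0; [exact: pi_ge0|lra].
      by apply/andP; split; lra.
    have zi : (0 : R) \in `[0, pi] by rewrite in_itv /= lexx pi_ge0.
    by apply: (cos_inj ui zi); rewrite cos0.
  by move=> /eqP; rewrite mulf_eq0 gt_eqF ?mulr_gt0//= => /eqP.
have [th|th] := leP t (1 / 2); first by apply: half => //; rewrite t0.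
have /half : 0 <= 1 - t <= 1 / 2 by lra.
move=> h; suff : 1 - t = 0 by lra.
apply: h; have -> : 2 * pi * (1 - t) = - (2 * pi * t) + pi *+ 2 by rewrite mulr2n; ring.
by rewrite cosD2pi cosN.
Qed.

Lemma cis_prim n : (0 < n)%N -> n.-primitive_root (cval (cis (n%:R^-1 : R))).
Proof.
move=> n0; have nn0 : n%:R != 0 :> R by rewrite pnatr_eq0 -lt0n.
apply/andP; split=> //; apply/forallP => i; rewrite unity_rootE -cisMn.
have [->|iN] := eqVneq i.+1 n; first by rewrite mulfV// cis1 eqxx.
apply/eqP/negbTE/eqP => /cis_eq1; apply/not_implyP; split.
  rewrite divr_ge0 ?ler0n//= ltr_pdivrMr ?ltr0n// mul1r ltr_nat.
  by rewrite ltn_neqAle iN ltn_ord.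
by move/eqP; rewrite mulf_eq0 invr_eq0 (negPf nn0) pnatr_eq0.
Qed.

Lemma cis_surj z : exists2 t, 0 <= t < 1 & cis t = z.
Proof.
have pi0 := pi_gt0 R.
case: z => -[x y] nz; have e1 : x ^+ 2 + y ^+ 2 = 1.
  have := add_Re2_Im2 (x +i* y); rewrite (eqP nz) expr1n /= => -[].
  by [].
have x11 : -1 <= x <= 1 by apply/andP; split; nra.
have cx : cos (acos x) = x by rewrite acosK// in_itv.
have sx : sin (acos x) = `|y| by 
  by rewrite sin_acos// -sqrtr_sqr -e1 addrAC subrr add0r.
have a0 := acos_ge0 x11; have api := acos_lepi x11.
have t2 (u : R) : 2 * pi * (u / (2 * pi)) = u.
  by rewrite mulrCA mulfV ?mulr1// mulf_neq0 ?pnatr_eq0// gt_eqF.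
have [y0|y0] := leP 0 y.
  exists (acos x / (2 * pi)).
    apply/andP; split; first by apply: divr_ge0 => //; nra.
    by rewrite ltr_pdivrMr; nra.
  by apply: circle_inj; rewrite /= t2 cx sx ger0_norm.
exists (1 - acos x / (2 * pi)).
  have x1 : x < 1 by nra.
  have ap : 0 < acos x by apply: acos_gt0; move/andP: x11 => [-> _].
  have q0 : 0 < acos x / (2 * pi) by apply: divr_gt0 => //; nra.
  have q1 : acos x / (2 * pi) <= 1 by rewrite ler_pdivrMr; nra.
  by apply/andP; split; lra.
apply: circle_inj; rewrite /= mulrBr mulr1 t2 [2 * pi]mulr_natl.
by rewrite addrC cosD2pi sinD2pi cosN sinN cx sx ltr0_norm// opprK.
Qed.

Lemma thetaK z : cis (theta z) = z.
Proof.
rewrite /theta; case: xgetP => [t _ [_ //]|no].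
by have [t t01 tz] := cis_surj z; case: (no t).
Qed.

Definition J_poly (z1 z2 : R[i]) : R[i] :=
  z1 ^+ 2 * z2 + z1 * z2 ^- 3 + z1 ^+ 3 * z2 ^- 2
  - z1 * z2 ^+ 2 - z1 ^+ 3 * z2^-1 - z1 ^+ 2 * z2 ^- 3.

Lemma J_cis s t : J_angle s t =
  8 * pi ^+ 2 * complex.Re (J_poly (cval (cis s)) (cval (cis t))).
Proof.
have ReD (x y : R[i]) : complex.Re (x + y) = complex.Re x + complex.Re y by case: x y => ? ? [].
have ReN (x : R[i]) : complex.Re (- x) = - complex.Re x by case: x.
rewrite /J_angle /J_poly !ReD !ReN -!exprVn -!cisN -!cisMn -!cisD /=.
by congr (_ * (_ + _ + _ - _ - _ - _)); congr (cos (_ * _)); ring.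
Qed.

Lemma J_E (w : torus R) :
  J w = 8 * pi ^+ 2 * complex.Re (J_poly (cval w.1) (cval w.2)).
Proof. by rewrite /J J_cis !thetaK. Qed.

End Cis.

Lemma sum_quotient (V : nmodType) (gT : finGroupType) (G H : {group gT})
    (f : coset_of H -> V) : normal H G ->
  \sum_(g in G) f (coset H g) = (\sum_(x in (G / H)%g) f x) *+ #|H|.
Proof.
move=> /andP[sHG nHG].
rewrite (partition_big (coset H) (mem (G / H)%g)) /=; last first.
  by move=> g Gg; exact: mem_quotient.
rewrite -sumrMnl; apply: eq_bigr => _ /morphimP[g Ng Gg ->] /=.
rewrite (eq_bigr (fun=> f (coset H g))); last by move=> h /andP[_ /eqP ->].
rewrite sumr_const; congr (_ *+ _).
rewrite -(card_lcoset H g); apply: eq_card => h; rewrite -[LHS]/((h \in G) && (coset H h == coset H g)).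
apply/andP/idP => [[Gh /eqP e]|].
  have Nh := fintype.subsetP nHG _ Gh; rewrite mem_lcoset; apply: coset_idr.
    by rewrite groupM ?groupV.
  by rewrite morphM ?morphV ?groupV//= e mulVg.
move=> /lcosetP[k Hk ->]; have Nk := fintype.subsetP (normG H) _ Hk.
split; first by rewrite groupM// (fintype.subsetP sHG).
by rewrite morphM//= (coset_id Hk) mulg1.
Qed.

Lemma pchar_group (F : numFieldType) (gT : finGroupType) (G : {group gT}) :
  ([pchar F]^'.-group G)%g.
Proof. by apply/pgroupP=> p _ _; rewrite inE /= pchar_num. Qed.

Section Moments.
Variables (R : realType) (iota : G2_embedding R (PSL2 'F_13)).
Local Notation G := (SL2_group 'F_13).
Local Notation Z := ('Z(SL2 'F_13))%g.

Lemma SL2_center_normal : normal Z G.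
Proof. exact: center_normal. Qed.

Definition psl (g : {'GL_2['F_13]}) : coset_of Z := coset Z g.

Lemma psl_PSL2 g : g \in G -> psl g \in PSL2 'F_13.
Proof. exact: mem_quotient. Qed.

Lemma pslM g h : g \in G -> h \in G -> psl (g * h)%g = (psl g * psl h)%g.
Proof.
have nZ := fintype.subsetP (normal_norm SL2_center_normal).
by move=> Gg Gh; rewrite /psl morphM ?nZ.
Qed.

Lemma psl_mx_repr : mx_repr G (fun g => rho1 (iota (psl g))).
Proof.
have [h1 hM] := rho1_mx_repr iota.
split=> [|g h Gg Gh]; first by rewrite /psl morph1; exact: h1.
by rewrite pslM// hM ?psl_PSL2.
Qed.

Definition psl_repr := MxRepresentation psl_mx_repr.

Local Notation chi1 x := (\tr (rho1_repr iota x)).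
Local Notation chi2 x := (\tr (rho2_repr iota x)).

Lemma class_moment_avg m n : class_moment iota m n =
  #|PSL2 'F_13|%:R^-1 * \sum_(x in PSL2 'F_13) chi1 x ^+ m * chi2 x ^+ n.
Proof.
rewrite -(class_sum (f := fun x => chi1 x ^+ m * chi2 x ^+ n)) => [|x y Gx Gy].
  rewrite mulr_sumr; apply: eq_bigr => C _.
  by rewrite [RHS]mulrnAr -mulrnAl mulr_natl.
by rewrite !mxtrace_reprJ.
Qed.

Lemma mckay_moment_avg m n : mckay_moment iota m n =
  #|PSL2 'F_13|%:R^-1 * \sum_(x in PSL2 'F_13) chi1 x ^+ m * chi2 x ^+ n.
Proof. exact: (mckay_mx_moment (pchar_group _ _)). Qed.

Lemma chi2E x : x \in PSL2 'F_13 ->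
  chi2 x = (chi1 x ^+ 2 - chi1 (x * x)%g) / 2%:R - chi1 x.
Proof. by move=> Gx; rewrite /= (mxtrace_rho2 (emb_G2 iota Gx)) -embM. Qed.

Lemma elt_minus1_center : psl (elt minus1) = 1%g.
Proof.
apply: coset_id; apply/centerP; split=> [|g Gg]; first exact: elt_SL2.
apply: GLval_inj; rewrite !GL_ME elt_val//.
have -> : mx4 minus1 = (-1)%:M.
  by apply: mx22_eq; rewrite !mxE /= ?F13_12 ?mulr1n ?mulr0n.
by rewrite [LHS]mul_scalar_mx [RHS]mul_mx_scalar.
Qed.

Lemma elt_uq_not_center : psl (elt uq) <> 1%g.
Proof.
have Nu : elt uq \in 'N(Z)%g.
  by apply: (fintype.subsetP (normal_norm SL2_center_normal)); exact: elt_SL2.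
have dv : det4 (1, 0, 1, 1)%N = 1%N by [].
have du : det4 uq = 1%N by [].
move=> /(coset_idr Nu) /centerP[_ /(_ _ (elt_SL2 dv))].
move=> e; have := etrans (eltM du dv) (etrans e (esym (eltM dv du))).
move=> /(elt_mx4 (det4M du dv) (det4M dv du))/(congr1 (fun A : 'M['F_13]_2 => A 0 0)).
by rewrite !mxE.
Qed.

Lemma psl_repr_minus1 : psl_repr (elt minus1) = 1%:M.
Proof. by rewrite /= elt_minus1_center; have [] := rho1_mx_repr iota. Qed.

Lemma psl_repr_uq : psl_repr (elt uq) <> 1%:M.
Proof.
move=> /= e; apply: elt_uq_not_center; apply: (emb_inj (g := iota)).
- by apply: psl_PSL2; exact: elt_SL2.
- exact: group1.
by rewrite emb1; apply: (map_mx_inj (f := real_complex R)); rewrite map_mx1.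
Qed.

Let el_class (f : {'GL_2['F_13]} -> R[i]) :
  (forall g h, g \in G -> h \in G -> f (g ^ h)%g = f g) ->
  (forall g, g \in G -> f (g * elt minus1)%g = f g) ->
  (forall q, det4 q = 1%N -> (class_idx q < 9)%N ->
     f (elt q) = f (elt (canon_quad (class_idx q)))) /\
  \sum_(g in G) f g
    = \sum_(k < 9) f (elt (canon_quad k)) *+ nth 0%N class_sizes k.
Proof.
move=> fJ fN; split=> [q dq q9|]; first exact: (class_idxP fJ fN dq q9).
exact: (sum_SL2 fJ fN).
Qed.

Definition power_sum (m n : nat) (x s : R[i]) : R[i] :=
  x ^+ m * ((x ^+ 2 - s) / 2%:R - x) ^+ n.

Lemma moment_table (eps : R[i]) (m n : nat) : 13.-primitive_root eps ->
  let F := power_sum m n in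
  #|PSL2 'F_13|%:R^-1 * \sum_(x in PSL2 'F_13) chi1 x ^+ m * chi2 x ^+ n =
  1092%:R^-1 * (F 7%:R 7%:R + 91%:R * F (-1) 7%:R + 182%:R * F 1 1 + 182%:R * F (-1) 1
    + 468%:R * F 0 0 + 84%:R * (F (qr_trace eps) (nqr_trace eps)
                                 + F (nqr_trace eps) (qr_trace eps))).
Proof.
move=> prim F.
have prim7 := @cis_prim R 7 isT; have prim6 := @cis_prim R 6 isT.
have Z0 : #|Z|%:R != 0 :> R[i] by rewrite pnatr_eq0 -lt0n cardG_gt0.
have avgE (f : coset_of Z -> R[i]) :
    #|PSL2 'F_13|%:R^-1 * \sum_(x in PSL2 'F_13) f x
    = #|G|%:R^-1 * \sum_(g in G) f (psl g).
  rewrite (sum_quotient f SL2_center_normal) -[_ *+ #|Z|]mulr_natr.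
  have -> : #|G|%:R = #|PSL2 'F_13|%:R * #|Z|%:R :> R[i].
    rewrite -natrM; congr (_%:R); apply/esym.
    by rewrite card_quotient ?normal_norm ?SL2_center_normal// mulnC Lagrange// center_sub.
  by rewrite invfM -[RHS]mulrA; congr (_ * _); rewrite mulrCA mulVf// mulr1.
rewrite avgE.
have := sum_chi_square prim prim7 prim6 elt1 elt_SL2 eltM el_class psl_repr_minus1
  psl_repr_uq F.
rewrite (eq_bigr (fun g => chi1 (psl g) ^+ m * chi2 (psl g) ^+ n)); last first.
  move=> g Gg; rewrite (chi2E (psl_PSL2 Gg)) -(pslM Gg Gg).
  by [].
move=> ->; rewrite (card_G el_class).
move: (F 7%:R 7%:R) (F (-1) 7%:R) (F 1 1) (F (-1) 1) (F 0 0) => a b c d e.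
move: (F (qr_trace eps) (nqr_trace eps)) (F (nqr_trace eps) (qr_trace eps)) => f g.
by field.
Qed.

End Moments.

Local Open Scope classical_set_scope.

Section BoundedMeasurable.
Context {d : measure_display} {T : measurableType d} {R : realType}.
Implicit Types f g : T -> R.

Definition bounded_mfun f :=
  measurable_fun setT f /\ exists M : R, forall t, `|f t| <= M.

Lemma bounded_mfun_cst c : bounded_mfun (fun=> c).
Proof. by split; [exact: measurable_cst|exists `|c|]. Qed.

Lemma bounded_mfunD f g : bounded_mfun f -> bounded_mfun g ->
  bounded_mfun (fun t => f t + g t).
Proof.
move=> [mf [M fM]] [mg [N gN]]; split; first exact: measurable_funD.
by exists (M + N) => t; rewrite (le_trans (ler_normD _ _))// lerD.
Qed.

Lemma bounded_mfunM f g : bounded_mfun f -> bounded_mfun g ->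
  bounded_mfun (fun t => f t * g t).
Proof.
move=> [mf [M fM]] [mg [N gN]]; split; first exact: measurable_funM.
by exists (M * N) => t; rewrite normrM ler_pM.
Qed.

Lemma bounded_mfunN f : bounded_mfun f -> bounded_mfun (fun t => - f t).
Proof.
move=> bf; have := bounded_mfunM (bounded_mfun_cst (-1)) bf.
by congr bounded_mfun; apply/funext => t; rewrite mulN1r.
Qed.

Lemma bounded_mfunX f n : bounded_mfun f -> bounded_mfun (fun t => f t ^+ n).
Proof.
move=> bf; elim: n => [|n IHn]; first exact: (bounded_mfun_cst 1).
by have := bounded_mfunM bf IHn; congr bounded_mfun; apply/funext => t; rewrite exprS.
Qed.

Lemma bounded_mfun_sum (I : Type) (s : seq I) (f : I -> T -> R) :
  (forall i, bounded_mfun (f i)) -> bounded_mfun (fun t => \sum_(i <- s) f i t).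
Proof.
move=> bf; elim: s => [|i s IHs].
  by have := bounded_mfun_cst 0; congr bounded_mfun; apply/funext => t; rewrite big_nil.
have := bounded_mfunD (bf i) IHs.
by congr bounded_mfun; apply/funext => t; rewrite big_cons.
Qed.

Lemma bounded_mfun_indic (A : set T) : measurable A -> bounded_mfun (\1_A).
Proof.
move=> mA; split; first exact: measurable_indic.
by exists 1 => t; rewrite indicE; case: (t \in A); rewrite ?normr1 ?normr0.
Qed.

Lemma bounded_mfun_integrable (mu : probability T R) f :
  bounded_mfun f -> mu.-integrable setT (EFin \o f).
Proof.
move=> [mf [M fM]]; apply: measurable_bounded_integrable => //.
  by rewrite ltey_eq fin_num_measure.
exists M; split; first exact: num_real.
by move=> N MN t _ /=; rewrite (le_trans (fM t))// ltW.
Qed.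

Local Notation E mu f := (\int[mu]_t f t).

Lemma expectD (mu : probability T R) f g : bounded_mfun f -> bounded_mfun g ->
  \int[mu]_t (f t + g t) = \int[mu]_t f t + \int[mu]_t g t.
Proof. by move=> bf bg; rewrite RintegralD//; exact: bounded_mfun_integrable. Qed.

Lemma expectZ (mu : probability T R) c f : bounded_mfun f ->
  \int[mu]_t (c * f t) = c * \int[mu]_t f t.
Proof. by move=> bf; rewrite RintegralZl//; exact: bounded_mfun_integrable. Qed.

Lemma expect_indic (mu : probability T R) A : measurable A ->
  \int[mu]_t (\1_A t) = fine (mu A).
Proof. by move=> mA; rewrite /Rintegral integral_indic// setIT. Qed.

Lemma expect_ae (mu : probability T R) (A : set T) f g : measurable A ->
  mu (~` A) = 0%E -> bounded_mfun f -> bounded_mfun g ->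
  (forall t, A t -> f t = g t) -> \int[mu]_t f t = \int[mu]_t g t.
Proof.
move=> mA A0 [mf _] [mg _] fg; rewrite /Rintegral; congr fine.
apply: ae_eq_integral => //; [exact/measurable_EFinP|exact/measurable_EFinP|].
exists (~` A); split => //; first exact: measurableC.
move=> t; apply: contra_not => At _; by rewrite fg//; exact: contrapT.
Qed.

Lemma expect_ge0_eq0 (mu : probability T R) f : bounded_mfun f ->
  (forall t, 0 <= f t) -> \int[mu]_t f t = 0 -> mu (~` [set t | f t = 0]) = 0%E.
Proof.
move=> bf f0 If; have [mf _] := bf.
have If0 : (\int[mu]_t `|(f t)%:E| = 0)%E.
  have fin := integrable_fin_num measurableT (bounded_mfun_integrable mu bf).
  rewrite (eq_integral (EFin \o f)) => [|t _]; last by rewrite /= ger0_norm.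
  by rewrite -(fineK fin) [fine _]If.
have mf' : measurable_fun setT (EFin \o f) by exact/measurable_EFinP.
have [N [mN N0 subN]] := (ae_eq_integral_abs mu measurableT mf').1 If0.
apply: (subset_measure0 _ mN _ N0).
  have := mf measurableT _ (measurable_set1 0); rewrite setTI => m0.
  exact: measurableC.
by move=> t /= ft; apply: subN => /=; apply/not_implyP; split=> // -[].
Qed.

End BoundedMeasurable.

Section MomentsDetermineFibres.
Context {d : measure_display} {T : measurableType d} {R : realType}.
Variables (mu nu : probability T R) (u v : T -> R).
Hypotheses (bu : bounded_mfun u) (bv : bounded_mfun v).
Hypothesis moments : forall m n,
  \int[mu]_t (u t ^+ m * v t ^+ n) = \int[nu]_t (u t ^+ m * v t ^+ n).

Definition same_moments (h : T -> R) := bounded_mfun h /\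
  forall m n, \int[mu]_t (h t * (u t ^+ m * v t ^+ n))
            = \int[nu]_t (h t * (u t ^+ m * v t ^+ n)).

Let bmon m n : bounded_mfun (fun t => u t ^+ m * v t ^+ n).
Proof. by apply: bounded_mfunM; exact: bounded_mfunX. Qed.

Lemma same_momentsE h : same_moments h -> \int[mu]_t h t = \int[nu]_t h t.
Proof.
move=> [_ /(_ 0 0)%N].
have -> : (fun t => h t * (u t ^+ 0 * v t ^+ 0)) = h.
  by apply/funext => t; rewrite !expr0 !mulr1.
move=> e; exact: e.
Qed.

Lemma same_moments1 : same_moments (fun=> 1).
Proof.
split=> [|m n]; first exact: bounded_mfun_cst.
have e : (fun t => 1 * (u t ^+ m * v t ^+ n)) = (fun t => u t ^+ m * v t ^+ n).
  by apply/funext => t; rewrite mul1r.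
by rewrite e moments.
Qed.

Lemma same_momentsZ c h : same_moments h -> same_moments (fun t => c * h t).
Proof.
move=> [bh mh]; split=> [|m n]; first exact: bounded_mfunM (bounded_mfun_cst c) bh.
have e : (fun t => c * h t * (u t ^+ m * v t ^+ n))
    = (fun t => c * (h t * (u t ^+ m * v t ^+ n))).
  by apply/funext => t; rewrite !mulrA.
by rewrite e !expectZ ?mh//; exact: bounded_mfunM.
Qed.

Lemma same_momentsD h k : same_moments h -> same_moments k ->
  same_moments (fun t => h t + k t).
Proof.
move=> [bh mh] [bk mk]; split=> [|m n]; first exact: bounded_mfunD.
have e : (fun t => (h t + k t) * (u t ^+ m * v t ^+ n))
    = (fun t => h t * (u t ^+ m * v t ^+ n) + k t * (u t ^+ m * v t ^+ n)).
  by apply/funext => t; rewrite mulrDl.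
by rewrite e !expectD ?mh ?mk//; exact: bounded_mfunM.
Qed.

Lemma same_momentsu h : same_moments h -> same_moments (fun t => u t * h t).
Proof.
move=> [bh mh]; split=> [|m n]; first exact: bounded_mfunM.
have e : (fun t => u t * h t * (u t ^+ m * v t ^+ n))
    = (fun t => h t * (u t ^+ m.+1 * v t ^+ n)).
  by apply/funext => t; rewrite exprS; ring.
by rewrite e mh.
Qed.

Lemma same_momentsv h : same_moments h -> same_moments (fun t => v t * h t).
Proof.
move=> [bh mh]; split=> [|m n]; first exact: bounded_mfunM.
have e : (fun t => v t * h t * (u t ^+ m * v t ^+ n))
    = (fun t => h t * (u t ^+ m * v t ^+ n.+1)).
  by apply/funext => t; rewrite exprS; ring.
by rewrite e mh.
Qed.

Definition sqdist (s s' : R * R) : R := (s.1 - s'.1) ^+ 2 + (s.2 - s'.2) ^+ 2.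

Lemma sqdist_eq0 s s' : (sqdist s s' == 0) = (s == s').
Proof.
rewrite /sqdist paddr_eq0 ?sqr_ge0// !sqrf_eq0 !subr_eq0.
by case: s s' => [a b] [c e].
Qed.

Lemma same_moments_sqdist s h : same_moments h ->
  same_moments (fun t => sqdist (u t, v t) s * h t).
Proof.
move=> gh.
have := same_momentsD (same_momentsD (same_momentsu (same_momentsu gh))
  (same_momentsD (same_momentsZ (- (2 * s.1)) (same_momentsu gh))
     (same_momentsZ (s.1 ^+ 2) gh)))
  (same_momentsD (same_momentsv (same_momentsv gh))
  (same_momentsD (same_momentsZ (- (2 * s.2)) (same_momentsv gh))
     (same_momentsZ (s.2 ^+ 2) gh))).
by congr same_moments; apply/funext => t; rewrite /sqdist /=; ring.
Qed.

Lemma same_moments_prod (S : seq (R * R)) :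
  same_moments (fun t => \prod_(s <- S) sqdist (u t, v t) s).
Proof.
elim: S => [|s S IHS].
  have := same_moments1.
  by congr same_moments; apply/funext => t; rewrite big_nil.
have := same_moments_sqdist s IHS.
by congr same_moments; apply/funext => t; rewrite big_cons.
Qed.

Lemma same_moments_sum (I : Type) (S : seq I) (f : I -> T -> R) :
  (forall i, same_moments (f i)) -> same_moments (fun t => \sum_(i <- S) f i t).
Proof.
move=> gf; elim: S => [|i S IHS].
  have := same_momentsZ 0 same_moments1.
  by congr same_moments; apply/funext => t; rewrite big_nil mul0r.
have := same_momentsD (gf i) IHS.
by congr same_moments; apply/funext => t; rewrite big_cons.
Qed.

Variable S : seq (R * R).
Local Notation E := [set t | (u t, v t) \in S].
Hypothesis nuS : nu (~` E) = 0%E.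

Let D t := \prod_(s <- S) sqdist (u t, v t) s.

Let D_eq0 t : D t = 0 <-> E t.
Proof.
split=> [/eqP|Et]; last first.
  by apply/eqP; rewrite prodf_seq_eq0; apply/hasP; exists (u t, v t) => //=; rewrite sqdist_eq0.
rewrite prodf_seq_eq0 => /hasP[s sS /=]; rewrite sqdist_eq0 => /eqP e.
by rewrite /= e.
Qed.

Let mE : measurable E.
Proof.
have [[mD _] _] := same_moments_prod S.
have -> : E = [set t | D t = 0] by apply/seteqP; split=> t /D_eq0.
by have := mD measurableT _ (measurable_set1 0); rewrite setTI.
Qed.

Lemma support_transfer : mu (~` E) = 0%E.
Proof.
have gD := same_moments_prod S; have [bD _] := gD.
have -> : E = [set t | D t = 0] by apply/seteqP; split=> t /D_eq0.
apply: expect_ge0_eq0 => // [t|].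
  by rewrite prodr_ge0// => s _; rewrite addr_ge0 ?sqr_ge0.
rewrite (same_momentsE gD).
rewrite (expect_ae mE nuS bD (bounded_mfun_cst 0)) => [|t /D_eq0 //].
by rewrite (Rintegral_cst nu measurableT) mul0r.
Qed.

Lemma expect_fibre h : bounded_mfun h ->
  (forall t t', u t = u t' -> v t = v t' -> h t = h t') ->
  \int[mu]_t h t = \int[nu]_t h t.
Proof.
move=> bh hfib.
pose phi (s : R * R) := h (get [set t | (u t, v t) = s]).
have phiE t : phi (u t, v t) = h t.
  have [eu ev] : (u (get [set t' | (u t', v t') = (u t, v t)]),
      v (get [set t' | (u t', v t') = (u t, v t)])) = (u t, v t).
    by apply: (@getPex _ [set t' | (u t', v t') = (u t, v t)]); exists t.
  exact: hfib.
pose U := undup S.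
pose q t := \sum_(s <- U) phi s / (\prod_(s' <- rem s U) sqdist s s')
  * \prod_(s' <- rem s U) sqdist (u t, v t) s'.
have gq : same_moments q.
  by apply: same_moments_sum => s; apply: same_momentsZ; exact: same_moments_prod.
have [bq _] := gq.
have qE t : E t -> h t = q t.
  move=> Et; have Ut : (u t, v t) \in U by rewrite mem_undup.
  rewrite /q (bigD1_seq (u t, v t)) ?undup_uniq//= [X in _ + X]big1 ?addr0 => [|s st]; last first.
    rewrite [X in _ * X](bigD1_seq (u t, v t)) ?rem_uniq ?undup_uniq//=; last first.
      by rewrite (mem_rem_uniq _ (undup_uniq S)) !inE eq_sym st.
    by rewrite (_ : sqdist _ _ = 0) ?mul0r ?mulr0//; apply/eqP; rewrite sqdist_eq0.
  rewrite divfK ?phiE//.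
  rewrite prodf_seq_neq0; apply/allP => s; rewrite (mem_rem_uniq _ (undup_uniq S)).
  by rewrite !inE => /andP[ns _] /=; rewrite sqdist_eq0 eq_sym.
rewrite (expect_ae mE support_transfer bh bq qE) (same_momentsE gq).
by rewrite (expect_ae mE nuS bh bq qE).
Qed.

End MomentsDetermineFibres.

Section CircleMeasurable.
Variable R : realType.
Local Notation RR := (measurableTypeR R).

Lemma measurable_circle_coord : measurable_fun setT (@circle_coord R).
Proof. by move=> _ B mB; exists B. Qed.

Lemma measurable_to_circle d (T : measurableType d) (F : T -> circle R) :
  measurable_fun setT (fun t => complex.Re (cval (F t)) : RR) ->
  measurable_fun setT (fun t => complex.Im (cval (F t)) : RR) ->
  measurable_fun setT F.
Proof.
move=> mRe mIm _ _ [B mB <-].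
have := (measurable_fun_pair mRe mIm) measurableT B mB.
by rewrite !setTI.
Qed.

End CircleMeasurable.

Section ComplexBounded.
Context {R : realType} {d : measure_display} {T : measurableType d}.
Implicit Types f g : T -> R[i].

Definition bounded_cfun f :=
  bounded_mfun (fun t => complex.Re (f t)) /\ bounded_mfun (fun t => complex.Im (f t)).

Lemma bounded_cfun_cst c : bounded_cfun (fun=> c).
Proof. by split; exact: bounded_mfun_cst. Qed.

Lemma bounded_cfunD f g : bounded_cfun f -> bounded_cfun g ->
  bounded_cfun (fun t => f t + g t).
Proof.
move=> [rf jf] [rg jg]; split.
  have := bounded_mfunD rf rg; congr bounded_mfun; apply/funext => t.
  by case: (f t) (g t) => ? ? [].
have := bounded_mfunD jf jg; congr bounded_mfun; apply/funext => t.
by case: (f t) (g t) => ? ? [].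
Qed.

Lemma bounded_cfunM f g : bounded_cfun f -> bounded_cfun g ->
  bounded_cfun (fun t => f t * g t).
Proof.
move=> [rf jf] [rg jg]; split.
  have := bounded_mfunD (bounded_mfunM rf rg) (bounded_mfunN (bounded_mfunM jf jg)).
  by congr bounded_mfun; apply/funext => t; case: (f t) (g t) => ? ? [].
have := bounded_mfunD (bounded_mfunM rf jg) (bounded_mfunM jf rg).
by congr bounded_mfun; apply/funext => t; case: (f t) (g t) => ? ? [].
Qed.

Lemma bounded_cfunN f : bounded_cfun f -> bounded_cfun (fun t => - f t).
Proof.
move=> [rf jf]; split.
  have := bounded_mfunN rf; congr bounded_mfun; apply/funext => t.
  by case: (f t).
have := bounded_mfunN jf; congr bounded_mfun; apply/funext => t.
by case: (f t).
Qed.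

Lemma bounded_cfunX f n : bounded_cfun f -> bounded_cfun (fun t => f t ^+ n).
Proof.
move=> bf; elim: n => [|n IHn]; first exact: (bounded_cfun_cst 1).
by have := bounded_cfunM bf IHn; congr bounded_cfun; apply/funext => t; rewrite exprS.
Qed.

End ComplexBounded.

Section TorusMeasurable.
Variable R : realType.
Implicit Types (w : torus R) (z : circle R).

Lemma circle_Re_Im z : `|complex.Re (cval z)| <= 1 /\ `|complex.Im (cval z)| <= 1.
Proof.
have e := add_Re2_Im2 (cval z); rewrite (eqP (cvalP z)) expr1n in e.
case: e => e.
have le1 (x y : R) : x ^+ 2 + y ^+ 2 = 1 -> `|x| <= 1.
  by move=> xy; rewrite -(@ler_pXn2r _ 2)// ?nnegrE// real_normK ?num_real//; nra.
by split; [exact: le1 e|apply: (le1 _ (complex.Re (cval z))); rewrite addrC].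
Qed.

Lemma bounded_cval (F : torus R -> circle R) : measurable_fun setT F ->
  bounded_cfun (fun w => cval (F w)).
Proof.
move=> mF; have mc : measurable_fun setT (@circle_coord R \o F).
  by apply: measurableT_comp mF => _; exact: measurable_circle_coord.
split; split.
- exact: (measurableT_comp measurable_fst mc).
- by exists 1 => w; case: (circle_Re_Im (F w)).
- exact: (measurableT_comp measurable_snd mc).
- by exists 1 => w; case: (circle_Re_Im (F w)).
Qed.

Lemma bounded_cval1 : bounded_cfun (fun w : torus R => cval w.1).
Proof. exact: bounded_cval measurable_fst. Qed.

Lemma bounded_cval2 : bounded_cfun (fun w : torus R => cval w.2).
Proof. exact: bounded_cval measurable_snd. Qed.

Lemma bounded_cfunV (F : torus R -> circle R) : bounded_cfun (fun w => cval (F w)) ->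
  bounded_cfun (fun w => (cval (F w))^-1).
Proof.
move=> [rf jf]; split.
  move: rf; congr bounded_mfun; apply/funext => w; rewrite cvalV.
  by case: (cval (F w)).
have := bounded_mfunN jf; congr bounded_mfun; apply/funext => w; rewrite cvalV.
by case: (cval (F w)).
Qed.

Lemma bounded_cfun_exprz (F : torus R -> circle R) (a : int) :
  bounded_cfun (fun w => cval (F w)) -> bounded_cfun (fun w => cval (F w) ^ a).
Proof.
move=> bF; case: a => n; first exact: (bounded_cfunX n bF).
have := bounded_cfunX n.+1 (bounded_cfunV bF).
by congr bounded_cfun; apply/funext => w; rewrite NegzE -exprnN exprVn.
Qed.

Lemma measurable_torus_act (g : 'M[int]_2) : measurable_fun setT (@torus_act R g).
Proof.
have mc (a b : int) : measurable_fun setT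
    (fun w : torus R => circle_mul (circle_exp w.1 a) (circle_exp w.2 b)).
  have [[mr _] [mi _]] := bounded_cfunM (bounded_cfun_exprz a bounded_cval1)
    (bounded_cfun_exprz b bounded_cval2).
  exact: measurable_to_circle.
exact: measurable_fun_pair.
Qed.

End TorusMeasurable.

Section WeylList.

Definition mx_of_quad (q : int * int * int * int) : 'M[int]_2 :=
  let: (a, b, c, d) := q in
  \matrix_(i, j) nth 0 (nth [::] [:: [:: a; b]; [:: c; d]] i) j.

Definition quad_mul (q r : int * int * int * int) : int * int * int * int :=
  let: (a, b, c, d) := q in let: (a', b', c', d') := r in
  (a * a' + b * c', a * b' + b * d', c * a' + d * c', c * b' + d * d').

Definition weyl_quads : seq (int * int * int * int) :=
  [:: (1, 0, 0, 1); (1, 0, 1, -1); (0, -1, -1, 0); (0, -1, 1, -1);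
      (-1, 1, -1, 0); (-1, 1, 0, 1);
      (-1, 0, 0, -1); (-1, 0, -1, 1); (0, 1, 1, 0); (0, 1, -1, 1);
      (1, -1, 1, 0); (1, -1, 0, -1)].

Lemma mx_of_quadM q r : mx_of_quad (quad_mul q r) = mx_of_quad q * mx_of_quad r.
Proof.
case: q => -[[a b] c] d; case: r => -[[a' b'] c'] d'.
apply/matrixP => i j; rewrite !mxE !big_ord_recl big_ord0 !mxE addr0.
by case: i => [[|[|]]] //= _; case: j => [[|[|]]].
Qed.

Lemma mx_of_quad_inj : injective mx_of_quad.
Proof.
move=> [[[a b] c] d] [[[a' b'] c'] d'] /matrixP e.
by have := (e 0 0, e 0 1, e 1 0, e 1 1); rewrite !mxE /= => -[[[-> ->] ->] ->].
Qed.

Lemma mx_of_quad1 : mx_of_quad (1, 0, 0, 1) = 1.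
Proof. by apply/matrixP => -[[|[|]]] //= ? -[[|[|]]] //= ?; rewrite !mxE. Qed.

Lemma weyl_quadsM q r : q \in weyl_quads -> r \in weyl_quads ->
  quad_mul q r \in weyl_quads.
Proof.
have : all (fun q => all (fun r => quad_mul q r \in weyl_quads) weyl_quads) weyl_quads.
  by vm_compute.
by move=> /allP h /h /allP; apply.
Qed.

Lemma weyl_quads_perm r : r \in weyl_quads ->
  perm_eq [seq quad_mul q r | q <- weyl_quads] weyl_quads.
Proof.
have : all (fun r => perm_eq [seq quad_mul q r | q <- weyl_quads] weyl_quads) weyl_quads.
  by vm_compute.
by move=> /allP; apply.
Qed.

Lemma weyl_quads_perml r : r \in weyl_quads ->
  perm_eq [seq quad_mul r q | q <- weyl_quads] weyl_quads.
Proof.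
have : all (fun r => perm_eq [seq quad_mul r q | q <- weyl_quads] weyl_quads) weyl_quads.
  by vm_compute.
by move=> /allP; apply.
Qed.

Lemma weyl_quads_weyl q : q \in weyl_quads -> weyl (mx_of_quad q).
Proof.
have w2 : weyl (mx_of_quad (0, -1, -1, 0)) by exact: weyl_T2.
have w6 : weyl (mx_of_quad (0, 1, -1, 1)) by exact: weyl_T6.
have w1 : weyl (mx_of_quad (1, 0, 0, 1)) by rewrite mx_of_quad1; exact: weyl1.
have wM s r : weyl (mx_of_quad s) -> weyl (mx_of_quad r) -> weyl (mx_of_quad (quad_mul s r)).
  by rewrite mx_of_quadM; exact: weylM.
pose w n := iter n (quad_mul (0, 1, -1, 1)) (1, 0, 0, 1).
have ww n : weyl (mx_of_quad (w n)) by elim: n => [//|n IHn]; exact: wM.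
have : all (fun q => has (fun n => (q == w n) || (q == quad_mul (w n) (0, -1, -1, 0)))
    (iota 0 6)) weyl_quads by vm_compute.
move=> /allP/[apply] /hasP[n _ /orP[]/eqP ->] //.
exact: wM.
Qed.

Lemma weyl_mem_quads g : weyl g -> exists2 q, q \in weyl_quads & g = mx_of_quad q.
Proof.
elim=> [|||h h' _ IHh _ IHh'|h _ [r wr ->]].
- by exists (0, -1, -1, 0).
- by exists (0, 1, -1, 1).
- by exists (1, 0, 0, 1) => //; rewrite mx_of_quad1.
- have [q wq ->] := IHh; have [r wr ->] := IHh'.
  by exists (quad_mul q r); [exact: weyl_quadsM|rewrite mx_of_quadM].
have : all (fun q => has (fun r => quad_mul q r == (1, 0, 0, 1)) weyl_quads) weyl_quads.
  by vm_compute.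
move=> /allP/(_ r wr)/hasP[s ws /eqP rs1]; exists s => //.
have e : mx_of_quad r * mx_of_quad s = 1 by rewrite -mx_of_quadM rs1 mx_of_quad1.
have [uq _] := mulmx1_unit e.
by rewrite -[LHS]mulr1 -e mulKr.
Qed.

Lemma D12E : D12 = [set` [seq mx_of_quad q | q <- weyl_quads]].
Proof.
apply/seteqP; split=> [g /weyl_mem_quads[q wq ->]|g].
  exact: (map_f mx_of_quad wq).
move=> gs; have {gs} : g \in [seq mx_of_quad q | q <- weyl_quads] by exact: gs.
by case/seq.mapP => q wq ->; exact: weyl_quads_weyl.
Qed.

End WeylList.

Section Orbits.
Variable R : realType.
Implicit Types (w : torus R) (q : int * int * int * int).

Definition quad_act q w : torus R := torus_act (mx_of_quad q) w.

Lemma torus_ext w w' : cval w.1 = cval w'.1 -> cval w.2 = cval w'.2 -> w = w'.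
Proof.
by case: w w' => [w1 w2] [w1' w2'] /= /circle_inj -> /circle_inj ->.
Qed.

Lemma cval_quad_act1 a b c d w :
  cval (quad_act (a, b, c, d) w).1 = cval w.1 ^ a * cval w.2 ^ b.
Proof. by rewrite /= !mxE. Qed.

Lemma cval_quad_act2 a b c d w :
  cval (quad_act (a, b, c, d) w).2 = cval w.1 ^ c * cval w.2 ^ d.
Proof. by rewrite /= !mxE. Qed.

Definition cval_quad_act := (cval_quad_act1, cval_quad_act2).

Lemma quad_actM q r w : quad_act q (quad_act r w) = quad_act (quad_mul q r) w.
Proof.
case: q => -[[a b] c] d; case: r => -[[a' b'] c'] d'.
have actM (z w' : R[i]) (m n i j i' j' : int) : z != 0 -> w' != 0 ->
    (z ^ i * w' ^ j) ^ m * (z ^ i' * w' ^ j') ^ n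
    = z ^ (m * i + n * i') * w' ^ (m * j + n * j').
  move=> z0 w0; rewrite !expfzMl !exprz_exp !expfzDr// ![_ * m]mulrC ![_ * n]mulrC.
  by rewrite mulrACA.
by apply: torus_ext; rewrite !cval_quad_act actM ?cval_neq0.
Qed.

End Orbits.

Section Characters.
Variable R : realType.
Implicit Types (w : torus R) (q : int * int * int * int).

Lemma chi_rho2E w : chi_rho2 w =
  ((chi_rho1 w) ^+ 2 - chi_rho1 (circle_exp w.1 2, circle_exp w.2 2)) / 2%:R - chi_rho1 w.
Proof.
rewrite /chi_rho2 /chi_rho1 /= -!exprnP; have := cval_neq0 w.1; have := cval_neq0 w.2.
move: (cval w.1) (cval w.2) => x y y0 x0; field.
by rewrite y0 x0.
Qed.

Lemma chi_rho1_act q w : q \in weyl_quads -> chi_rho1 (quad_act q w) = chi_rho1 w.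
Proof.
move=> wq; have e a b c d : chi_rho1 (quad_act (a, b, c, d) w) =
   let x := cval w.1 ^ a * cval w.2 ^ b in let y := cval w.1 ^ c * cval w.2 ^ d in
   1 + x + x^-1 + y + y^-1 + x * y^-1 + x^-1 * y.
  by rewrite /chi_rho1 !cval_quad_act.
have := cval_neq0 w.1; have := cval_neq0 w.2.
case: q wq => -[[a b] c] d wq; rewrite e /chi_rho1 /=; rewrite !inE in wq.
move: (cval w.1) (cval w.2) => x y y0 x0.
do ![case/orP: wq => [/eqP[-> -> -> ->]|wq]]; last move: wq => /eqP[-> -> -> ->].
all: rewrite ?expr0z ?expr1z ?exprN1 ?mul1r ?mulr1; field; by rewrite ?x0 ?y0.
Qed.

Lemma quad_act_circle_exp q w (a : int) :
  quad_act q (circle_exp w.1 a, circle_exp w.2 a) =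
  (circle_exp (quad_act q w).1 a, circle_exp (quad_act q w).2 a).
Proof.
have eM (x y : R[i]) (m n : int) : (x ^ a) ^ m * (y ^ a) ^ n = (x ^ m * y ^ n) ^ a.
  by rewrite expfzMl !exprz_exp ![a * _]mulrC.
case: q => -[[a' b] c] d; apply: torus_ext.
  by rewrite -[RHS]/(cval (quad_act (a', b, c, d) w).1 ^ a) !cval_quad_act1 -eM.
by rewrite -[RHS]/(cval (quad_act (a', b, c, d) w).2 ^ a) !cval_quad_act2 -eM.
Qed.

Lemma chi_rho2_act q w : q \in weyl_quads -> chi_rho2 (quad_act q w) = chi_rho2 w.
Proof.
by move=> wq; rewrite !chi_rho2E -quad_act_circle_exp !chi_rho1_act.
Qed.

(* The three weights of the representation 3 of SU(3). *)
Definition p3 w : R[i] := cval w.1 + (cval w.2)^-1 + (cval w.1)^-1 * cval w.2.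

Lemma p3_conj w : conjc (p3 w) = (cval w.1)^-1 + cval w.2 + cval w.1 * (cval w.2)^-1.
Proof.
by rewrite /p3 !rmorphD rmorphM !fmorphV /= -!cvalV !invrK.
Qed.

Lemma chi_rho1_p3 w : chi_rho1 w = 1 + p3 w + conjc (p3 w).
Proof. by rewrite p3_conj /chi_rho1 /p3; ring. Qed.

Lemma chi_rho2_p3 w : chi_rho2 w = chi_rho1 w + p3 w * conjc (p3 w) - 2.
Proof.
rewrite p3_conj /chi_rho2 /p3; have := cval_neq0 w.1; have := cval_neq0 w.2.
move: (cval w.1) (cval w.2) (chi_rho1 w) => x y c y0 x0; field.
by rewrite x0 y0.
Qed.

Definition chi1_re w : R := complex.Re (chi_rho1 w).
Definition chi2_re w : R := complex.Re (chi_rho2 w).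

Lemma chi1_reE w : chi_rho1 w = (chi1_re w)%:C.
Proof. 
rewrite /chi1_re chi_rho1_p3; case: (p3 w) => a b; simpc.
by congr (_ +i* _); rewrite ?addr0 ?add0r ?subrr.
Qed.

Lemma chi2_reE w : chi_rho2 w = (chi2_re w)%:C.
Proof.
rewrite /chi2_re chi_rho2_p3 chi1_reE; case: (p3 w) => a b; simpc.
by apply/eqP; rewrite eq_complex /=; apply/andP; split; apply/eqP; ring.
Qed.

Lemma bounded_chi_rho1 : bounded_cfun (@chi_rho1 R).
Proof.
have b1 := bounded_cval1 R; have b2 := bounded_cval2 R.
have bc := bounded_cfun_cst (T := torus R) (1 : R[i]).
have V1 := bounded_cfunV b1; have V2 := bounded_cfunV b2.
exact: bounded_cfunD (bounded_cfunD (bounded_cfunD (bounded_cfunD (bounded_cfunD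
  (bounded_cfunD bc b1) V1) b2) V2) (bounded_cfunM b1 V2)) (bounded_cfunM V1 b2).
Qed.

Lemma bounded_chi1_re : bounded_mfun chi1_re.
Proof. by case: bounded_chi_rho1. Qed.

Lemma bounded_chi2_re : bounded_mfun chi2_re.
Proof.
have b2 := bounded_cval2 R; have b1 := bounded_cval1 R.
have bp : bounded_cfun p3.
  by apply: bounded_cfunD (bounded_cfunD b1 (bounded_cfunV b2)) (bounded_cfunM (bounded_cfunV b1) b2).
have := bounded_cfunD (bounded_cfunD bounded_chi_rho1
  (bounded_cfunM bp (bounded_cfunD (bounded_cfunD (bounded_cfunV b1) b2)
   (bounded_cfunM b1 (bounded_cfunV b2))))) (bounded_cfun_cst (- 2 : R[i])).
case=> + _; congr bounded_mfun; apply/funext => w.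
by rewrite /chi2_re chi_rho2_p3 p3_conj.
Qed.

(* Two unordered triples with product 1 and equal elementary symmetric functions. *)
Lemma same_triple (F : fieldType) (x y x' y' : F) :
  x != 0 -> y != 0 -> x' != 0 -> y' != 0 ->
  x + y^-1 + x^-1 * y = x' + y'^-1 + x'^-1 * y' ->
  x^-1 + y + x * y^-1 = x'^-1 + y' + x' * y'^-1 ->
  exists2 q, q \in take 6 weyl_quads &
    let: (a, b, c, d) := q in x' = x ^ a * y ^ b /\ y' = x ^ c * y ^ d.
Proof.
move=> x0 y0 x'0 y'0 e1 e2.
have [] : [\/ x' = x, x' = y^-1 | x' = x^-1 * y].
  have : (x' - x) * (x' - y^-1) * (x' - x^-1 * y) = 0.
    have -> : (x' - x) * (x' - y^-1) * (x' - x^-1 * y) =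
        x' ^+ 3 - (x + y^-1 + x^-1 * y) * x' ^+ 2 + (x^-1 + y + x * y^-1) * x' - 1.
      by field; rewrite x0 y0.
    by rewrite e1 e2; field; rewrite x'0 y'0.
  move=> /eqP; rewrite !mulf_eq0 !subr_eq0 => /orP[/orP[]|] /eqP ->;
    by [constructor 1|constructor 2|constructor 3].
- move=> ex; rewrite {x'}ex in e1 e2 x'0 *.
  have : (y' - y) * (y' - x * y^-1) = y' * (y' + x * y'^-1 - (y + x * y^-1)) by field; rewrite y0 y'0.
  have -> : y' + x * y'^-1 - (y + x * y^-1) = 
     (x^-1 + y' + x * y'^-1) - (x^-1 + y + x * y^-1) by ring.
  rewrite e2 subrr mulr0 => /eqP; rewrite mulf_eq0 !subr_eq0 => /orP[]/eqP ->.
    by exists (1, 0, 0, 1) => //; rewrite !expr0z !expr1z mulr1 mul1r.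
  by exists (1, 0, 1, -1) => //; rewrite !expr0z !expr1z exprN1 mulr1.
- move=> ex; rewrite {x'}ex in e1 e2 x'0 *.
  have : (y' - x^-1) * (y' - x * y^-1) = 
     y' * ((y^-1^-1 + y' + y^-1 * y'^-1) - (x^-1 + y + x * y^-1)).
    by rewrite invrK; field; rewrite y0 x0 y'0.
  rewrite e2 subrr mulr0 => /eqP; rewrite mulf_eq0 !subr_eq0 => /orP[]/eqP ->.
    by exists (0, -1, -1, 0) => //; rewrite !expr0z !exprN1 mulr1 mul1r.
  by exists (0, -1, 1, -1) => //; rewrite !expr0z !expr1z exprN1 mul1r.
move=> ex; rewrite {x'}ex in e1 e2 x'0 *.
have : (y' - x^-1) * (y' - y) = 
   y' * (((x^-1 * y)^-1 + y' + x^-1 * y * y'^-1) - (x^-1 + y + x * y^-1)).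
  by field; rewrite y0 y'0 x0.
rewrite e2 subrr mulr0 => /eqP; rewrite mulf_eq0 !subr_eq0 => /orP[]/eqP ->.
  by exists (-1, 1, -1, 0) => //; rewrite !expr0z !expr1z !exprN1 mulr1.
by exists (-1, 1, 0, 1) => //; rewrite !expr0z !expr1z exprN1 mul1r.
Qed.

Lemma orbit_separation w w' :
  chi1_re w = chi1_re w' -> chi2_re w = chi2_re w' ->
  exists2 q, q \in weyl_quads & w' = quad_act q w.
Proof.
move=> e1 e2.
have c1 : chi_rho1 w = chi_rho1 w' by rewrite !chi1_reE e1.
have c2 : chi_rho2 w = chi_rho2 w' by rewrite !chi2_reE e2.
have same_p3 v : p3 w = p3 v -> exists2 q, q \in take 6 weyl_quads & v = quad_act q w.
  move=> ep; have ec : conjc (p3 w) = conjc (p3 v) by rewrite ep.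
  move: ep ec; rewrite !p3_conj => ep ec.
  have [[[[a b] c] d] qs [ex ey]] := same_triple (cval_neq0 _) (cval_neq0 _)
    (cval_neq0 _) (cval_neq0 _) ep ec.
  by exists (a, b, c, d) => //; apply: torus_ext; rewrite !cval_quad_act.
have [] : p3 w' = p3 w \/ p3 w' = conjc (p3 w).
  have : p3 w' ^+ 2 - p3 w' * (p3 w + conjc (p3 w)) + p3 w * conjc (p3 w) = 0.
    have -> : p3 w + conjc (p3 w) = p3 w' + conjc (p3 w').
      have := c1; rewrite !chi_rho1_p3 -!addrA => h. by have := @addrI _ _ _ _ h.
    have -> : p3 w * conjc (p3 w) = p3 w' * conjc (p3 w').
      by have := c2; rewrite !chi_rho2_p3 c1 => /addIr/addrI.
    by ring.
  have -> : p3 w' ^+ 2 - p3 w' * (p3 w + conjc (p3 w)) + p3 w * conjc (p3 w)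
    = (p3 w' - p3 w) * (p3 w' - conjc (p3 w)) by ring.
  by move=> /eqP; rewrite mulf_eq0 !subr_eq0 => /orP[]/eqP; [left|right].
- move=> /esym/same_p3[q qs ->]; exists q => //.
  by rewrite -(cat_take_drop 6 weyl_quads) mem_cat qs.
move=> ep; have wN : (-1, 0, 0, -1) \in weyl_quads by [].
have [] := same_p3 (quad_act (-1, 0, 0, -1) w').
  rewrite -[p3 w]conjcK -ep p3_conj /p3 !cval_quad_act !expr0z !exprN1 mulr1 mul1r.
  by rewrite !invrK.
move=> q /mem_take qs ew; exists (quad_mul (-1, 0, 0, -1) q); first exact: weyl_quadsM.
rewrite -quad_actM -ew quad_actM.
by apply: torus_ext; rewrite !cval_quad_act expr0z ?expr1z ?mulr1 ?mul1r.
Qed.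

End Characters.

Section Uniform.
Context {d : measure_display} {T : measurableType d} {R : realType}.
Implicit Types (s : seq T) (f : T -> R).

Definition mean s f : R := (size s)%:R^-1 * \sum_(t <- s) f t.

Lemma integral_unif_ge0 s f : measurable_fun setT f -> (forall t, 0 <= f t) ->
  (\int[unif s]_t (f t)%:E = (mean s f)%:E)%E.
Proof.
move=> mf f0; have mf' : measurable_fun setT (EFin \o f) by exact/measurable_EFinP.
have f0' t : setT t -> (0 <= (f t)%:E)%E by rewrite lee_fin.
rewrite /unif ge0_integral_mscale// ge0_integral_measure_sum//.
rewrite (eq_bigr (fun i : 'I_(size s) => (f (nth point s i))%:E)) => [|i _]; last first.
  by rewrite integral_dirac// diracT mul1e.
by rewrite sumEFin -EFinM /mean (big_nth point) big_mkord.
Qed.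

Lemma unif_setE s A : unif s A = (mean s (\1_A))%:E :> \bar R.
Proof.
rewrite /unif /mscale /msum /mean (big_nth point) big_mkord EFinM -sumEFin.
by congr (_ * _)%E; apply: eq_bigr => i _; rewrite diracE indicE.
Qed.

Lemma integral_unif s f : measurable_fun setT f ->
  \int[unif s]_t f t = mean s f.
Proof.
move=> mf; have mf' : measurable_fun setT (EFin \o f) by exact/measurable_EFinP.
rewrite /Rintegral integralE.
have mp : measurable_fun setT (f^\+) by exact: measurable_funrpos.
have mn : measurable_fun setT (f^\-) by exact: measurable_funrneg.
rewrite (eq_integral (EFin \o f^\+)) => [|t _]; last by rewrite -funerpos.
rewrite [X in (_ - X)%E](eq_integral (EFin \o f^\-)) => [|t _]; last by rewrite -funerneg.
rewrite !integral_unif_ge0//=.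
rewrite /mean -mulrBr -sumrB; congr (_ * _); apply: eq_bigr => t _.
by rewrite -[in RHS](funrposBneg f).
Qed.

Definition unif_probability s of (0 < size s)%N : set T -> \bar R := unif s.

Section Probability.
Variables (s : seq T) (s_gt0 : (0 < size s)%N).

HB.instance Definition _ := Measure.on (unif_probability s_gt0).

Let unif_setT : unif_probability s_gt0 setT = 1%E.
Proof.
rewrite [LHS]unif_setE /mean (eq_bigr (fun=> 1)) => [|t _]; last by rewrite indicE in_setT.
by rewrite -(natr_sum _ _ _ (fun=> 1%N)) sum1_size mulVf ?pnatr_eq0 -?lt0n.
Qed.

HB.instance Definition _ :=
  Measure_isProbability.Build _ _ _ (unif_probability s_gt0) unif_setT.

End Probability.

End Uniform.

Section Product.
Context {d1 d2 : measure_display} {T1 : measurableType d1} {T2 : measurableType d2}.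
Context {R : realType}.

Lemma integral_unif_prod (s1 : seq T1) (s2 : seq T2) (f : T1 * T2 -> R) :
  measurable_fun setT f -> (forall t, 0 <= f t) ->
  (\int[unif s1 \x unif s2]_w (f w)%:E = (mean s1 (fun x => mean s2 (fun y => f (x, y))))%:E)%E.
Proof.
move=> mf f0; have mf' : measurable_fun setT (EFin \o f) by exact/measurable_EFinP.
rewrite (fubini_tonelli1 (EFin \o f))//.
have mfx x : measurable_fun setT (fun y => f (x, y)).
  by apply: measurableT_comp => //; exact: measurable_pair1.
rewrite (eq_integral (EFin \o (fun x => mean s2 (fun y => f (x, y))))) => [|x _]; last first.
  by rewrite /fubini_F integral_unif_ge0.
rewrite integral_unif_ge0// => [|x]; last first.
  by rewrite /mean mulr_ge0 ?invr_ge0 ?ler0n ?sumr_ge0.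
apply: measurable_funM; first exact: measurable_cst.
apply: measurable_sum => y; apply: measurableT_comp => //.
Qed.

End Product.

Section Orbits.
Variable R : realType.
Implicit Types (w t : torus R) (A : set (torus R)).

Definition orbit_sum (V : nmodType) (f : torus R -> V) w : V :=
  \sum_(q <- weyl_quads) f (quad_act q w).

Lemma orbit_sum_act (V : nmodType) (f : torus R -> V) r w : r \in weyl_quads ->
  orbit_sum f (quad_act r w) = orbit_sum f w.
Proof.
move=> wr; rewrite /orbit_sum.
under eq_bigr do rewrite quad_actM.
by rewrite -[RHS](perm_big _ (weyl_quads_perm wr)) [RHS]big_map.
Qed.

Lemma orbit_sum_cst (V : nmodType) (f : torus R -> V) w :
  (forall q, q \in weyl_quads -> f (quad_act q w) = f w) -> orbit_sum f w = f w *+ 12.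
Proof.
move=> fq; rewrite /orbit_sum big_seq (eq_bigr (fun=> f w)) -?big_seq.
  by rewrite big_const_seq iter_addr_0.
exact: fq.
Qed.

(* The points of the orbits of the second components, repeated according to the
   first components. *)
Definition orbit_list (l : seq (nat * torus R)) : seq (torus R) :=
  flatten [seq flatten (nseq kt.1 [seq quad_act q kt.2 | q <- weyl_quads]) | kt <- l].

Lemma sum_orbit_list (V : nmodType) (f : torus R -> V) l :
  \sum_(t <- orbit_list l) f t = \sum_(kt <- l) orbit_sum f kt.2 *+ kt.1.
Proof.
rewrite /orbit_list big_flatten big_map; apply: eq_bigr => kt _.
by rewrite big_flatten big_nseq iter_addr_0 big_map.
Qed.

Lemma size_orbit_list l : size (orbit_list l) = (12 * \sum_(kt <- l) kt.1)%N.
Proof.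
rewrite -sum1_size (sum_orbit_list (fun=> 1%N)) big_distrr; apply: eq_bigr => kt _.
by rewrite orbit_sum_cst // -mulrnA natn.
Qed.

Lemma D12_act_invariant (mu : probability (torus R) R) q A :
  D12_invariant mu -> q \in weyl_quads -> measurable A ->
  mu (quad_act q @^-1` A) = mu A.
Proof. by move=> inv wq mA; apply: inv => //; exact: weyl_quads_weyl. Qed.

Lemma measurable_quad_act q : measurable_fun setT (@quad_act R q).
Proof. exact: measurable_torus_act. Qed.

Lemma bounded_orbit_indic A : measurable A -> bounded_mfun (orbit_sum (\1_A : _ -> R)).
Proof.
move=> mA; apply: bounded_mfun_sum => q.
have := bounded_mfun_indic (R := R) (measurable_quad_act q measurableT mA).
by congr bounded_mfun; rewrite setTI.
Qed.

Lemma expect_orbit_indic (mu : probability (torus R) R) A :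
  D12_invariant mu -> measurable A ->
  \int[mu]_t (orbit_sum (\1_A : _ -> R) t) = 12 * fine (mu A).
Proof.
move=> inv mA; rewrite /orbit_sum.
have sumE (s : seq (int * int * int * int)) : (forall q, q \in s -> q \in weyl_quads) ->
    \int[mu]_t (\sum_(q <- s) \1_A (quad_act q t)) = (size s)%:R * fine (mu A).
  have bA q : bounded_mfun (\1_(quad_act q @^-1` A) : torus R -> R).
    apply: bounded_mfun_indic.
    by have := measurable_quad_act q measurableT mA; rewrite setTI.
  elim: s => [|q s IHs] ws.
    under eq_fun do rewrite big_nil.
    by rewrite (Rintegral_cst mu measurableT) !mul0r.
  under eq_fun do rewrite big_cons.
  have := expectD mu (bA q) (bounded_mfun_sum s bA).
  rewrite -[X in X = _]/(\int[mu]_t (\1_A (quad_act q t) + \sum_(q <- s) \1_A (quad_act q t))).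
  move=> ->; rewrite IHs => [|r rs]; last by apply: ws; rewrite inE rs orbT.
  rewrite expect_indic; last first.
    by have := measurable_quad_act q measurableT mA; rewrite setTI.
  rewrite D12_act_invariant ?ws ?mem_head//.
  by rewrite -[size (_ :: _)]/(size s).+1 -natr1 mulrDl mul1r addrC.
by rewrite sumE.
Qed.

Lemma joint_momentE (mu : probability (torus R) R) m n :
  joint_moment mu m n = (\int[mu]_t (chi1_re t ^+ m * chi2_re t ^+ n))%:C.
Proof.
have e w : chi_rho1 w ^+ m * chi_rho2 w ^+ n = (chi1_re w ^+ m * chi2_re w ^+ n)%:C.
  by rewrite chi1_reE chi2_reE rmorphM !rmorphXn.
rewrite /joint_moment /complex_integral.
under [X in X +i* _]eq_Rintegral do rewrite e.
under [X in _ +i* X]eq_Rintegral do rewrite e.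
by rewrite (Rintegral_cst mu measurableT) mul0r.
Qed.

Lemma joint_moment_unif (s : seq (torus R)) (s0 : (0 < size s)%N) m n :
  joint_moment (unif_probability s0) m n
  = (size s)%:R^-1 * \sum_(t <- s) (chi_rho1 t ^+ m * chi_rho2 t ^+ n).
Proof.
rewrite joint_momentE.
have b : bounded_mfun (fun t : torus R => chi1_re t ^+ m * chi2_re t ^+ n).
  by apply: bounded_mfunM; apply: bounded_mfunX; [exact: bounded_chi1_re|exact: bounded_chi2_re].
rewrite [X in X%:C](integral_unif s b.1) /mean rmorphM fmorphV rmorph_nat rmorph_sum.
congr (_ * _); apply: eq_bigr => t _.
by rewrite chi1_reE chi2_reE rmorphM !rmorphXn.
Qed.

Lemma D12_invariant_orbit_list l (s0 : (0 < size (orbit_list l))%N) :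
  D12_invariant (unif_probability s0).
Proof.
move=> g A /weyl_mem_quads[q wq ->] mA; rewrite [LHS]unif_setE [RHS]unif_setE.
congr (_%:E); rewrite /mean !sum_orbit_list; congr (_ * _); apply: eq_bigr => kt _.
congr (_ *+ _); rewrite -[RHS](perm_big _ (weyl_quads_perml wq)) [RHS]big_map.
by apply: eq_bigr => r _; rewrite -quad_actM !indicE.
Qed.

Lemma invariant_measure_unique (mu : probability (torus R) R) l (s0 : (0 < size (orbit_list l))%N) :
  let nu := unif_probability s0 in
  D12_invariant mu -> D12_invariant nu ->
  (forall m n, joint_moment mu m n = joint_moment nu m n) ->
  forall A, measurable A -> mu A = nu A.
Proof.
move=> nu imu inu moments A mA.
have mom m n : \int[mu]_t (chi1_re t ^+ m * chi2_re t ^+ n)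
    = \int[nu]_t (chi1_re t ^+ m * chi2_re t ^+ n).
  by have := moments m n; rewrite !joint_momentE => -[].
pose S := [seq (chi1_re t, chi2_re t) | t <- orbit_list l].
have nuS : nu (~` [set t | (chi1_re t, chi2_re t) \in S]) = 0%E.
  rewrite [LHS]unif_setE /mean big_seq big1 ?mulr0// => t tl.
  rewrite indicE memNset//= => /(_ _) h; apply: h.
  exact: (map_f (fun t => (chi1_re t, chi2_re t))).
have hfib t t' : chi1_re t = chi1_re t' -> chi2_re t = chi2_re t' ->
    orbit_sum (\1_A : _ -> R) t = orbit_sum (\1_A : _ -> R) t'.
  by move=> e1 e2; have [q wq ->] := orbit_separation e1 e2; rewrite orbit_sum_act.
have := expect_fibre (bounded_chi1_re R) (bounded_chi2_re R) mom nuS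
  (bounded_orbit_indic mA) hfib.
rewrite !expect_orbit_indic// => /(mulfI _) e.
rewrite -[LHS]fineK ?fin_num_measure// -[RHS]fineK ?fin_num_measure//.
by rewrite e// pnatr_eq0.
Qed.

End Orbits.

Section Grid.
Variable R : realType.

Definition grid_point (n : nat) (p : nat * nat) : torus R :=
  (cis (p.1%:R / n%:R), cis (p.2%:R / n%:R)).

Definition grid (n : nat) : seq (nat * nat) :=
  [seq (i, j) | i <- iota 0 n, j <- iota 0 n].

Definition unit_root n : R[i] := cval (cis (n%:R^-1 : R)).

Lemma cis_frac n i : cval (cis (i%:R / n%:R : R)) = unit_root n ^+ i.
Proof. exact: cisMn. Qed.

Lemma unit_root_expn n : (0 < n)%N -> unit_root n ^+ n = 1.
Proof. by move=> n0; exact: prim_expr_order (cis_prim R n0). Qed.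

Lemma unit_root_neq0 n : unit_root n != 0.
Proof. exact: cval_neq0. Qed.

Lemma exprz_mod (F : fieldType) (e : F) n (z : int) : (0 < n)%N -> e ^+ n = 1 ->
  e ^ z = e ^+ `|(z %% n)%Z|%N.
Proof.
move=> n0 en; have e0 : e != 0.
  by apply: contraTneq n0 => e0; move: en; rewrite e0; case: n => // n; rewrite expr0n => /eqP; rewrite eq_sym oner_eq0.
have zn : (n%:Z != 0) by rewrite eqz_nat -lt0n.
have e1 : e ^ ((z %/ n)%Z * n) = 1.
  by rewrite mulrC -exprz_exp -[e ^ n]/(e ^+ n) en exp1rz.
by rewrite {1}(divz_eq z n) expfzDr// e1 mul1r exprnP gez0_abs// modz_ge0.
Qed.

Definition grid_act (n : nat) (p : nat * nat) (q : int * int * int * int) : nat * nat :=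
  let: (a, b, c, d) := q in
  (`|(a * p.1%:Z + b * p.2%:Z) %% n|%Z%N, `|(c * p.1%:Z + d * p.2%:Z) %% n|%Z%N).

Lemma quad_act_grid n p q : (0 < n)%N ->
  quad_act q (grid_point n p) = grid_point n (grid_act n p q).
Proof.
move=> n0; case: q => -[[a b] c] d.
have e (a' b' : int) : (unit_root n ^+ p.1) ^ a' * (unit_root n ^+ p.2) ^ b'
    = unit_root n ^+ `|(a' * p.1%:Z + b' * p.2%:Z) %% n|%Z%N.
  rewrite -exprz_mod ?unit_root_expn// expfzDr ?unit_root_neq0//.
  by rewrite !exprnP !exprz_exp [a' * _]mulrC [b' * _]mulrC.
by apply: torus_ext; rewrite !cval_quad_act !cis_frac e.
Qed.

Lemma orbit_sum_grid (V : nmodType) (f : torus R -> V) n p : (0 < n)%N ->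
  orbit_sum f (grid_point n p)
  = \sum_(p' <- [seq grid_act n p q | q <- weyl_quads]) f (grid_point n p').
Proof.
by move=> n0; rewrite big_map; apply: eq_bigr => q _; rewrite quad_act_grid.
Qed.

Lemma grid_point_scale k n i j : (0 < k)%N ->
  grid_point (k * n) (k * i, k * j)%N = grid_point n (i, j).
Proof.
move=> k0; have kn0 : k%:R != 0 :> R by rewrite pnatr_eq0 -lt0n.
have e (a : nat) : (k * a)%:R / (k * n)%:R = a%:R / n%:R :> R.
  by rewrite !natrM invfM mulrACA mulfV ?mul1r.
by rewrite /grid_point /= !e.
Qed.

Definition orbit6 : seq (nat * nat) := undup [seq grid_act 6 (3, 1) q | q <- weyl_quads]%N.
Definition orbit7 : seq (nat * nat) := undup [seq grid_act 7 (1, 3) q | q <- weyl_quads]%N.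

End Grid.

Section CharacterValues.
Variable R : realType.

Lemma chi_rho1_root (e : R[i]) (w : torus R) n i j :
  e ^+ n = 1 -> (i <= n)%N -> (j <= n)%N -> cval w.1 = e ^+ i -> cval w.2 = e ^+ j ->
  chi_rho1 w = 1 + e ^+ i + e ^+ (n - i) + e ^+ j + e ^+ (n - j)
    + e ^+ (i + (n - j)) + e ^+ ((n - i) + j).
Proof.
move=> en ni nj w1 w2.
have inv k : (k <= n)%N -> (e ^+ k)^-1 = e ^+ (n - k).
  move=> kn; have ee : e ^+ (n - k) * e ^+ k = 1 by rewrite -exprD subnK.
  have ek0 : e ^+ k != 0 by apply: contra_eq_neq ee => ->; rewrite mulr0 eq_sym oner_eq0.
  by apply: (mulIf ek0); rewrite mulVf.
by rewrite /chi_rho1 w1 w2 !inv// !exprD.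
Qed.

End CharacterValues.

Section JGrid.
Variable R : realType.

Definition root_cos (n k : nat) : R := complex.Re (unit_root R n ^+ k).

Lemma root_cosE n k : root_cos n k = cos (2 * pi * (k%:R / n%:R)).
Proof. by rewrite /root_cos -cis_frac. Qed.

Definition fold (n k : nat) : nat := minn (k %% n) (n - k %% n).

Lemma root_cos_fold n k : (0 < n)%N -> root_cos n k = root_cos n (fold n k).
Proof.
move=> n0; have -> : root_cos n k = root_cos n (k %% n).
  by rewrite /root_cos expr_mod ?unit_root_expn.
rewrite /fold; have kn : (k %% n <= n)%N by rewrite ltnW ?ltn_mod.
case: leqP => // _; rewrite !root_cosE natrB// mulrBl mulfV ?pnatr_eq0 -?lt0n//.
by rewrite mulrBr mulr1 mulr_natl addrC cosD2pi cosN.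
Qed.

Definition J_exponents (n : nat) (p : nat * nat) : seq (int * nat) :=
  [:: (1, (2 * p.1 + p.2)%N); (1, (p.1 + (n - 3) * p.2)%N);
      (1, (3 * p.1 + (n - 2) * p.2)%N); (-1, (p.1 + 2 * p.2)%N);
      (-1, (3 * p.1 + (n - 1) * p.2)%N); (-1, (2 * p.1 + (n - 3) * p.2)%N)].

Definition J_coef (n : nat) (p : nat * nat) (k : nat) : int :=
  foldr +%R 0 [seq (if fold n x.2 == k then x.1 else 0) | x <- J_exponents n p].

Lemma J_grid n p : (3 <= n)%N -> (n <= 7)%N -> J (grid_point R n p) =
  8 * pi ^+ 2 * \sum_(k < 4) (J_coef n p k)%:~R * root_cos n k.
Proof.
move=> n3 n7; have n0 : (0 < n)%N by apply: leq_trans n3.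
have inv i k : (k <= n)%N -> (unit_root R n ^+ i) ^- k = unit_root R n ^+ ((n - k) * i).
  move=> kn; have e0 := unit_root_neq0 R n.
  apply: (mulIf (expf_neq0 k (expf_neq0 i e0))).
  rewrite mulVf ?expf_neq0// -!exprM -exprD [(i * k)%N]mulnC -mulnDl subnK//.
  by rewrite exprM unit_root_expn// expr1n.
have inv1 i : (unit_root R n ^+ i)^-1 = unit_root R n ^+ ((n - 1) * i) := inv i 1 n0.
have ReD (x y : R[i]) : complex.Re (x + y) = complex.Re x + complex.Re y by case: x y => ? ? [].
have ReN (x : R[i]) : complex.Re (- x) = - complex.Re x by case: x.
have -> : J (grid_point R n p) = 8 * pi ^+ 2 *
    \sum_(x <- J_exponents n p) x.1%:~R * root_cos n x.2.
  rewrite J_E /J_poly !cis_frac inv1.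
  rewrite !inv ?(leq_trans _ n3)// -!exprM -!exprD !ReD !ReN -![complex.Re _]/(root_cos n _).
  rewrite /J_exponents !big_cons big_nil /=.
  congr (_ * _); rewrite !mul1r !mulN1r !addr0 ![(p.1 * _)%N]mulnC ![(p.2 * _)%N]mulnC.
  by rewrite !addrA.
congr (_ * _).
under eq_bigr => x _ do rewrite root_cos_fold//.
have foldE k : root_cos n (fold n k) = \sum_(j < 4) (fold n k == j)%:R * root_cos n j.
  have fn : (fold n k < 4)%N.
    by rewrite /fold; have := ltn_pmod k n0; move: (k %% n)%N => r rn; lia.
  rewrite (bigD1 (Ordinal fn))//= eqxx mul1r big1 ?addr0// => j jn.
  rewrite (_ : (_ == _) = false) ?mul0r//; apply: contraNF jn => /eqP e.
  by apply/eqP/val_inj.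
under eq_bigr => x _ do rewrite foldE mulr_sumr.
rewrite exchange_big; apply: eq_bigr => k _; rewrite /J_coef foldrE big_map rmorph_sum mulr_suml.
apply: eq_bigr => x _; case: eqP => _; rewrite ?mul1r//.
by rewrite mul0r mulr0.
Qed.

Lemma sum_root_cos n : (1 < n)%N -> \sum_(k < n) root_cos n k = 0.
Proof.
move=> n1; have root_n1 : unit_root R n != 1.
  apply/eqP => e; have := prim_order_dvd (cis_prim R (ltnW n1)) 1.
  by rewrite -/(unit_root R n) expr1 e eqxx dvdn1 => /eqP n1'; rewrite n1' in n1.
have := sum_root_unity (unit_root_expn R (ltnW n1)) root_n1.
by move=> /(congr1 (@complex.Re R)); rewrite raddf_sum.
Qed.

Lemma root_cos0 n : root_cos n 0 = 1.
Proof. by []. Qed.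

Lemma root_cos7 : root_cos 7 1 + root_cos 7 2 + root_cos 7 3 = - 2^-1.
Proof.
have := @sum_root_cos 7 isT; rewrite !big_ord_recl big_ord0 /= /bump /= root_cos0.
rewrite (@root_cos_fold 7 4)// (@root_cos_fold 7 5)// (@root_cos_fold 7 6)//.
rewrite -[fold 7 4]/3%N -[fold 7 5]/2%N -[fold 7 6]/1%N.
move: (root_cos 7 1) (root_cos 7 2) (root_cos 7 3) => a b c; lra.
Qed.

Lemma root_cos6 : [/\ root_cos 6 1 = 2^-1, root_cos 6 2 = - 2^-1 & root_cos 6 3 = - 1].
Proof.
have c3 : root_cos 6 3 = -1.
  rewrite root_cosE -[RHS](cospi R); congr cos; field.
  by rewrite ?pnatr_eq0.
have c2 : root_cos 6 2 = - 2^-1.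
  have e k : root_cos 3 k = root_cos 6 (2 * k).
    by rewrite !root_cosE; congr (cos (_ * _)); rewrite natrM; field.
  have := @sum_root_cos 3 isT; rewrite !big_ord_recl big_ord0 /= /bump /= !e root_cos0.
  rewrite (@root_cos_fold 6 (2 * 2))// -[fold 6 (2 * 2)]/2%N -[(2 * 1)%N]/2%N.
  by move: (root_cos 6 2) => b; lra.
split=> //; have := @sum_root_cos 6 isT; rewrite !big_ord_recl big_ord0 /= /bump /= root_cos0.
rewrite (@root_cos_fold 6 4)// (@root_cos_fold 6 5)//.
rewrite -[fold 6 4]/2%N -[fold 6 5]/1%N c2 c3.
by move: (root_cos 6 1) => b; lra.
Qed.

Lemma sum4 (F : nat -> R) : \sum_(k < 4) F k = F 0%N + F 1%N + F 2%N + F 3%N.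
Proof. by rewrite !big_ord_recl big_ord0 addr0 !addrA. Qed.

Lemma J_grid7 p : p \in grid 7 ->
  J (grid_point R 7 p) ^+ 2 = if p \in orbit7 then 784 * pi ^+ 4 else 0.
Proof.
have : all (fun p => [&& J_coef 7 p 1 == J_coef 7 p 2, J_coef 7 p 1 == J_coef 7 p 3,
    J_coef 7 p 0 == - 3 * J_coef 7 p 1 & J_coef 7 p 1 ^+ 2 == (p \in orbit7)%:R])
    (grid 7).
  by vm_compute.
move=> /allP/[apply]/and4P[/eqP c2 /eqP c3 /eqP c0 /eqP c1].
set m : R := (J_coef 7 p 1)%:~R.
have -> : J (grid_point R 7 p) = 8 * pi ^+ 2 * (m * (root_cos 7 1 + root_cos 7 2 + root_cos 7 3 - 3)).
  rewrite J_grid// (sum4 (fun k => (J_coef 7 p k)%:~R * root_cos 7 k)) -c2 -c3 c0 root_cos0 intrM -/m.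
  by congr (_ * _); ring.
rewrite root_cos7; have m2 : m ^+ 2 = (p \in orbit7)%:R by rewrite -rmorphXn c1 rmorph_nat.
have -> : (8 * pi ^+ 2 * (m * (- 2^-1 - 3))) ^+ 2 = 784 * pi ^+ 4 * m ^+ 2 by field.
by rewrite m2; case: ifP; rewrite ?mulr1 ?mulr0.
Qed.

Lemma J_grid6 p : p \in grid 6 ->
  J (grid_point R 6 p) ^+ 2 = if p \in orbit6 then 576 * pi ^+ 4 else 0.
Proof.
have : all (fun p => (2 * J_coef 6 p 0 + J_coef 6 p 1 - J_coef 6 p 2 - 2 * J_coef 6 p 3) ^+ 2
    == 36 * (p \in orbit6)%:R) (grid 6).
  by vm_compute.
move=> /allP/[apply]/eqP; have [c1 c2 c3] := root_cos6.
set m := _ - _ => m2.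
have -> : J (grid_point R 6 p) = 4 * pi ^+ 2 * m%:~R.
  rewrite J_grid// (sum4 (fun k => (J_coef 6 p k)%:~R * root_cos 6 k)) root_cos0 c1 c2 c3 /m.
  move: (J_coef 6 p 0) (J_coef 6 p 1) (J_coef 6 p 2) (J_coef 6 p 3) => a b c d.
  by rewrite !rmorphB rmorphD !rmorphM /=; field.
have -> : (4 * pi ^+ 2 * m%:~R) ^+ 2 = 16 * pi ^+ 4 * (m ^+ 2)%:~R :> R by rewrite rmorphXn; ring.
rewrite m2 rmorphM /= rmorph_nat.
by case: ifP => _; rewrite ?mulr1 ?mulr0//; ring.
Qed.

End JGrid.

Section RootMeasureSums.
Variable R : realType.
Implicit Types (A : set (torus R)) (f : torus R -> R).

Lemma bounded_J : bounded_mfun (@J R).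
Proof.
have b1 := bounded_cval1 R; have b2 := bounded_cval2 R.
have V1 := bounded_cfunV b1; have V2 := bounded_cfunV b2.
have V2X n : bounded_cfun (fun w : torus R => cval w.2 ^- n).
  have := bounded_cfunX n V2.
  by congr bounded_cfun; apply/funext => w; rewrite exprVn.
have bJ : bounded_cfun (fun w : torus R => J_poly (cval w.1) (cval w.2)).
  apply: bounded_cfunD (bounded_cfunN (bounded_cfunM (bounded_cfunX 2 b1) (V2X 3%N))).
  apply: bounded_cfunD (bounded_cfunN (bounded_cfunM (bounded_cfunX 3 b1) V2)).
  apply: bounded_cfunD (bounded_cfunN (bounded_cfunM b1 (bounded_cfunX 2 b2))).
  apply: bounded_cfunD (bounded_cfunM (bounded_cfunX 3 b1) (V2X 2%N)).
  exact: bounded_cfunD (bounded_cfunM (bounded_cfunX 2 b1) b2) (bounded_cfunM b1 (V2X 3%N)).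
have := bounded_mfunM (bounded_mfun_cst (8 * pi ^+ 2)) bJ.1.
by congr bounded_mfun; apply/funext => w; rewrite J_E.
Qed.

Lemma integral_d_root k A f : measurable A -> measurable_fun setT f ->
  (forall w, 0 <= f w) ->
  (\int[d_root R k \x d_root R k]_(w in A) (f w)%:E
   = ((k * k)%:R^-1 * \sum_(p <- grid k) f (grid_point R k p) * \1_A (grid_point R k p))%:E)%E.
Proof.
move=> mA mf f0.
rewrite integral_mkcond (eq_integral (fun w => (f w * \1_A w)%:E)); last first.
  move=> w _; rewrite patchE indicE; case: ifP => _; by rewrite ?mulr1 ?mulr0.
rewrite [LHS](@integral_unif_prod _ _ _ _ R _ _ (fun w => f w * \1_A w)).
- congr (_%:E); rewrite /mean !size_map !size_iota natrM invfM -mulrA; congr (_ * _).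
  rewrite big_map big_allpairs mulr_sumr; apply: eq_bigr => i _.
  by rewrite big_map.
- by apply: measurable_funM => //; exact: measurable_indic.
- by move=> w; rewrite mulr_ge0// indicE ler0n.
Qed.

Lemma d_root_prod k A : measurable A ->
  ((d_root R k \x d_root R k) A
   = ((k * k)%:R^-1 * \sum_(p <- grid k) \1_A (grid_point R k p))%:E)%E.
Proof.
move=> mA; have := @integral_d_root k A (fun=> 1) mA (measurable_cst _) (fun=> ler01).
rewrite integral_cst// mul1e => ->.
by congr (_ * _)%:E; apply: eq_bigr => p _; rewrite mul1r.
Qed.

Lemma integral_J2 k A : measurable A ->
  (\int[d_root R k \x d_root R k]_(w in A) (J w ^+ 2)%:E
   = ((k * k)%:R^-1 * \sum_(p <- grid k) J (grid_point R k p) ^+ 2 * \1_A (grid_point R k p))%:E)%E.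
Proof.
move=> mA; apply: (@integral_d_root k A (fun w => J w ^+ 2)) => // [|w]; last exact: sqr_ge0.
by have [] := bounded_mfunX 2 bounded_J.
Qed.

Lemma sum_J2_6 (I : torus R -> R) :
  \sum_(p <- grid 6) J (grid_point R 6 p) ^+ 2 * I (grid_point R 6 p)
  = 576 * pi ^+ 4 * \sum_(p <- orbit6) I (grid_point R 6 p).
Proof.
rewrite big_seq (eq_bigr (fun p => if p \in orbit6 then
    576 * pi ^+ 4 * I (grid_point R 6 p) else 0)) => [|p /J_grid6 ->]; last first.
  by case: ifP; rewrite ?mul0r.
rewrite -big_seq -big_mkcond -big_filter mulr_sumr; apply: perm_big.
by vm_compute.
Qed.

Lemma sum_J2_7 (I : torus R -> R) :
  \sum_(p <- grid 7) J (grid_point R 7 p) ^+ 2 * I (grid_point R 7 p)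
  = 784 * pi ^+ 4 * \sum_(p <- orbit7) I (grid_point R 7 p).
Proof.
rewrite big_seq (eq_bigr (fun p => if p \in orbit7 then
    784 * pi ^+ 4 * I (grid_point R 7 p) else 0)) => [|p /J_grid7 ->]; last first.
  by case: ifP; rewrite ?mul0r.
rewrite -big_seq -big_mkcond -big_filter mulr_sumr; apply: perm_big.
by vm_compute.
Qed.

Lemma d_diag1E A :
  (d_diag R 1 A = (3^-1 * \sum_(p <- [:: (0, 0); (1, 2); (2, 1)]%N)
     \1_A (grid_point R 3 p))%:E)%E.
Proof.
rewrite [LHS]unif_setE /mean size_map big_map; congr (_ * _)%:E.
Qed.

Lemma sum_D12 (f : 'M[int]_2 -> R) :
  (\sum_(g \in D12) (f g)%:E = (\sum_(q <- weyl_quads) f (mx_of_quad q))%:E)%E.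
Proof.
rewrite D12E -fsbig_seq ?map_inj_uniq ?big_map ?sumEFin//.
exact: mx_of_quad_inj.
Qed.

End RootMeasureSums.

Section CharacterValues.
Variable R : realType.

Definition square (w : torus R) : torus R := (circle_exp w.1 2, circle_exp w.2 2).

Definition has_values (w : torus R) (x s : R[i]) :=
  chi_rho1 w = x /\ chi_rho1 (square w) = s.

Lemma chi_power_sum w x s m n : has_values w x s ->
  chi_rho1 w ^+ m * chi_rho2 w ^+ n = power_sum m n x s.
Proof. by move=> [e1 e2]; rewrite chi_rho2E -/(square w) e1 e2. Qed.

Lemma chi_rho1_grid n i j : (0 < n)%N -> (j <= n)%N -> chi_rho1 (grid_point R n (i, j)) =
  (1 + 2 * root_cos R n i + 2 * root_cos R n j + 2 * root_cos R n (i + (n - j)))%:C.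
Proof.
move=> n0 jn.
have twice k : unit_root R n ^+ k + (unit_root R n ^+ k)^-1 = (2 * root_cos R n k)%:C.
  rewrite /root_cos -cis_frac cvalV; case: (cval _) => a b.
  by apply/eqP; rewrite eq_complex /=; apply/andP; split; apply/eqP; ring.
have eij : unit_root R n ^+ i * (unit_root R n ^+ j)^-1 = unit_root R n ^+ (i + (n - j)).
  have ej0 : unit_root R n ^+ j != 0 by rewrite expf_neq0 ?unit_root_neq0.
  by apply: (mulIf ej0); rewrite divfK// -exprD -addnA subnK// exprD unit_root_expn// mulr1.
rewrite !rmorphD rmorph1 /= -!twice /chi_rho1 !cis_frac -eij invfM invrK; ring.
Qed.

Lemma square_grid n i j : square (grid_point R n (i, j)) = grid_point R n (2 * i, 2 * j)%N.
Proof.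
have e k : circle_exp (cis (k%:R / n%:R)) 2 = cis ((2 * k)%:R / n%:R) :> circle R.
  by apply: circle_inj; rewrite -[LHS]/(cval (cis _) ^+ 2) !cis_frac -exprM mulnC.
by rewrite /square /grid_point /= !e.
Qed.

Lemma has_values_grid n i j (x s : R) : (0 < n)%N -> (2 * j <= n)%N ->
  let c k := root_cos R n (fold n k) in
  1 + 2 * c i + 2 * c j + 2 * c (i + (n - j))%N = x ->
  1 + 2 * c (2 * i)%N + 2 * c (2 * j)%N + 2 * c (2 * i + (n - 2 * j))%N = s ->
  has_values (grid_point R n (i, j)) x%:C s%:C.
Proof.
move=> n0 jn c <- <-; have jn' : (j <= n)%N by apply: leq_trans jn; rewrite leq_pmull.
have cE k : c k = root_cos R n k by rewrite /c -root_cos_fold.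
by split; rewrite ?square_grid chi_rho1_grid// !cE.
Qed.

Lemma values_order1 : has_values (grid_point R 6 (0, 0)%N) 7%:R 7%:R.
Proof.
have := @has_values_grid 6 0 0 7 7 isT isT; rewrite rmorph_nat; apply => /=.
  by rewrite root_cos0; ring.
by rewrite root_cos0; ring.
Qed.

Lemma values_order2 : has_values (grid_point R 6 (3, 0)%N) (-1) 7%:R.
Proof.
have [c1 c2 c3] := root_cos6 R.
have := @has_values_grid 6 3 0 (-1) 7 isT isT; rewrite rmorph_nat rmorphN1; apply.
  by rewrite -[fold 6 3]/3%N -[fold 6 0]/0%N -[fold 6 (3 + _)]/3%N c3 root_cos0; ring.
by rewrite -[fold 6 (2 * 3)]/0%N -[fold 6 (2 * 0)]/0%N -[fold 6 (_ + _)]/0%N root_cos0; ring.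
Qed.

Lemma values_order3 : has_values (grid_point R 6 (2, 0)%N) 1 1.
Proof.
have [c1 c2 c3] := root_cos6 R.
have := @has_values_grid 6 2 0 1 1 isT isT; rewrite rmorph1; apply.
  by rewrite -[fold 6 2]/2%N -[fold 6 0]/0%N -[fold 6 (2 + _)]/2%N c2 root_cos0; field.
by rewrite -[fold 6 (2 * 2)]/2%N -[fold 6 (2 * 0)]/0%N -[fold 6 (_ + _)]/2%N c2 root_cos0; field.
Qed.

Lemma values_order6 : has_values (grid_point R 6 (3, 1)%N) (-1) 1.
Proof.
have [c1 c2 c3] := root_cos6 R.
have := @has_values_grid 6 3 1 (-1) 1 isT isT; rewrite rmorph1 rmorphN1; apply.
  by rewrite -[fold 6 3]/3%N -[fold 6 1]/1%N -[fold 6 (3 + _)]/2%N c1 c2 c3; field.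
by rewrite -[fold 6 (2 * 3)]/0%N -[fold 6 (2 * 1)]/2%N -[fold 6 (_ + _)]/2%N c2 root_cos0; field.
Qed.

Lemma values_order7 : has_values (grid_point R 7 (1, 3)%N) 0 0.
Proof.
have c := root_cos7 R.
have := @has_values_grid 7 1 3 0 0 isT isT; rewrite rmorph0; apply.
  rewrite -[fold 7 3]/3%N -[fold 7 1]/1%N -[fold 7 (1 + _)]/2%N.
  by move: c; move: (root_cos R 7 1) (root_cos R 7 2) (root_cos R 7 3) => x y z e; lra.
rewrite -[fold 7 (2 * 3)]/1%N -[fold 7 (2 * 1)]/2%N -[fold 7 (_ + _)]/3%N.
by move: c; move: (root_cos R 7 1) (root_cos R 7 2) (root_cos R 7 3) => x y z e; lra.
Qed.

Lemma cval_circle_exp (z : circle R) (n : nat) : cval (circle_exp z n) = cval z ^+ n.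
Proof. by []. Qed.

Lemma values_order13 (zeta : circle R) : 13.-primitive_root (cval zeta) ->
  has_values (zeta, circle_exp zeta 4) (qr_trace (cval zeta)) (nqr_trace (cval zeta)) /\ has_values (circle_exp zeta 2, circle_exp zeta 7)
    (nqr_trace (cval zeta)) (qr_trace (cval zeta)).
Proof.
move=> prim; have e13 := prim_expr_order prim; set e := cval zeta in e13 *.
have root13 (w : torus R) i j i' j' : (i' <= 13)%N -> (j' <= 13)%N ->
    cval w.1 = e ^+ i -> cval w.2 = e ^+ j -> (i %% 13 = i')%N -> (j %% 13 = j')%N ->
    chi_rho1 w = 1 + e ^+ (i' %% 13) + e ^+ ((13 - i') %% 13) + e ^+ (j' %% 13)
      + e ^+ ((13 - j') %% 13) + e ^+ ((i' + (13 - j')) %% 13) + e ^+ (((13 - i') + j') %% 13).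
  move=> i13 j13 e1 e2 ei ej.
  have e1' : cval w.1 = e ^+ i' by rewrite -ei expr_mod.
  have e2' : cval w.2 = e ^+ j' by rewrite -ej expr_mod.
  by rewrite (chi_rho1_root e13 i13 j13 e1' e2') !(expr_mod _ e13).
split; split.
- by rewrite (root13 _ 1%N 4%N 1%N 4%N) ?expr1.
- have -> : nqr_trace e = 1 + e ^+ 2 + e ^+ 11 + e ^+ 8 + e ^+ 5 + e ^+ 7 + e ^+ 6.
    by rewrite /nqr_trace; ring.
  by rewrite (root13 _ 2%N 8%N 2%N 8%N) // ?cval_circle_exp -?exprM.
- have -> : nqr_trace e = 1 + e ^+ 2 + e ^+ 11 + e ^+ 7 + e ^+ 6 + e ^+ 8 + e ^+ 5.
    by rewrite /nqr_trace; ring.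
  by rewrite (root13 _ 2%N 7%N 2%N 7%N) // ?cval_circle_exp.
have -> : qr_trace e = 1 + e ^+ 4 + e ^+ 9 + e ^+ 1 + e ^+ 12 + e ^+ 3 + e ^+ 10.
  by rewrite /qr_trace; ring.
by rewrite (root13 _ 4%N 14%N 4%N 1%N) // ?cval_circle_exp -?exprM.
Qed.

End CharacterValues.

Section Spectral.
Variables (R : realType) (zeta : circle R).

Definition psl_points : seq (nat * torus R) :=
  [:: (1, grid_point R 6 (0, 0)); (91, grid_point R 6 (3, 0));
      (182, grid_point R 6 (3, 1)); (182, grid_point R 6 (2, 0));
      (468, grid_point R 7 (1, 3)); (84, (zeta, circle_exp zeta 4));
      (84, (circle_exp zeta 2, circle_exp zeta 7))]%N.

Lemma sum_psl_points (V : nmodType) (F : nat -> torus R -> V) :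
  \sum_(kt <- psl_points) F kt.1 kt.2 =
  F 1%N (grid_point R 6 (0, 0)%N) + F 91%N (grid_point R 6 (3, 0)%N)
  + F 182%N (grid_point R 6 (3, 1)%N) + F 182%N (grid_point R 6 (2, 0)%N)
  + F 468%N (grid_point R 7 (1, 3)%N) + F 84%N (zeta, circle_exp zeta 4)
  + F 84%N (circle_exp zeta 2, circle_exp zeta 7).
Proof. by rewrite /psl_points !big_cons big_nil addr0 !addrA. Qed.

Lemma size_psl : size (orbit_list psl_points) = (12 * 1092)%N.
Proof.
by rewrite size_orbit_list (sum_psl_points (fun k _ => k)).
Qed.

Lemma size_psl_gt0 : (0 < size (orbit_list psl_points))%N.
Proof. by rewrite size_psl. Qed.

Definition psl_measure : probability (torus R) R := unif_probability size_psl_gt0.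

Hypothesis hzeta : 13.-primitive_root (cval zeta).

Lemma mean_psl (f : torus R -> R[i]) :
  (forall q w, q \in weyl_quads -> f (quad_act q w) = f w) ->
  (size (orbit_list psl_points))%:R^-1 * \sum_(t <- orbit_list psl_points) f t =
  1092%:R^-1 * (f (grid_point R 6 (0, 0)%N) + 91%:R * f (grid_point R 6 (3, 0)%N)
  + 182%:R * f (grid_point R 6 (3, 1)%N) + 182%:R * f (grid_point R 6 (2, 0)%N)
  + 468%:R * f (grid_point R 7 (1, 3)%N) + 84%:R * f (zeta, circle_exp zeta 4)
  + 84%:R * f (circle_exp zeta 2, circle_exp zeta 7)).
Proof.
move=> fq; rewrite size_psl sum_orbit_list.
under eq_bigr => kt _.
  rewrite orbit_sum_cst => [|q wq]; last exact: fq.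
  rewrite -mulrnA -mulr_natr natrM mulrCA [f _ * _]mulrC -[kt.1%:R * f kt.2]/((fun k t => k%:R * f t) kt.1 kt.2).
  over.
rewrite -mulr_sumr natrM invfM mulrA [_ / _ * _]mulrAC mulVf ?pnatr_eq0// mul1r.
by rewrite (sum_psl_points (fun k t => k%:R * f t)) mul1r.
Qed.

Lemma psl_moment m n : let F := power_sum m n in
  let q := qr_trace (cval zeta) in let q' := nqr_trace (cval zeta) in
  joint_moment psl_measure m n =
  1092%:R^-1 * (F 7%:R 7%:R + 91%:R * F (-1) 7%:R + 182%:R * F 1 1 + 182%:R * F (-1) 1
    + 468%:R * F 0 0 + 84%:R * (F q q' + F q' q)).
Proof.
move=> F q q'; rewrite joint_moment_unif.
have [v13 v13'] := values_order13 hzeta.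
rewrite mean_psl => [|r w wr]; last by rewrite chi_rho1_act// chi_rho2_act.
rewrite (chi_power_sum _ _ (values_order1 R)) (chi_power_sum _ _ (values_order2 R)).
rewrite (chi_power_sum _ _ (values_order3 R)) (chi_power_sum _ _ (values_order6 R)).
rewrite (chi_power_sum _ _ (values_order7 R)).
rewrite (chi_power_sum _ _ v13) (chi_power_sum _ _ v13').
rewrite -/F -/q -/q'.
move: (F 7%:R 7%:R) (F (-1) 7%:R) (F 1 1) (F (-1) 1) (F 0 0) (F q q') (F q' q).
move=> a b c d e g h; congr (_ * _).
rewrite mulrDr !addrA; congr (_ + _ + _ + _); rewrite -!addrA; congr (_ + (_ + _)).
exact: addrC.
Qed.

Lemma psl_measureE A : psl_measure A =
  ((12 * 1092)%:R^-1 * \sum_(kt <- psl_points) orbit_sum (\1_A) kt.2 *+ kt.1)%:E.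
Proof. by rewrite [LHS]unif_setE /mean size_psl sum_orbit_list. Qed.

Lemma psl_identity (I : torus R -> R) (x6 x7 y : R) :
  x6 = \sum_(p <- orbit6) I (grid_point R 6 p) ->
  x7 = \sum_(p <- orbit7) I (grid_point R 7 p) ->
  y = \sum_(q <- weyl_quads) (I (quad_act q (zeta, circle_exp zeta 4))
      + I (quad_act q (circle_exp zeta 2, circle_exp zeta 7))) ->
  (12 * 1092)%:R^-1 * \sum_(kt <- psl_points) orbit_sum I kt.2 *+ kt.1 =
  1 / (448 * pi ^+ 4)
    * ((7 * 7)%:R^-1 * (784 * pi ^+ 4 * x7))
  + 1 / (1152 * pi ^+ 4)
    * ((6 * 6)%:R^-1 * (576 * pi ^+ 4 * x6))
  + 1 / 4 * ((3 * 3)%:R^-1 * \sum_(p <- grid 3) I (grid_point R 3 p))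
  + 1 / 9 * ((2 * 2)%:R^-1 * \sum_(p <- grid 2) I (grid_point R 2 p))
  - 22 / 819 * ((1 * 1)%:R^-1 * \sum_(p <- grid 1) I (grid_point R 1 p))
  - 1 / 12 * (3^-1 * \sum_(p <- [:: (0, 0); (1, 2); (2, 1)]%N) I (grid_point R 3 p))
  + 1 / 156 * y.
Proof.
move=> ex6 ex7; rewrite big_split => ey.
pose e := fun i j => I (grid_point R 6 (i, j)).
have os6 p s : [seq grid_act 6 p q | q <- weyl_quads] = s ->
    orbit_sum I (grid_point R 6 p) = \sum_(p' <- s) e p'.1 p'.2.
  by move=> <-; rewrite orbit_sum_grid//; apply: eq_bigr => -[].
have os7 : orbit_sum I (grid_point R 7 (1, 3)%N) = x7.
  by rewrite ex7 orbit_sum_grid//; apply: perm_big; vm_compute.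
have os6' : orbit_sum I (grid_point R 6 (3, 1)%N) = x6.
  by rewrite ex6 orbit_sum_grid//; apply: perm_big; vm_compute.
have gr k n (s s' : seq (nat * nat)) : (0 < k)%N -> (k * n = 6)%N ->
    s' = [seq (k * p.1, k * p.2)%N | p <- s] ->
    \sum_(p <- s) I (grid_point R n p) = \sum_(p <- s') e p.1 p.2.
  move=> k0 kn ->; rewrite big_map; apply: eq_bigr => -[i j] _.
  by rewrite /e -kn /= grid_point_scale.
have os1 := os6 (0, 0)%N [:: (0, 0); (0, 0); (0, 0); (0, 0); (0, 0); (0, 0); (0, 0); (0, 0); (0, 0); (0, 0); (0, 0); (0, 0)]%N erefl.
have os2 := os6 (3, 0)%N
  [:: (3, 0); (3, 3); (0, 3); (0, 3); (3, 3); (3, 0); (3, 0); (3, 3); (0, 3); (0, 3); (3, 3); (3, 0)]%N erefl.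
have os3 := os6 (2, 0)%N
  [:: (2, 0); (2, 2); (0, 4); (0, 2); (4, 4); (4, 0); (4, 0); (4, 4); (0, 2); (0, 4); (2, 2); (2, 0)]%N erefl.
have g3 := gr 2%N 3%N (grid 3) [:: (0, 0); (0, 2); (0, 4); (2, 0); (2, 2); (2, 4);
  (4, 0); (4, 2); (4, 4)]%N isT erefl erefl.
have g2 := gr 3%N 2%N (grid 2) [:: (0, 0); (0, 3); (3, 0); (3, 3)]%N isT erefl erefl.
have g1 := gr 6%N 1%N (grid 1) [:: (0, 0)]%N isT erefl erefl.
have gd := gr 2%N 3%N [:: (0, 0); (1, 2); (2, 1)]%N
  [:: (0, 0); (2, 4); (4, 2)]%N isT erefl erefl.
rewrite g3 g2 g1 gd {g3 g2 g1 gd}.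
rewrite (sum_psl_points (fun k t => orbit_sum I t *+ k)) os1 os2 os3 os7 os6' {os1 os2 os3 os7 os6' os6 gr}.
move: ey; rewrite -/(orbit_sum I (zeta, circle_exp zeta 4)) -/(orbit_sum I (circle_exp zeta 2, circle_exp zeta 7)).
move: (orbit_sum I (zeta, circle_exp zeta 4)) (orbit_sum I (circle_exp zeta 2, circle_exp zeta 7)).
move=> y1 y2 -> /=; rewrite !big_cons !big_nil /=.
move: (e 0 0) (e 0 2) (e 0 4) (e 2 0) (e 2 2) (e 2 4) (e 4 0) (e 4 2) (e 4 4)
  (e 0 3) (e 3 0) (e 3 3) => a00 a02 a04 a20 a22 a24 a40 a42 a44 a03 a30 a33.
have : pi != 0 :> R by rewrite gt_eqF ?pi_gt0.
move: (pi : R) => P P0.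
by field; rewrite P0.
Qed.

End Spectral.

Local Open Scope ereal_scope.
Theorem theorem4p6 (R : realType) (iota : G2_embedding R (PSL2 'F_13))
    (zeta : circle R) (hzeta : 13.-primitive_root (cval zeta)) :
  exists eps : probability (torus R) R,
    joint_spectral_measure iota eps /\
    forall A : set (torus R), measurable A ->
      eps A =
        (1 / (448 * pi ^+ 4))%R%:E
          * (\int[d_root R 7 \x d_root R 7]_(w in A) (J w ^+ 2)%R%:E)
        + (1 / (1152 * pi ^+ 4))%R%:E
          * (\int[d_root R 6 \x d_root R 6]_(w in A) (J w ^+ 2)%R%:E)
        + (1 / 4)%R%:E * (d_root R 3 \x d_root R 3) A
        + (1 / 9)%R%:E * (d_root R 2 \x d_root R 2) A
        - (22 / 819)%R%:E * (d_root R 1 \x d_root R 1) A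
        - (1 / 12)%R%:E * d_diag R 1 A
        + (1 / 156)%R%:E
          * \sum_(g \in D12)
              ((\d_(torus_act g (zeta, circle_exp zeta 4)) A : \bar R)
               + \d_(torus_act g (circle_exp zeta 2, circle_exp zeta 7)) A).
Proof.
exists (psl_measure zeta); split.
  have inv : D12_invariant (psl_measure zeta) by exact: D12_invariant_orbit_list.
  have mom m n : joint_moment (psl_measure zeta) m n = mckay_moment iota m n.
    by rewrite mckay_moment_avg (moment_table iota m n hzeta) psl_moment.
  split.
    split=> // m n; split=> //.
    by rewrite mckay_moment_avg class_moment_avg.
  move=> eps' [inv' spec'] A mA.
  have mom' m n : joint_moment eps' m n = joint_moment (psl_measure zeta) m n.
    by rewrite (spec' m n).1 -mom.
  exact: (invariant_measure_unique inv' inv mom' mA).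
move=> A mA.
rewrite psl_measureE !integral_J2// sum_J2_6 sum_J2_7 !d_root_prod// d_diag1E.
rewrite (sum_D12 (fun g => \1_A (torus_act g (zeta, circle_exp zeta 4))
  + \1_A (torus_act g (circle_exp zeta 2, circle_exp zeta 7)))%R).
rewrite -!EFinM -!EFinN -!EFinD; congr (_%:E).
exact: (psl_identity (I := \1_A) erefl erefl erefl).
Qed.
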